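(* Let $B=2\pi/\sqrt{6}$ and, for integers $n\ge 0$ and $\ell\ge 0$, let $Q_1(n,\ell)=2n(3n+1)+3n\ell$ and $Q_2(n,\ell)=Q_1(n,\ell)+8n+4+2\ell$. Define $$I_M(\ell,N)=\sum_{n\ge 0}\left(e^{-\frac{BQ_1(n,\ell)}{2\sqrt{N}}}-e^{-\frac{BQ_2(n,\ell)}{2\sqrt{N}}}\right).$$ Then, uniformly for integers $0\le \ell\le \sqrt{N}(\log N)^2$, as $N\to\infty$, $$\frac{1}{p(N)}V_d\left(\ell,\,N+\frac{\ell(\ell+1)}{2}\right)=I_M(\ell,N)+O\left(N^{-1/5}\right).$$
   Context: A strongly concave composition of a nonnegative integer $n$ is a finite sequence of nonnegative integers $(a_1,\dots,a_s)$, $s\ge 1$, summing to $n$, such that for some index $k$ with $1\le k\le s$ one has $a_1>a_2>\dots>a_{k-1}>a_k<a_{k+1}<\dots<a_s$. Its rank is $s-2k+1$. $V_d(m,n)$ denotes the number of strongly concave compositions of $n$ with rank $m$. $p(n)$ is the partition function, with $p(n)=0$ for negative $n$. *)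

(* Defs.v *)
From Stdlib Require Import Reals List Arith ZArith Bool.
Import ListNotations.
Local Open Scope bool_scope.
Local Open Scope nat_scope.

Fixpoint lists_of (len maxv : nat) : list (list nat) :=
  match len with
  | O => [nil]
  | S l => flat_map (fun x => map (cons x) (lists_of l maxv)) (seq 0 (S maxv))
  end.

(* [sc_at a k] : with 1-based index k (1 <= k <= s = length a),
   a_1 > ... > a_{k-1} > a_k < a_{k+1} < ... < a_s. *)
Definition sc_at (a : list nat) (k : nat) : bool :=
  (1 <=? k) && (k <=? length a) &&
  forallb (fun i => if i + 1 <? k then nth (i+1) a 0 <? nth i a 0
                    else nth i a 0 <? nth (i+1) a 0)
          (seq 0 (length a - 1)).

Definition is_scc_rank (n : nat) (m : Z) (a : list nat) : bool :=
  (list_sum a =? n) &&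
  existsb (fun k => sc_at a k &&
             (Z.of_nat (length a) - 2 * Z.of_nat k + 1 =? m)%Z)
          (seq 1 (length a)).

(* V_d(m,n): number of strongly concave compositions of n with rank m.
   Every such composition has length s <= 2n+1 and entries <= n, so the
   enumeration below is exhaustive (and duplicate-free). *)
Definition Vd (m : Z) (n : nat) : nat :=
  length (filter (is_scc_rank n m)
                 (flat_map (fun l => lists_of l n) (seq 1 (2 * n + 1)))).

Fixpoint noninc (a : list nat) : bool :=
  match a with
  | x :: ((y :: _) as t) => (y <=? x) && noninc t
  | _ => true
  end.

Definition is_partition (n : nat) (a : list nat) : bool :=
  (list_sum a =? n) && noninc a && forallb (fun x => 1 <=? x) a.

Definition part (n : nat) : nat :=
  length (filter (is_partition n)
                 (flat_map (fun l => lists_of l n) (seq 0 (S n)))).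

Open Scope R_scope.

Definition Bconst : R := 2 * PI / sqrt 6.

Definition Q1 (n l : nat) : R := 2 * INR n * (3 * INR n + 1) + 3 * INR n * INR l.
Definition Q2 (n l : nat) : R := Q1 n l + 8 * INR n + 4 + 2 * INR l.

Definition IM_term (l N : nat) (n : nat) : R :=
  exp (- (Bconst * Q1 n l) / (2 * sqrt (INR N)))
  - exp (- (Bconst * Q2 n l) / (2 * sqrt (INR N))).

(* Main.v *)
(** Sorting the compositions of rank [l] by the number [k] of entries left of the
    minimum gives the generating function
    [q^(l(l+1)/2) sum_k q^(k(k+l+1)) / ((q)_k (q)_(k+l) (1 - q^(2k+l+1)))].
    The sum [W_l] in it satisfies [W_l = (1 - q^(2l+4)) / (q)_oo + q^(3l+8) W_(l+4)]
    by the Durfee rectangle identity, whence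
    [V_d(l, N + l(l+1)/2) = sum_n (p(N - Q1 n l) - p(N - Q2 n l))].

    With [t = PI / sqrt (6 M)], Cauchy's integral on [|q| = e^(-t)] expresses [p(M)] and
    [p(M-1)] through the same modulus [R] and phase; since [int R th = O(t^3)] while the
    integral for [p(M)] is at least [c t^(3/2)], one gets
    [p(M-1)/p(M) = exp (-t + O(t^(3/2)))].  Hence the total variation of
    [j |-> p(N-j)/p(N) - exp (-j t)] is [O(N^(-1/4))], and this bounds the error because
    the intervals [[Q1 n l, Q2 n l)] are disjoint for [n >= 0]. *)

From Coquelicot Require Import Coquelicot.
Require Import Defs.
From Stdlib Require Import Reals List Arith ZArith.
From Stdlib Require Import Bool Permutation Lia Lra.
Import ListNotations.

(** * A recurrence for the generating function *)

Local Open Scope Z_scope.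

(** Only ratios of partition numbers enter, so the normalising product cancels and a lower bound for
    one integral suffices. Since [p(n)] counts partitions into parts at most [J] as soon as
    [n <= J], the analysis concerns finite products, whose factors have explicit real modulus and
    argument. The phase of the product has slope about PI^2/(6 t^2) at 0; t = PI / sqrt (6 M) makes
    it stationary against e^(-i M th). Stationarity is required up to O(1/t), so that the phase
    error for th <= A t^(3/2) is O(sqrt t). This calls for the Basel sum with error O(1/K), not only
    for its value. Half powers of t are avoided by writing t = s^2. The modulus is majorised by C
    t^6 / (t^3 + th^2)^2, which has the true width t^(3/2) of the peak and an elementary first
    moment. A pointwise error O(N^(-1/4)) for the ratios would be lost in the sum over n: at l = 0
    about N^(1/4) terms matter. This is why the variation is estimated. *)

Fixpoint zsum (f : nat -> Z) (n : nat) : Z :=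
  match n with O => 0 | S m => zsum f m + f m end.

Lemma zsum_ext (f g : nat -> Z) n :
  (forall i, (i < n)%nat -> f i = g i) -> zsum f n = zsum g n.
Proof. induction n as [|n IH]; intros H; simpl; [easy|]. rewrite IH, H by auto with arith. reflexivity. Qed.

Lemma zsum_0 (f : nat -> Z) n : (forall i, (i < n)%nat -> f i = 0) -> zsum f n = 0.
Proof. induction n as [|n IH]; intros H; simpl; [easy|]. rewrite IH, H by auto with arith. reflexivity. Qed.

Lemma zsum_add (f g : nat -> Z) n : zsum (fun i => f i + g i) n = zsum f n + zsum g n.
Proof. induction n; simpl; lia. Qed.

Lemma zsum_sub (f g : nat -> Z) n : zsum (fun i => f i - g i) n = zsum f n - zsum g n.
Proof. induction n; simpl; lia. Qed.

Lemma zsum_recl (f : nat -> Z) n : zsum f (S n) = f O + zsum (fun i => f (S i)) n.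
Proof. induction n as [|n IH]; [simpl; lia|]. change (zsum f (S (S n))) with (zsum f (S n) + f (S n)). rewrite IH. simpl. lia. Qed.

Lemma zsum_extend (f : nat -> Z) n m :
  (n <= m)%nat -> (forall i, (n <= i < m)%nat -> f i = 0) -> zsum f m = zsum f n.
Proof.
  induction m as [|m IH]; intros Hnm H.
  - replace n with 0%nat by lia. reflexivity.
  - destruct (Nat.eq_dec n (S m)) as [->|Hne]; [reflexivity|].
    simpl. rewrite IH, (H m); try lia. intros i Hi; apply H; lia.
Qed.

(* A formal power series in [q] is represented by its coefficient function
   [Z -> Z], required to vanish at negative arguments; multiplication by [q^s]
   is then [fun n => f (n - s)] and division by [1 - q^s] is [geo s]. *)
Definition causal (f : Z -> Z) : Prop := forall n, n < 0 -> f n = 0.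

Definition geo (s : nat) (f : Z -> Z) (n : Z) : Z :=
  zsum (fun i => f (n - Z.of_nat (i * s))) (S (Z.to_nat n)).

Lemma geo_causal s f : causal f -> causal (geo s f).
Proof. intros Hf n Hn. apply zsum_0. intros; apply Hf; lia. Qed.

Lemma geo_step s f : causal f -> (0 < s)%nat -> forall n, geo s f n = f n + geo s f (n - Z.of_nat s).
Proof.
  intros Hf Hs n. unfold geo at 1. rewrite zsum_recl. f_equal.
  - f_equal. lia.
  - unfold geo.
    rewrite (zsum_ext _ (fun i => f (n - Z.of_nat s - Z.of_nat (i * s)))) by (intros; f_equal; lia).
    destruct (Z_lt_ge_dec n (Z.of_nat s)) as [H|H].
    + rewrite !zsum_0; trivial; intros; apply Hf; lia.
    + apply zsum_extend; [lia|]. intros i Hi. apply Hf. nia.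
Qed.

(** Cancellation of a factor 1 - q^s, by which identities between quotients are proved below.
    Descending by [s] at each step ends at negative arguments, where both series vanish. *)
Lemma causal_unique s f g : (0 < s)%nat -> causal f -> causal g ->
  (forall n, f n - f (n - Z.of_nat s) = g n - g (n - Z.of_nat s)) -> forall n, f n = g n.
Proof.
  intros Hs Hf Hg H.
  assert (K : forall b : nat, forall n, n < Z.of_nat b -> f n = g n).
  { induction b as [|b IH]; intros n Hn.
    - rewrite Hf, Hg by lia. reflexivity.
    - specialize (H n). specialize (IH (n - Z.of_nat s)). lia. }
  intros n. apply (K (S (Z.to_nat n))). lia.
Qed.

(* Coefficients of [1 / ((q)_k (q)_l)]. *)
Fixpoint qinv2 (k l : nat) : Z -> Z :=
  match l with
  | O => (fix g (k : nat) : Z -> Z :=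
           match k with
           | O => fun n => if n =? 0 then 1 else 0
           | S k' => geo (S k') (g k')
           end) k
  | S l' => geo (S l') (qinv2 k l')
  end.

Lemma qinv2_causal k l : causal (qinv2 k l).
Proof.
  induction l as [|l IH]; [|now apply geo_causal].
  induction k as [|k IH]; [|now apply (geo_causal (S k))].
  intros n Hn. simpl. destruct (Z.eqb_spec n 0); lia.
Qed.

Lemma qinv2_Sr k l n : qinv2 k (S l) n = qinv2 k l n + qinv2 k (S l) (n - Z.of_nat (S l)).
Proof. apply (geo_step (S l)); [apply qinv2_causal|lia]. Qed.

(** The recursion strips the factors of (q)_l before those of (q)_k. Multiplying by 1 - q^(l+1)
    carries the step in [k] past them, so both indices can be treated alike. *)
Lemma qinv2_Sl k l : forall n, qinv2 (S k) l n = qinv2 k l n + qinv2 (S k) l (n - Z.of_nat (S k)).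
Proof.
  induction l as [|l IH]; intros n.
  - apply (geo_step (S k)); [apply (qinv2_causal k 0)|lia].
  - cut (qinv2 (S k) (S l) n - qinv2 (S k) (S l) (n - Z.of_nat (S k)) = qinv2 k (S l) n); [lia|].
    revert n.
    apply (causal_unique (S l)); [lia| |apply qinv2_causal|].
    + intros n Hn. rewrite !qinv2_causal by lia. reflexivity.
    + intros n.
      rewrite (qinv2_Sr (S k) l n), (qinv2_Sr k l n), (qinv2_Sr (S k) l (n - Z.of_nat (S k))), (IH n).
      replace (n - Z.of_nat (S k) - Z.of_nat (S l)) with (n - Z.of_nat (S l) - Z.of_nat (S k)) by lia.
      lia.
Qed.

(* Partitions of [n] into parts of size at most [k]. *)
Definition pk (k : nat) (n : Z) : Z := qinv2 0 k n.

(** The partition function, extended by zero to negative arguments: parts exceeding [n] cannot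
    occur. *)
Definition pz (n : Z) : Z := pk (Z.to_nat n) n.

Lemma pk_S k n : pk (S k) n = pk k n + pk (S k) (n - Z.of_nat (S k)).
Proof. apply qinv2_Sr. Qed.

Lemma pk_neg k n : n < 0 -> pk k n = 0.
Proof. apply qinv2_causal. Qed.

(** Admitting a part size beyond [n] adds only a value at a negative argument. The analytic half
    relies on this to replace 1/(q)_oo by a finite product. *)
Lemma pk_stable k n : n <= Z.of_nat k -> pk k n = pz n.
Proof.
  unfold pz. intros H.
  destruct (Z_lt_ge_dec n 0) as [Hn|Hn]; [rewrite !pk_neg by lia; reflexivity|].
  assert (K : forall d, pk (Z.to_nat n + d) n = pk (Z.to_nat n) n).
  { induction d as [|d IH]; [now rewrite Nat.add_0_r|].
    rewrite Nat.add_succ_r, pk_S, IH, (pk_neg _ (n - _)) by lia. lia. }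
  rewrite <- (K (k - Z.to_nat n)%nat). f_equal. lia.
Qed.

Lemma pz_neg n : n < 0 -> pz n = 0.
Proof. apply pk_neg. Qed.

Lemma pk0_sym k : forall n, qinv2 k 0 n = pk k n.
Proof.
  induction k as [|k IH]; intros n; [reflexivity|]. revert n.
  apply (causal_unique (S k)); [lia|apply qinv2_causal|apply qinv2_causal|].
  intros n. rewrite (qinv2_Sl k 0 n), (pk_S k n), IH. lia.
Qed.

(** * The Durfee rectangle identity *)

Definition durfee_term (j : nat) (n : Z) (k : nat) : Z :=
  qinv2 k (k + j) (n - Z.of_nat (k * (k + j))).

(** Coefficient of the sum over k of q^(k(k+j)) / ((q)_k (q)_(k+j)), which sorts partitions by their
    largest rectangle of shape k by k+j. Its value 1/(q)_oo, for every [j], is derived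
    algebraically. *)
Definition durfee (j : nat) (n : Z) : Z := zsum (durfee_term j n) (S (Z.to_nat n)).

Lemma durfee_sum j n K : n <= Z.of_nat K -> zsum (durfee_term j n) (S K) = durfee j n.
Proof.
  intros H. apply zsum_extend; [lia|]. intros i Hi. apply qinv2_causal. nia.
Qed.

Lemma durfee_neg j n : n < 0 -> durfee j n = 0.
Proof. intros H. apply zsum_0. intros i Hi. apply qinv2_causal. lia. Qed.

(** With D_j for the series, D_j - D_(j+1) + q^(j+1) D_(j+1) has k-th term q^(k(k+j)) (1 - q^k) /
    ((q)_k (q)_(k+j+1)). This vanishes at k = 0, and 1 - q^k lowers (q)_k; replacing k by k+1 turns
    the sum into q^(j+1) D_(j+2). *)
Lemma durfee_rec j n :
  durfee j n - durfee (S j) n =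
  - (durfee (S j) (n - Z.of_nat (S j)) - durfee (S (S j)) (n - Z.of_nat (S j))).
Proof.
  set (K := Z.to_nat n).
  rewrite <- (durfee_sum j n (S K)), <- (durfee_sum (S j) n (S K)),
    <- (durfee_sum (S j) (n - _) (S K)), <- (durfee_sum (S (S j)) (n - _) K) by lia.
  enough (E : zsum (durfee_term j n) (S (S K)) - zsum (durfee_term (S j) n) (S (S K))
    + zsum (durfee_term (S j) (n - Z.of_nat (S j))) (S (S K))
    = zsum (durfee_term (S (S j)) (n - Z.of_nat (S j))) (S K)) by lia.
  rewrite <- zsum_sub, <- zsum_add, zsum_recl.
  assert (E0 : forall k, durfee_term j n k - durfee_term (S j) n k + durfee_term (S j) (n - Z.of_nat (S j)) k
     = qinv2 k (S (k + j)) (n - Z.of_nat (k * (k + j))) - qinv2 k (S (k + j)) (n - Z.of_nat (k * (k + j)) - Z.of_nat k)).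
  { intros k. unfold durfee_term. rewrite Nat.add_succ_r.
    rewrite (qinv2_Sr k (k + j) (n - Z.of_nat (k * (k + j)))).
    replace (n - Z.of_nat (k * (k + j)) - Z.of_nat (S (k + j))) with
      (n - Z.of_nat (S j) - Z.of_nat (k * S (k + j))) by nia.
    replace (n - Z.of_nat (k * (k + j)) - Z.of_nat k) with (n - Z.of_nat (k * S (k + j))) by nia.
    lia. }
  rewrite E0. simpl (0 * _)%nat.
  replace (n - Z.of_nat 0 - Z.of_nat 0) with (n - Z.of_nat 0) by lia.
  rewrite Z.sub_diag, Z.add_0_l. apply zsum_ext. intros k _.
  rewrite E0, (qinv2_Sl k). unfold durfee_term.
  rewrite Z.add_simpl_r. f_equal; [lia|]. nia.
Qed.

(** The recurrence moves the difference to the smaller argument n - (j+1), hence eventually to a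
    negative one. The index [j] grows along the way, so it is quantified inside the induction. *)
Lemma durfee_eq n : forall j, durfee j n = durfee (S j) n.
Proof.
  assert (K : forall b : nat, forall n, n < Z.of_nat b -> forall j, durfee j n = durfee (S j) n).
  { induction b as [|b IH]; intros m Hm j.
    - rewrite !durfee_neg by lia. reflexivity.
    - pose proof (durfee_rec j m) as E.
      rewrite (IH (m - Z.of_nat (S j))) in E by lia. lia. }
  apply (K (S (Z.to_nat n))). lia.
Qed.

(** The value does not depend on the index, and once the index is at least [n] no rectangle with k
    >= 1 fits: only k = 0 remains. *)
Lemma durfee_pz j n : durfee j n = pz n.
Proof.
  destruct (Z_lt_ge_dec n 0) as [Hn|Hn]; [now rewrite durfee_neg, pz_neg|].
  assert (E : forall i, durfee j n = durfee (j + i) n).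
  { induction i as [|i IH]; [now rewrite Nat.add_0_r|]. rewrite IH, durfee_eq. f_equal; lia. }
  rewrite (E (Z.to_nat n)). unfold durfee. rewrite zsum_recl, (zsum_0 (fun i => _ (S i))).
  - unfold durfee_term. simpl (0 * _)%nat. rewrite Z.sub_0_r, Z.add_0_r.
    apply pk_stable. lia.
  - intros i _. apply qinv2_causal. nia.
Qed.

(* [geo] sums over the value of the minimum: raising it by one raises all
   [2k + l + 1] entries. *)
Definition conc_term (l : nat) (n : Z) (k : nat) : Z :=
  geo (2 * k + l + 1) (qinv2 k (k + l)) (n - Z.of_nat (k * (k + l + 1))).

(** Coefficients of the sum [W_l]. The range of k suffices because q^(k(k+l+1)) divides the k-th
    term. *)
Definition conc (l : nat) (n : Z) : Z := zsum (conc_term l n) (S (Z.to_nat n)).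

Lemma conc_term_neg l n k : n < Z.of_nat (k * (k + l + 1)) -> conc_term l n k = 0.
Proof. intros H. apply geo_causal; [apply qinv2_causal|lia]. Qed.

Lemma conc_sum l n K : n <= Z.of_nat K -> zsum (conc_term l n) (S K) = conc l n.
Proof. intros H. apply zsum_extend; [lia|]. intros i Hi. apply conc_term_neg. nia. Qed.

Lemma conc_neg l n : n < 0 -> conc l n = 0.
Proof. intros H. apply zsum_0. intros i Hi. apply conc_term_neg. lia. Qed.

(** Expands the fraction by 1 - q^(l+1). Together with the analogue in [k] it brings summands with
    different indices over one denominator. *)
Lemma geo_qinv2_Sr s k l n : (0 < s)%nat ->
  geo s (qinv2 k l) n = geo s (qinv2 k (S l)) n - geo s (qinv2 k (S l)) (n - Z.of_nat (S l)).
Proof.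
  intros Hs. revert n. apply (causal_unique s); [easy| | |].
  - apply geo_causal, qinv2_causal.
  - intros n Hn. rewrite !(geo_causal s _ (qinv2_causal k (S l))) by lia. reflexivity.
  - intros n. rewrite !(geo_step s _ (qinv2_causal _ _) Hs n),
      (geo_step s _ (qinv2_causal _ _) Hs (n - Z.of_nat (S l))), (qinv2_Sr k l n).
    replace (n - Z.of_nat (S l) - Z.of_nat s) with (n - Z.of_nat s - Z.of_nat (S l)) by lia. lia.
Qed.

Lemma geo_qinv2_Sl s k l n : (0 < s)%nat ->
  geo s (qinv2 k l) n = geo s (qinv2 (S k) l) n - geo s (qinv2 (S k) l) (n - Z.of_nat (S k)).
Proof.
  intros Hs. revert n. apply (causal_unique s); [easy| | |].
  - apply geo_causal, qinv2_causal.
  - intros n Hn. rewrite !(geo_causal s _ (qinv2_causal (S k) l)) by lia. reflexivity.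
  - intros n. rewrite !(geo_step s _ (qinv2_causal _ _) Hs n),
      (geo_step s _ (qinv2_causal _ _) Hs (n - Z.of_nat (S k))), (qinv2_Sl k l n).
    replace (n - Z.of_nat (S k) - Z.of_nat s) with (n - Z.of_nat s - Z.of_nat (S k)) by lia. lia.
Qed.

(** Term of the sum over k of q^(k(k+l+1)) / ((q)_k (q)_(k+l+2)), which mediates between [conc] and
    [durfee]. *)
Definition shifted_term (l : nat) (n : Z) (k : nat) : Z :=
  qinv2 k (k + l + 2) (n - Z.of_nat (k * (k + l + 1))).

(* With [x = q^k], [y = q^l], everything rests on
   [(1-q x y)(1-q^2 x y) - q^2 y (1-x)(1-x/q) = (1 - q^2 y)(1 - q x^2 y)]. *)
Lemma conc_term_rec l n k :
  conc_term l n (S (S k)) - conc_term (l + 4) (n - Z.of_nat (8 + 3 * l)) k =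
  shifted_term l n (S (S k)) - shifted_term l (n - Z.of_nat (l + 2)) (S (S k)).
Proof.
  unfold conc_term, shifted_term.
  set (m := n - Z.of_nat (S (S k) * (S (S k) + l + 1))).
  replace (n - Z.of_nat (l + 2) - Z.of_nat (S (S k) * (S (S k) + l + 1))) with (m - Z.of_nat (l + 2)) by (unfold m; lia).
  replace (n - Z.of_nat (8 + 3 * l) - Z.of_nat (k * (k + (l + 4) + 1))) with (m - Z.of_nat (l + 2)) by (unfold m; nia).
  replace (2 * k + (l + 4) + 1)%nat with (2 * S (S k) + l + 1)%nat by lia.
  replace (S (S k) + l + 2)%nat with (S (S (k + l + 2))) by lia.
  replace (S (S k) + l)%nat with (k + l + 2)%nat by lia.
  replace (k + (l + 4))%nat with (S (S (k + l + 2))) by lia.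
  set (s := (2 * S (S k) + l + 1)%nat).
  assert (Hs : (0 < s)%nat) by (unfold s; lia).
  set (L := (k + l + 2)%nat).
  (* Common denominator (q)_(k+2) (q)_(k+l+4) (1 - q^s): all four terms become combinations of
     shifts of [X], and the identity becomes linear. *)
  pose (X := geo s (qinv2 (S (S k)) (S (S L)))).
  assert (EX : forall a, qinv2 (S (S k)) (S (S L)) a = X a - X (a - Z.of_nat s)).
  { intros a. unfold X. rewrite (geo_step s _ (qinv2_causal _ _) Hs a). lia. }
  rewrite !EX, !(geo_qinv2_Sr s _ L), !(geo_qinv2_Sr s _ (S L)), !(geo_qinv2_Sl s k), !(geo_qinv2_Sl s (S k)) by easy.
  fold X.
  replace (m - Z.of_nat (S L) - Z.of_nat (S (S L))) with (m - Z.of_nat (l + 2) - Z.of_nat s) by (unfold L, s; lia).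
  replace (m - Z.of_nat (l + 2) - Z.of_nat (S k) - Z.of_nat (S (S k))) with (m - Z.of_nat s) by (unfold s; lia).
  replace (m - Z.of_nat (l + 2) - Z.of_nat (S k)) with (m - Z.of_nat (S L)) by (unfold L; lia).
  replace (m - Z.of_nat (l + 2) - Z.of_nat (S (S k))) with (m - Z.of_nat (S (S L))) by (unfold L; lia).
  lia.
Qed.

(** At k = 0 and k = 1, that is x = 1 and x = q, the factor (1-x)(1-x/q) vanishes, so no term of
    W_(l+4) takes part. Here 1 - q^(l+1) is itself the next factor after (q)_l; for k = 1 the same
    happens once 1 - q^(l+2) has been cleared. *)
Lemma conc_term_rec0 l n :
  conc_term l n 0 = shifted_term l n 0 - shifted_term l (n - Z.of_nat (l + 2)) 0.
Proof.
  unfold conc_term, shifted_term. rewrite !Nat.mul_0_l. change (Z.of_nat 0) with 0. rewrite !Z.sub_0_r, !Nat.add_0_l.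
  replace (l + 2)%nat with (S (S l)) by lia. replace (2 * 0 + l + 1)%nat with (S l) by lia. replace (l + 1)%nat with (S l) by lia.
  change (geo (S l) (qinv2 0 l)) with (qinv2 0 (S l)).
  rewrite (qinv2_Sr 0 (S l) n). lia.
Qed.

Lemma conc_term_rec1 l n :
  conc_term l n 1 = shifted_term l n 1 - shifted_term l (n - Z.of_nat (l + 2)) 1.
Proof.
  unfold conc_term, shifted_term.
  replace (1 + l + 2)%nat with (S (S (S l))) by lia.
  replace (2 * 1 + l + 1)%nat with (S (S (S l))) by lia.
  rewrite (geo_qinv2_Sr _ 1 (1 + l)) by lia.
  change (geo (S (S (S l))) (qinv2 1 (S (1 + l)))) with (qinv2 1 (S (S (S l)))).
  f_equal. f_equal. lia.
Qed.

(** In q^(k(k+l+1)) = q^(k(k+l+2)) q^(-k) write q^(-k) = 1 + q^(-k) (1 - q^k). The first part is the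
    Durfee sum for l+2; the second, after k becomes k+1, is q^(l+2) times the one for l+3. *)
Lemma shifted_sum l n K : n <= Z.of_nat K ->
  zsum (shifted_term l n) (S (S K)) = pz n + pz (n - Z.of_nat (l + 2)).
Proof.
  intros HK.
  rewrite <- (durfee_pz (l + 2) n), <- (durfee_pz (l + 3)), <- (durfee_sum (l + 2) n (S K)),
    <- (durfee_sum (l + 3) _ K) by lia.
  rewrite !(zsum_recl _ (S K)), <- Z.add_assoc, <- zsum_add. f_equal.
  apply zsum_ext. intros k _. unfold shifted_term, durfee_term.
  replace (S k + l + 2)%nat with (k + (l + 3))%nat by lia.
  replace (S k + (l + 2))%nat with (k + (l + 3))%nat by lia.
  rewrite (qinv2_Sl k). rewrite Z.add_comm. f_equal; f_equal; nia.
Qed.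

(** Summing the termwise identities, W_l - q^(3l+8) W_(l+4) is 1 - q^(l+2) times the sum of
    [shifted_term], which is (1 + q^(l+2)) / (q)_oo; the two factors multiply to 1 - q^(2l+4). *)
Lemma conc_rec l n :
  conc l n = pz n - pz (n - Z.of_nat (4 + 2 * l)) + conc (l + 4) (n - Z.of_nat (8 + 3 * l)).
Proof.
  set (K := Z.to_nat n).
  rewrite <- (conc_sum l n (S (S K))), <- (conc_sum (l + 4) _ K) by lia.
  pose proof (shifted_sum l n (S K)) as E1.
  pose proof (shifted_sum l (n - Z.of_nat (l + 2)) (S K)) as E2.
  rewrite !(zsum_recl _ (S (S K))), !(zsum_recl _ (S K)) in *.
  assert (E3 : zsum (fun i => conc_term l n (S (S i))) (S K) - zsum (conc_term (l + 4) (n - Z.of_nat (8 + 3 * l))) (S K)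
    = zsum (fun i => shifted_term l n (S (S i))) (S K) - zsum (fun i => shifted_term l (n - Z.of_nat (l + 2)) (S (S i))) (S K)).
  { rewrite <- !zsum_sub. apply zsum_ext. intros i _. apply conc_term_rec. }
  rewrite conc_term_rec0, conc_term_rec1.
  replace (n - Z.of_nat (4 + 2 * l)) with (n - Z.of_nat (l + 2) - Z.of_nat (l + 2)) by lia.
  lia.
Qed.

(** The shift accumulated by n uses of the recurrence, namely the sum of 8 + 3 (l + 4 i) over i < n;
    [q2] adds the 4 + 2 (l + 4 n) of the next use. *)
Definition q1 (n l : nat) : nat := 2 * n * (3 * n + 1) + 3 * n * l.
Definition q2 (n l : nat) : nat := q1 n l + 8 * n + 4 + 2 * l.

Lemma conc_partial l N M :
  conc l N = zsum (fun n => pz (N - Z.of_nat (q1 n l)) - pz (N - Z.of_nat (q2 n l))) M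
    + conc (l + 4 * M) (N - Z.of_nat (q1 M l)).
Proof.
  induction M as [|M IH].
  - simpl zsum. unfold q1. simpl. f_equal; lia.
  - rewrite IH, conc_rec. simpl zsum. rewrite <- Z.add_assoc. f_equal.
    f_equal; [|f_equal; [lia|unfold q1; nia]].
    f_equal. f_equal. unfold q2, q1; nia.
Qed.

(** Since [q1 M l >= M], the remainder after more than [N] steps sits at a negative argument. *)
Lemma conc_formula l N M : N < Z.of_nat M ->
  conc l N = zsum (fun n => pz (N - Z.of_nat (q1 n l)) - pz (N - Z.of_nat (q2 n l))) M.
Proof.
  intros H. rewrite (conc_partial l N M), conc_neg; [lia|]. unfold q1. nia.
Qed.

(** * Cauchy products of partition series *)

Definition conv (f g : Z -> Z) (n : Z) : Z :=
  zsum (fun i => f (Z.of_nat i) * g (n - Z.of_nat i)) (S (Z.to_nat n)).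

Lemma conv_extend f g n K : causal g -> n <= Z.of_nat K ->
  zsum (fun i => f (Z.of_nat i) * g (n - Z.of_nat i)) (S K) = conv f g n.
Proof. intros Hg H. apply zsum_extend; [lia|]. intros i Hi. rewrite Hg by lia. lia. Qed.

(** Distributing a total over the two flanks of a composition gives this convolution; [s1] and [s2]
    will be the sums of the smallest admissible flanks. Induction on [l] strips the factors of the
    second series. *)
Lemma conv_pk k l s1 s2 : forall n, 0 <= s1 -> 0 <= s2 ->
  conv (fun i => pk k (i - s1)) (fun i => pk l (i - s2)) n = qinv2 k l (n - s1 - s2).
Proof.
  intros n H1 H2. revert n. 
  assert (C : forall l, causal (fun i => pk l (i - s2))) by (intros l' n Hn; apply pk_neg; lia).
  assert (Cc : forall l, causal (conv (fun i => pk k (i - s1)) (fun i => pk l (i - s2)))).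
  { intros l' n Hn. apply zsum_0. intros i _. rewrite (pk_neg l') by lia. lia. }
  induction l as [|l IH].
  - intros n. rewrite pk0_sym. unfold conv.
    destruct (Z_lt_ge_dec n s2) as [Hn|Hn].
    + rewrite pk_neg by lia. apply zsum_0. intros i _. rewrite (pk_neg 0) by lia. lia.
    + set (a := Z.to_nat (n - s2)).
      rewrite (zsum_extend _ (S a)) by (try lia; intros i Hi; rewrite (pk_neg 0) by lia; lia).
      simpl zsum. rewrite zsum_0.
      * unfold a. rewrite Z2Nat.id by lia.
        replace (n - (n - s2) - s2) with 0 by lia. change (pk 0 0) with 1.
        replace (n - s2 - s1) with (n - s1 - s2) by lia. lia.
      * intros i Hi. replace (pk 0 (n - Z.of_nat i - s2)) with 0; [lia|].
        unfold pk. simpl. destruct (Z.eqb_spec (n - Z.of_nat i - s2) 0); lia.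
  - apply (causal_unique (S l)); [lia|apply Cc| |].
    + intros n Hn. apply qinv2_causal. lia.
    + intros n. rewrite (qinv2_Sr k l (n - s1 - s2)).
      replace (n - Z.of_nat (S l) - s1 - s2) with (n - s1 - s2 - Z.of_nat (S l)) by lia.
      rewrite Z.add_simpl_r, <- IH.
      rewrite <- (conv_extend _ _ (n - Z.of_nat (S l)) (Z.to_nat n) (C (S l))) by lia.
      unfold conv. rewrite <- zsum_sub. apply zsum_ext. intros i _.
      rewrite (pk_S l (n - Z.of_nat i - s2)).
      replace (n - Z.of_nat (S l) - Z.of_nat i - s2) with (n - Z.of_nat i - s2 - Z.of_nat (S l)) by lia.
      lia.
Qed.

(** * Enumeration of compositions and partitions *)

Local Close Scope Z_scope.
Local Open Scope nat_scope.

Lemma NoDup_flat_map {A B : Type} (f : A -> list B) (s : list A) :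
  NoDup s -> (forall a, In a s -> NoDup (f a)) ->
  (forall a b z, In a s -> In b s -> In z (f a) -> In z (f b) -> a = b) ->
  NoDup (flat_map f s).
Proof.
  induction s as [|a s IH]; intros Hs Hf Hd; simpl; [constructor|].
  inversion Hs as [|? ? Ha Hs']; subst.
  apply NoDup_app.
  - apply Hf; now left.
  - apply IH; [easy| |]; intros; [apply Hf; now right|].
    eapply Hd; try right; eassumption.
  - intros z Hz Hz'. apply in_flat_map in Hz' as (b & Hb & Hzb).
    rewrite <- (Hd a b z) in Hb; [easy|now left|now right|easy|easy].
Qed.

Lemma NoDup_map_inj {A B : Type} (f : A -> B) (s : list A) :
  (forall x y, f x = f y -> x = y) -> NoDup s -> NoDup (map f s).
Proof. intros Hf. now apply FinFun.Injective_map_NoDup. Qed.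

Lemma length_flat_map_seq {A : Type} (f : nat -> list A) n :
  Z.of_nat (length (flat_map f (seq 0 n))) = zsum (fun i => Z.of_nat (length (f i))) n.
Proof.
  induction n as [|n IH]; [reflexivity|].
  rewrite seq_S, flat_map_app, length_app, Nat2Z.inj_add, IH. simpl.
  now rewrite app_nil_r.
Qed.

Lemma length_flat_map_const {A B : Type} (f : A -> list B) s m :
  (forall a, length (f a) = m) -> length (flat_map f s) = length s * m.
Proof. intros H. induction s as [|a s IH]; simpl; [easy|]. now rewrite length_app, H, IH. Qed.

Lemma length_eq_of_In {A : Type} (s t : list A) :
  NoDup s -> NoDup t -> (forall x, In x s <-> In x t) -> length s = length t.
Proof. intros. now apply Permutation_length, NoDup_Permutation. Qed.

Lemma lists_of_spec len m x : In x (lists_of len m) <-> length x = len /\ Forall (fun y => y <= m) x.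
Proof.
  revert x. induction len as [|len IH]; intros x.
  - simpl. split.
    + intros [<-|[]]. split; [easy|constructor].
    + intros [H _]. destruct x; [now left|easy].
  - change (lists_of (S len) m) with (flat_map (fun x => map (cons x) (lists_of len m)) (seq 0 (S m))).
    rewrite in_flat_map. split.
    + intros (a & Ha & Hx). apply in_map_iff in Hx as (t & <- & Ht).
      apply IH in Ht as [Hl Hf]. apply in_seq in Ha. simpl. split; [now f_equal|].
      constructor; [lia|easy].
    + intros [Hl Hf]. destruct x as [|a t]; [easy|]. inversion Hf; subst.
      exists a. split; [apply in_seq; lia|]. apply in_map, IH. simpl in Hl. split; [lia|easy].
Qed.

Lemma lists_of_NoDup len m : NoDup (lists_of len m).
Proof.
  induction len as [|len IH]; [repeat constructor; easy|].
  apply NoDup_flat_map.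
  - apply seq_NoDup.
  - intros a _. apply NoDup_map_inj; [|easy]. now intros x y [=].
  - intros a b z _ _ Ha Hb. apply in_map_iff in Ha as (? & <- & _), Hb as (? & [=] & _). congruence.
Qed.

Lemma lists_upto_NoDup a b m : NoDup (flat_map (fun l => lists_of l m) (seq a b)).
Proof.
  apply NoDup_flat_map; [apply seq_NoDup|intros; apply lists_of_NoDup|].
  intros i j z _ _ Hi Hj. apply lists_of_spec in Hi as [Hi _], Hj as [Hj _]. congruence.
Qed.

Fixpoint sinc (a : nat) (x : list nat) : Prop :=
  match x with [] => True | y :: t => a <= y /\ sinc (S y) t end.

Lemma sinc_weaken a b x : b <= a -> sinc a x -> sinc b x.
Proof. destruct x; simpl; [easy|]. intros ? [? ?]; split; [lia|easy]. Qed.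

Lemma sinc_ge a x y : sinc a x -> In y x -> a <= y.
Proof.
  revert a. induction x as [|z t IH]; intros a; [easy|]. intros [H1 H2] [->|H]; [easy|].
  specialize (IH (S z) H2 H). lia.
Qed.

(* Strictly increasing lists of length [k] with entries [>= a] and sum [n],
   complete as soon as [n < a + fuel]. *)
Fixpoint incs (fuel k a n : nat) : list (list nat) :=
  match k with
  | 0 => if n =? 0 then [[]] else []
  | S k' =>
    match fuel with
    | 0 => []
    | S f => (if a <=? n then map (cons a) (incs f k' (S a) (n - a)) else []) ++ incs f k (S a) n
    end
  end.

Lemma incs_spec fuel : forall k a n x, n < a + fuel ->
  (In x (incs fuel k a n) <-> length x = k /\ sinc a x /\ list_sum x = n).
Proof.
  induction fuel as [|f IH]; intros [|k] a n x Hf; simpl incs.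
  1, 3: destruct (Nat.eqb_spec n 0) as [->|Hn]; simpl; split; try easy.
  1, 4: intros [<-|[]]; easy.
  1, 3: intros (Hl & _ & _); destruct x; [now left|easy].
  1, 2: intros (Hl & _ & Hs); destruct x; simpl in *; congruence.
  - split; [easy|]. intros (Hl & Hi & Hs). destruct x; simpl in *; lia.
  - rewrite in_app_iff, IH by lia. split.
    + intros [H|(Hl & Hi & Hs)].
      * destruct (Nat.leb_spec a n) as [Ha|Ha]; [|easy].
        apply in_map_iff in H as (t & <- & Ht). apply IH in Ht as (Hl & Hi & Hs); [|lia].
        simpl. repeat split; [lia|lia|easy|lia].
      * repeat split; [easy| |easy]. eapply sinc_weaken; [|eassumption]; lia.
    + intros (Hl & Hi & Hs). destruct x as [|y t]; [easy|]. simpl in Hl, Hi, Hs.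
      destruct Hi as [Hy Hi]. destruct (Nat.eq_dec a y) as [->|Hne].
      * left. destruct (Nat.leb_spec y n); [|lia]. apply in_map. apply IH; [lia|].
        repeat split; [lia|easy|lia].
      * right. simpl. repeat split; [lia|lia|easy|lia].
Qed.

Lemma incs_NoDup fuel : forall k a n, n < a + fuel -> NoDup (incs fuel k a n).
Proof.
  induction fuel as [|f IH]; intros [|k] a n Hf; simpl incs.
  1, 3: destruct (n =? 0); repeat constructor; easy.
  - constructor.
  - apply NoDup_app.
    + destruct (Nat.leb_spec a n); [|constructor]. apply NoDup_map_inj; [now intros x y [=]|].
      apply IH; lia.
    + apply IH; lia.
    + intros x H1 H2. destruct (Nat.leb_spec a n); [|easy].
      apply in_map_iff in H1 as (t & <- & _). apply incs_spec in H2 as (_ & [H2 _] & _); lia.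
Qed.

(** * Counting strongly concave compositions *)

Fixpoint tri (k : nat) : nat := match k with 0 => 0 | S k' => tri k' + k' end.

Lemma tri_eq k : 2 * tri k + k = k * k.
Proof. induction k; simpl tri; lia. Qed.

(** Subtracting the smallest list a, a+1, ..., of sum k a + [tri k], leaves a partition with at most
    k parts. Either the first entry is a, or all entries can be lowered by one: the two summands of
    [pk_S]. *)
Lemma length_incs fuel : forall k a n, n < a + fuel ->
  Z.of_nat (length (incs fuel k a n)) = pk k (Z.of_nat n - Z.of_nat (k * a + tri k)).
Proof.
  induction fuel as [|f IH]; intros [|k] a n Hf; simpl incs.
  1, 3: simpl; rewrite Z.sub_0_r; destruct n; reflexivity.
  - rewrite pk_neg by lia. reflexivity.
  - rewrite pk_S, length_app, Nat2Z.inj_add, IH by lia.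
    f_equal; [|f_equal; simpl tri; nia].
    destruct (Nat.leb_spec a n).
    + rewrite length_map, IH by lia. f_equal. simpl tri. nia.
    + rewrite pk_neg by (simpl tri; nia). reflexivity.
Qed.

(** The left flank is stored reversed, so both flanks increase away from the minimum [c]. With s =
    |x| + 1 + |y| and k = |x| + 1 the rank s - 2k + 1 equals |y| - |x|. *)
Definition scc_decomp (l n : nat) (z : list nat) : Prop :=
  exists c x y, z = rev x ++ c :: y /\ sinc (S c) x /\ sinc (S c) y /\
    length y = length x + l /\ c + list_sum x + list_sum y = n.

(** The nesting mirrors the generating function: [k] is the index of [conc_term], [c] that of [geo],
    and the sum [i] of the left flank that of [conv]. Entries of a flank are positive, so its length
    is at most [n]. *)
Definition scc_lists (l n : nat) : list (list nat) :=
  flat_map (fun k => flat_map (fun c => flat_map (fun i =>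
    flat_map (fun x => map (fun y => rev x ++ c :: y) (incs (S n) (k + l) (S c) (n - c - i)))
      (incs (S n) k (S c) i))
    (seq 0 (S (n - c)))) (seq 0 (S n))) (seq 0 (S n)).

Lemma sinc_length_le a x : sinc (S a) x -> length x <= list_sum x.
Proof.
  revert a. induction x as [|y t IH]; intros a; simpl; [lia|]. intros [H1 H2].
  specialize (IH y H2). lia.
Qed.

Lemma scc_lists_spec l n z : In z (scc_lists l n) <-> scc_decomp l n z.
Proof.
  unfold scc_lists. split.
  - intros H. apply in_flat_map in H as (k & _ & H). apply in_flat_map in H as (c & Hc & H).
    apply in_flat_map in H as (i & Hi & H). apply in_flat_map in H as (x & Hx & H).
    apply in_map_iff in H as (y & <- & Hy). apply in_seq in Hc, Hi.
    apply incs_spec in Hx as (? & ? & ?); [|lia]. apply incs_spec in Hy as (? & ? & ?); [|lia].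
    exists c, x, y. repeat split; try easy; lia.
  - intros (c & x & y & -> & Hx & Hy & Hl & Hs).
    pose proof (sinc_length_le _ _ Hx).
    apply in_flat_map; exists (length x); split; [apply in_seq; lia|].
    apply in_flat_map; exists c; split; [apply in_seq; lia|].
    apply in_flat_map; exists (list_sum x); split; [apply in_seq; lia|].
    apply in_flat_map; exists x; split; [apply incs_spec; [lia|easy]|].
    apply in_map_iff; exists y; split; [easy|]. apply incs_spec; [lia|]. repeat split; [lia|easy|lia].
Qed.

(** If the two splittings differ, each central entry lies in a flank of the other one, which forces
    both c < c' and c' < c. Hence no composition is listed twice. *)
Lemma scc_decomp_unique c x y c' x' y' :
  rev x ++ c :: y = rev x' ++ c' :: y' ->
  sinc (S c) x -> sinc (S c) y -> sinc (S c') x' -> sinc (S c') y' ->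
  x = x' /\ c = c' /\ y = y'.
Proof.
  intros E Hx Hy Hx' Hy'.
  assert (K : forall c x y c' x' y' u, rev x = rev x' ++ u -> c' :: y' = u ++ c :: y ->
    sinc (S c) x -> sinc (S c') y' -> u = []).
  { clear. intros c x y c' x' y' u E1 E2 Hx Hy'. destruct u as [|b u]; [easy|exfalso].
    injection E2 as <- E2.
    assert (H1 : S c <= c') by (apply (sinc_ge _ x); [easy|]; apply in_rev; rewrite E1; apply in_elt).
    assert (H2 : S c' <= c) by (apply (sinc_ge _ y'); [easy|]; rewrite E2; apply in_elt).
    lia. }
  apply app_eq_app in E as (u & [[E1 E2]|[E1 E2]]).
  - assert (u = []) by (eapply K; eassumption). subst u.
    rewrite app_nil_r in E1. injection E2 as -> ->. repeat split.
    now rewrite <- (rev_involutive x), E1, rev_involutive.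
  - assert (u = []) by (eapply K; eassumption). subst u.
    rewrite app_nil_r in E1. injection E2 as -> ->. repeat split.
    now rewrite <- (rev_involutive x), <- E1, rev_involutive.
Qed.

Lemma scc_lists_NoDup l n : NoDup (scc_lists l n).
Proof.
  set (g := fun c x (y : list nat) => rev x ++ c :: y).
  assert (I : forall c k1 k2 i j z, c <= n -> i <= n ->
     In z (flat_map (fun x => map (g c x) (incs (S n) k2 (S c) j)) (incs (S n) k1 (S c) i)) -> j <= n ->
     exists x y, z = g c x y /\ length x = k1 /\ list_sum x = i /\ sinc (S c) x /\ sinc (S c) y).
  { intros c k1 k2 i j z Hc Hi Hz Hj. apply in_flat_map in Hz as (x & Hx & Hz).
    apply in_map_iff in Hz as (y & <- & Hy).
    apply incs_spec in Hx as (? & ? & ?); [|lia]. apply incs_spec in Hy as (? & ? & ?); [|lia].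
    now exists x, y. }
  apply NoDup_flat_map; [apply seq_NoDup|intros k _; apply NoDup_flat_map; [apply seq_NoDup|intros c Hc; apply NoDup_flat_map; [apply seq_NoDup|intros i Hi; apply NoDup_flat_map|]|]|].
  - apply in_seq in Hc, Hi. apply incs_NoDup; lia.
  - intros x _. apply NoDup_map_inj.
    + intros y y' E. apply app_inv_head in E. now injection E.
    + apply incs_NoDup; lia.
  - intros x x' z Hx Hx' Hz Hz'. apply in_seq in Hc, Hi.
    apply in_map_iff in Hz as (y & <- & Hy), Hz' as (y' & E & Hy').
    apply incs_spec in Hx as (? & ? & ?), Hx' as (? & ? & ?), Hy as (? & ? & ?), Hy' as (? & ? & ?); try lia.
    now apply scc_decomp_unique in E as (-> & _ & _).
  - intros i i' z Hi Hi' Hz Hz'. apply in_seq in Hc, Hi, Hi'.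
    apply I in Hz as (x & y & -> & <- & <- & Hx & Hy); try lia.
    apply I in Hz' as (x' & y' & E & ? & <- & Hx' & Hy'); try lia.
    apply scc_decomp_unique in E as (-> & _ & _); easy.
  - intros c c' z Hc Hc' Hz Hz'. apply in_seq in Hc, Hc'.
    apply in_flat_map in Hz as (i & Hi & Hz), Hz' as (i' & Hi' & Hz'). apply in_seq in Hi, Hi'.
    apply I in Hz as (x & y & -> & ? & ? & Hx & Hy); try lia.
    apply I in Hz' as (x' & y' & E & ? & ? & Hx' & Hy'); try lia.
    now apply scc_decomp_unique in E as (-> & -> & _).
  - intros k k' z _ _ Hz Hz'.
    apply in_flat_map in Hz as (c & Hc & Hz), Hz' as (c' & Hc' & Hz'). apply in_seq in Hc, Hc'.
    apply in_flat_map in Hz as (i & Hi & Hz), Hz' as (i' & Hi' & Hz'). apply in_seq in Hi, Hi'.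
    apply I in Hz as (x & y & -> & ? & ? & Hx & Hy); try lia.
    apply I in Hz' as (x' & y' & E & ? & ? & Hx' & Hy'); try lia.
    apply scc_decomp_unique in E as (-> & _ & _); congruence.
Qed.

Lemma sinc_nth c y :
  sinc (S c) y <-> (forall i, i < length y -> nth i (c :: y) 0 < nth (S i) (c :: y) 0).
Proof.
  revert c. induction y as [|b y IH]; intros c; [simpl; split; [lia|easy]|].
  simpl sinc. rewrite IH. split.
  - intros [H1 H2] [|i] Hi; [simpl; lia|]. apply (H2 i). simpl in Hi. lia.
  - intros H. split; [apply (H 0); simpl; lia|]. intros i Hi. apply (H (S i)). simpl; lia.
Qed.

(** Read outwards from position |x|, the left half of the list is [c :: x] and the right half is
    [c :: y]; the 1-based index of the minimum is therefore S |x|. *)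
Lemma sc_at_iff c x y :
  sc_at (rev x ++ c :: y) (S (length x)) = true <-> sinc (S c) x /\ sinc (S c) y.
Proof.
  unfold sc_at. rewrite length_app, length_rev. simpl length.
  replace (S (length x) <=? length x + S (length y)) with true by (symmetry; apply Nat.leb_le; lia).
  simpl andb. rewrite forallb_forall, !sinc_nth.
  assert (L : forall i, i <= length x -> nth i (rev x ++ c :: y) 0 = nth (length x - i) (c :: x) 0).
  { intros i Hi. replace (rev x ++ c :: y) with (rev (c :: x) ++ y) by (simpl; now rewrite <- app_assoc).
    rewrite app_nth1 by (rewrite length_rev; simpl; lia).
    rewrite rev_nth by (simpl; lia). f_equal; simpl; lia. }
  assert (R : forall i, nth (length x + i) (rev x ++ c :: y) 0 = nth i (c :: y) 0).
  { intros i. rewrite app_nth2; rewrite length_rev; [f_equal; lia|lia]. }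
  split.
  - intros H. split; intros i Hi.
    + specialize (H (length x - S i)). rewrite in_seq in H.
      destruct (Nat.ltb_spec (length x - S i + 1) (S (length x))); [|lia].
      specialize (H ltac:(lia)). apply Nat.ltb_lt in H. rewrite !L in H by lia.
      replace (length x - (length x - S i + 1)) with i in H by lia.
      replace (length x - (length x - S i)) with (S i) in H by lia. easy.
    + specialize (H (length x + i)). rewrite in_seq in H.
      destruct (Nat.ltb_spec (length x + i + 1) (S (length x))); [lia|].
      specialize (H ltac:(lia)). apply Nat.ltb_lt in H.
      rewrite <- Nat.add_assoc, !R in H. now rewrite Nat.add_1_r in H.
  - intros [Hx Hy] i Hi. apply in_seq in Hi.
    destruct (Nat.ltb_spec (i + 1) (S (length x))); apply Nat.ltb_lt.
    + rewrite !L by lia. specialize (Hx (length x - (i + 1)) ltac:(lia)).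
      replace (length x - i) with (S (length x - (i + 1))) by lia. easy.
    + specialize (Hy (i - length x) ltac:(lia)).
      replace i with (length x + (i - length x)) by lia. rewrite <- Nat.add_assoc, !R, Nat.add_1_r. easy.
Qed.

Lemma list_sum_rev x : list_sum (rev x) = list_sum x.
Proof. induction x as [|a x IH]; simpl; [easy|]. rewrite list_sum_app, IH. simpl. lia. Qed.

Lemma list_sum_le x y : In y x -> y <= list_sum x.
Proof. induction x as [|a x IH]; simpl; [easy|]. intros [->|H]; [lia|]. specialize (IH H). lia. Qed.

Lemma Vd_scc_lists l n : Vd (Z.of_nat l) n = length (scc_lists l n).
Proof.
  unfold Vd. apply length_eq_of_In.
  - apply NoDup_filter, lists_upto_NoDup.
  - apply scc_lists_NoDup.
  - intros z. rewrite filter_In, scc_lists_spec, in_flat_map. unfold is_scc_rank.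
    rewrite andb_true_iff, Nat.eqb_eq, existsb_exists. split.
    + intros [_ [Hs (k & Hk & H)]]. apply andb_true_iff in H as [H Hr].
      apply Z.eqb_eq in Hr. apply in_seq in Hk.
      destruct (nth_split z 0 (n := k - 1)) as (u & y & Ez & Hu); [lia|].
      set (c := nth (k - 1) z 0) in Ez. clearbody c.
      rewrite <- (rev_involutive u) in Ez. set (x := rev u) in Ez.
      assert (Hx : length x = k - 1) by (unfold x; now rewrite length_rev).
      replace k with (S (length x)) in H by lia. rewrite Ez in H. apply sc_at_iff in H as [H1 H2].
      exists c, x, y. rewrite Ez in Hs, Hr. rewrite list_sum_app, list_sum_rev in Hs.
      rewrite length_app, length_rev in Hr. simpl in Hs. simpl length in Hr. repeat split; try easy; lia.
    + intros (c & x & y & -> & Hx & Hy & Hl & Hs).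
      assert (Hsum : list_sum (rev x ++ c :: y) = n) by (rewrite list_sum_app, list_sum_rev; simpl; lia).
      pose proof (sinc_length_le _ _ Hx). pose proof (sinc_length_le _ _ Hy).
      split; [|split; [easy|]].
      * exists (length (rev x ++ c :: y)). rewrite lists_of_spec, in_seq, length_app, length_rev.
        simpl. repeat split; try lia.
        apply Forall_forall. intros b Hb. rewrite <- Hsum. now apply list_sum_le.
      * exists (S (length x)). rewrite in_seq, length_app, length_rev. simpl length. split; [lia|].
        apply andb_true_iff. split; [now apply sc_at_iff|]. apply Z.eqb_eq. lia.
Qed.

Lemma geo_sum s f n K : causal f -> 0 < s -> (n <= Z.of_nat K)%Z ->
  zsum (fun i => f (n - Z.of_nat (i * s))%Z) (S K) = geo s f n.
Proof. intros Hf Hs H. apply zsum_extend; [lia|]. intros i Hi. apply Hf. nia. Qed.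

(** With minimum c and k entries to its left, the smallest composition has sum c (2k+l+1) + k(k+l+1)
    + l(l+1)/2. The three summands are the shift in [geo], the shift in [conc_term] and the offset
    in the argument of [Vd]. *)
Lemma Vd_conc l N : Z.of_nat (Vd (Z.of_nat l) (N + l * (l + 1) / 2)) = conc l (Z.of_nat N).
Proof.
  rewrite Vd_scc_lists.
  assert (Hl : 2 * (l * (l + 1) / 2) = l * l + l).
  { replace (l * (l + 1)) with ((tri l + l) * 2) by (pose proof (tri_eq l); nia).
    rewrite Nat.div_mul by lia. pose proof (tri_eq l). nia. }
  set (n := N + l * (l + 1) / 2). unfold scc_lists. rewrite length_flat_map_seq.
  rewrite <- (conc_sum l _ n) by lia. apply zsum_ext. intros k _.
  unfold conc_term. rewrite length_flat_map_seq.
  rewrite <- (geo_sum _ _ _ n (qinv2_causal _ _)) by lia.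
  apply zsum_ext. intros c Hc. rewrite length_flat_map_seq.
  replace (Z.of_nat N - Z.of_nat (k * (k + l + 1)) - Z.of_nat (c * (2 * k + l + 1)))%Z with
    (Z.of_nat (n - c) - Z.of_nat (k * S c + tri k) - Z.of_nat ((k + l) * S c + tri (k + l)))%Z.
  2: { unfold n in *. pose proof (tri_eq k). pose proof (tri_eq (k + l)). nia. }
  rewrite <- conv_pk by lia. unfold conv. rewrite Nat2Z.id. apply zsum_ext. intros i Hi.
  rewrite (length_flat_map_const _ _ (length (incs (S n) (k + l) (S c) (n - c - i)))) by (intros; apply length_map).
  rewrite Nat2Z.inj_mul, !length_incs by lia. f_equal. f_equal. lia.
Qed.

(** * Counting partitions *)

Fixpoint ndesc (b : nat) (x : list nat) : Prop :=
  match x with [] => True | y :: t => 1 <= y <= b /\ ndesc y t end.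

(* Complete as soon as [J + n <= fuel]. *)
Fixpoint parts (fuel J n : nat) : list (list nat) :=
  match J with
  | 0 => if n =? 0 then [[]] else []
  | S J' =>
    match fuel with
    | 0 => []
    | S f => parts f J' n ++ (if J <=? n then map (cons J) (parts f J (n - J)) else [])
    end
  end.

Lemma ndesc_weaken a b x : a <= b -> ndesc a x -> ndesc b x.
Proof. destruct x; simpl; [easy|]. intros ? [? ?]; split; [lia|easy]. Qed.

Lemma parts_spec fuel : forall J n x, J + n <= fuel ->
  (In x (parts fuel J n) <-> ndesc J x /\ list_sum x = n).
Proof.
  assert (B : forall n x, In x (if n =? 0 then [[]] else []) <-> ndesc 0 x /\ list_sum x = n).
  { intros n [|y t]; destruct (Nat.eqb_spec n 0) as [->|Hn]; simpl; intuition (try easy; lia). }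
  induction fuel as [|f IH]; intros [|J] n x Hf; cbn [parts]; try lia; [apply B|apply B|].
  rewrite in_app_iff, IH by lia. split.
  - intros [[H1 H2]|H].
    + split; [|easy]. eapply ndesc_weaken; [|eassumption]; lia.
    + destruct (Nat.leb_spec (S J) n); [|easy]. apply in_map_iff in H as (t & <- & Ht).
      apply IH in Ht as [? ?]; [|lia]. simpl; repeat split; try easy; lia.
  - intros [Hd Hs]. destruct x as [|y t]; [left; now split|]. simpl in Hd, Hs. destruct Hd as [Hy Hd].
    destruct (Nat.eq_dec y (S J)) as [->|Hne].
    + right. destruct (Nat.leb_spec (S J) n); [|lia]. apply in_map. apply IH; [lia|]. split; [easy|lia].
    + left. simpl. repeat split; try easy; lia.
Qed.

Lemma parts_NoDup fuel : forall J n, J + n <= fuel -> NoDup (parts fuel J n).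
Proof.
  induction fuel as [|f IH]; intros [|J] n Hf; cbn [parts]; try lia.
  1, 2: destruct (n =? 0); repeat constructor; easy.
  apply NoDup_app.
  - apply IH; lia.
  - destruct (Nat.leb_spec (S J) n); [|constructor]. apply NoDup_map_inj; [now intros x y [=]|].
    apply IH; lia.
  - intros x H1 H2. destruct (Nat.leb_spec (S J) n); [|easy].
    apply in_map_iff in H2 as (t & <- & _). apply parts_spec in H1 as [[? _] _]; lia.
Qed.

(** Either the size J is absent or one copy of it can be removed, the same alternative as in
    [pk_S]. *)
Lemma length_parts fuel : forall J n, J + n <= fuel ->
  Z.of_nat (length (parts fuel J n)) = pk J (Z.of_nat n).
Proof.
  induction fuel as [|f IH]; intros [|J] n Hf; cbn [parts]; try lia.
  1, 2: destruct n; reflexivity.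
  rewrite pk_S, length_app, Nat2Z.inj_add, IH by lia. f_equal.
  destruct (Nat.leb_spec (S J) n).
  - rewrite length_map, IH by lia. f_equal. lia.
  - rewrite pk_neg by lia. reflexivity.
Qed.

Lemma noninc_cons2 y w t : noninc (y :: w :: t) = true <-> w <= y /\ noninc (w :: t) = true.
Proof.
  change (noninc (y :: w :: t)) with ((w <=? y) && noninc (w :: t)).
  now rewrite andb_true_iff, Nat.leb_le.
Qed.

Lemma noninc_Forall t : forall w, noninc (w :: t) = true -> Forall (fun y => y <= w) t.
Proof.
  induction t as [|v t IH]; intros w Hn; [constructor|].
  apply noninc_cons2 in Hn as [H1 H2]. constructor; [easy|].
  eapply Forall_impl; [|apply IH; exact H2]. simpl; lia.
Qed.

Lemma ndesc_iff b x : ndesc b x <->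
  noninc x = true /\ forallb (fun y => 1 <=? y) x = true /\ Forall (fun y => y <= b) x.
Proof.
  revert b. induction x as [|y t IH]; intros b; [simpl; repeat split; constructor|].
  simpl ndesc. rewrite IH. cbn [forallb]. rewrite andb_true_iff, Nat.leb_le, Forall_cons_iff.
  split.
  - intros ([? ?] & Hn & ? & F). repeat split; try easy.
    + destruct t as [|w t]; [easy|]. apply noninc_cons2. split; [|easy]. now inversion F.
    + eapply Forall_impl; [|exact F]. simpl; lia.
  - intros (Hn & [? Hp] & ? & F). repeat split; try easy.
    + destruct t as [|w t]; [easy|]. now apply noninc_cons2 in Hn.
    + now apply noninc_Forall.
Qed.

Lemma part_pz n : Z.of_nat (part n) = pz (Z.of_nat n).
Proof.
  unfold part. rewrite (length_eq_of_In _ (parts (n + n) n n)).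
  - rewrite length_parts by lia. apply pk_stable. lia.
  - apply NoDup_filter, lists_upto_NoDup.
  - apply parts_NoDup; lia.
  - intros x. rewrite filter_In, parts_spec, in_flat_map, ndesc_iff by lia. unfold is_partition.
    rewrite !andb_true_iff, Nat.eqb_eq. split.
    + intros (_ & (Hs & Hn) & Hp). repeat split; try easy.
      apply Forall_forall. intros y Hy. rewrite <- Hs. now apply list_sum_le.
    + intros ((Hn & Hp & Hb) & Hs). repeat split; try easy.
      exists (length x). rewrite lists_of_spec, in_seq. repeat split; try easy; [lia|].
      enough (length x <= list_sum x) by lia.
      clear - Hp. induction x as [|y t IH]; [simpl; lia|]. cbn [forallb] in Hp. simpl.
      apply andb_true_iff in Hp as [H1 H2]. apply Nat.leb_le in H1. specialize (IH H2). lia.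
Qed.

(** * The Basel sum with a rate *)

Local Close Scope nat_scope.
Local Open Scope R_scope.

Fixpoint rsum (f : nat -> R) (n : nat) : R :=
  match n with O => 0 | S m => rsum f m + f m end.

(** The Taylor polynomial makes cos (8/5) negative. The bound PI/2 < 8/5 gives x^2 < 3 on [0, PI/2],
    which x - x^3/6 >= x/2 requires. *)
Lemma PI_lt_16_5 : PI < 16 / 5.
Proof.
  destruct (Rlt_dec PI (16 / 5)) as [H|H]; [easy|exfalso].
  assert (H1 : 0 <= cos (8 / 5)) by (apply cos_ge_0; lra).
  destruct (cos_bound (8 / 5) 0) as [_ H2]; try lra.
  unfold cos_approx, cos_term in H2. simpl in H2. lra.
Qed.

Lemma sin_ge_half x : 0 <= x <= PI / 2 -> x / 2 <= sin x.
Proof.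
  intros Hx. pose proof PI_lt_16_5. destruct (sin_bound x 0) as [H1 _]; try lra.
  unfold sin_approx, sin_term in H1. simpl in H1.
  assert (x * x <= 64 / 25) by nra.
  assert (x * (x * x) <= x * (64 / 25)) by (apply Rmult_le_compat_l; lra).
  lra.
Qed.

Lemma ex_RInt_cont (f : R -> R) a b : (forall x, continuous f x) -> ex_RInt f a b.
Proof. intros H. apply (ex_RInt_continuous (V := R_CompleteNormedModule)). intros; apply H. Qed.

(** Wallis integral; [cosint2] is the same integral with weight x^2. *)
Definition cosint (n : nat) : R := RInt (fun x => cos x ^ (2 * n)) 0 (PI / 2).
Definition cosint2 (n : nat) : R := RInt (fun x => x ^ 2 * cos x ^ (2 * n)) 0 (PI / 2).

Lemma continuous_derivable (f : R -> R) x : ex_derive f x -> continuous f x.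
Proof. apply (ex_derive_continuous (V := R_NormedModule)). Qed.

Lemma is_RInt_cosint n : is_RInt (fun x => cos x ^ (2 * n)) 0 (PI / 2) (cosint n).
Proof. apply (RInt_correct (V := R_CompleteNormedModule)), ex_RInt_cont. intros x. apply continuous_derivable. auto_derive. easy. Qed.

Lemma is_RInt_cosint2 n : is_RInt (fun x => x ^ 2 * cos x ^ (2 * n)) 0 (PI / 2) (cosint2 n).
Proof. apply (RInt_correct (V := R_CompleteNormedModule)), ex_RInt_cont. intros x. apply continuous_derivable. auto_derive. easy. Qed.

Lemma RInt_derive_eq (f df : R -> R) a b I :
  (forall x, is_derive f x (df x)) -> (forall x, continuous df x) -> is_RInt df a b I -> I = f b - f a.
Proof.
  intros Hf Hc HI. apply (is_RInt_unique (V := R_CompleteNormedModule)) in HI. rewrite <- HI.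
  apply (is_RInt_unique (V := R_CompleteNormedModule)).
  apply (is_RInt_derive (V := R_CompleteNormedModule) f df); auto.
Qed.

Lemma is_derive_sin_cos_pow k x :
  is_derive (fun x => sin x * cos x ^ S k) x
    ((INR k + 2) * cos x ^ S (S k) - (INR k + 1) * cos x ^ k).
Proof.
  auto_derive; [easy|].
  change (match k with 0%nat => 1 | S _ => INR k + 1 end) with (INR (S k)). rewrite S_INR. simpl pow.
  pose proof (sin2_cos2 x) as H. unfold Rsqr in H.
  replace (sin x * (1 * - sin x * ((INR k + 1) * cos x ^ k)))
    with (- (sin x * sin x) * ((INR k + 1) * cos x ^ k)) by ring.
  replace (sin x * sin x) with (1 - cos x * cos x) by lra. ring.
Qed.

(** Two integrations by parts in one antiderivative: the coefficient (k+2)/2 makes the terms x sin x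
    cos^(k+1) x cancel, leaving only the integrands of [cosint] and [cosint2]. The antiderivative
    vanishes at 0 and PI/2. *)
Lemma is_derive_sq_sin_cos_pow k x :
  is_derive (fun x => x * cos x ^ S (S k) + (INR k + 2) / 2 * (x ^ 2 * (sin x * cos x ^ S k))) x
    (cos x ^ S (S k) + (INR k + 2) ^ 2 / 2 * (x ^ 2 * cos x ^ S (S k))
       - (INR k + 2) * (INR k + 1) / 2 * (x ^ 2 * cos x ^ k)).
Proof.
  auto_derive; [easy|].
  change (match k with 0%nat => 1 | S _ => INR k + 1 end) with (INR (S k)). rewrite S_INR. simpl pow.
  pose proof (sin2_cos2 x) as H. unfold Rsqr in H.
  replace (cos x * (cos x * cos x ^ k)) with ((1 - sin x * sin x) * cos x ^ k)
    by (replace (1 - sin x * sin x) with (cos x * cos x) by lra; ring).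
  field_simplify. replace (cos x ^ 2) with (1 - sin x ^ 2) by (simpl; lra). field.
Qed.

Lemma cosint_rec n : 2 * INR (S n) * cosint (S n) = (2 * INR n + 1) * cosint n.
Proof.
  assert (E : (INR (2 * n) + 2) * cosint (S n) - (INR (2 * n) + 1) * cosint n = 0).
  { replace 0 with (sin (PI / 2) * cos (PI / 2) ^ (S (2 * n)) - sin 0 * cos 0 ^ (S (2 * n)))
      by (rewrite cos_PI2, sin_0; simpl; ring).
    eapply (RInt_derive_eq (fun x => sin x * cos x ^ (S (2 * n)))); [apply is_derive_sin_cos_pow| |].
    - intros x. apply continuous_derivable. auto_derive. easy.
    - replace (S (S (2 * n))) with (2 * S n)%nat by lia.
      apply (is_RInt_minus (V := R_NormedModule)); apply (is_RInt_scal (V := R_NormedModule)); apply is_RInt_cosint. }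
  rewrite mult_INR in E. rewrite S_INR. simpl INR in E. lra.
Qed.

Lemma cosint2_rec n :
  cosint (S n) = INR (S n) * (2 * INR n + 1) * cosint2 n - 2 * INR (S n) ^ 2 * cosint2 (S n).
Proof.
  assert (E : cosint (S n) + (INR (2 * n) + 2) ^ 2 / 2 * cosint2 (S n)
    - (INR (2 * n) + 2) * (INR (2 * n) + 1) / 2 * cosint2 n = 0).
  { replace 0 with ((PI / 2 * cos (PI / 2) ^ S (S (2 * n)) + (INR (2 * n) + 2) / 2 * ((PI / 2) ^ 2 * (sin (PI / 2) * cos (PI / 2) ^ S (2 * n))))
      - (0 * cos 0 ^ S (S (2 * n)) + (INR (2 * n) + 2) / 2 * (0 ^ 2 * (sin 0 * cos 0 ^ S (2 * n)))))
      by (rewrite cos_PI2, sin_0; simpl; ring).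
    eapply (RInt_derive_eq (fun x => x * cos x ^ S (S (2 * n)) + (INR (2 * n) + 2) / 2 * (x ^ 2 * (sin x * cos x ^ S (2 * n))))); [apply is_derive_sq_sin_cos_pow| |].
    - intros x. apply continuous_derivable. auto_derive. easy.
    - replace (S (S (2 * n))) with (2 * S n)%nat by lia.
      apply (is_RInt_minus (V := R_NormedModule)); [apply (is_RInt_plus (V := R_NormedModule))|];
        [apply is_RInt_cosint|apply (is_RInt_scal (V := R_NormedModule))|apply (is_RInt_scal (V := R_NormedModule))]; apply is_RInt_cosint2. }
  rewrite mult_INR in E. rewrite S_INR. simpl INR in E. lra.
Qed.

Lemma cosint_0 : cosint 0 = PI / 2.
Proof.
  apply (is_RInt_unique (V := R_CompleteNormedModule)). simpl.
  replace (PI / 2) with (scal (PI / 2 - 0) 1) at 2 by (unfold scal; simpl; unfold mult; simpl; ring).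
  apply (is_RInt_const (V := R_NormedModule)).
Qed.

Lemma cosint2_0 : cosint2 0 = (PI / 2) ^ 3 / 3.
Proof.
  replace ((PI / 2) ^ 3 / 3) with ((PI / 2) ^ 3 / 3 - 0 ^ 3 / 3) by (simpl; field).
  apply (RInt_derive_eq (fun x => x ^ 3 / 3) (fun x => x ^ 2 * cos x ^ (2 * 0))).
  - intros x. auto_derive; [easy|]. simpl. field.
  - intros x. apply continuous_derivable. auto_derive. easy.
  - apply is_RInt_cosint2.
Qed.

Lemma cosint_pos n : 0 < cosint n.
Proof.
  induction n as [|n IH]; [rewrite cosint_0; pose proof PI_RGT_0; lra|].
  pose proof (cosint_rec n) as E. pose proof (pos_INR n). rewrite S_INR in E. nra.
Qed.

(** From sin x >= x/2 one gets x^2 <= 4 sin^2 x, and sin^2 x cos^(2n) x is a difference of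
    consecutive even powers. With [cosint_rec] the upper bound is 2/(n+1) times [cosint n]. *)
Lemma cosint2_bounds n : 0 <= cosint2 n <= 4 * (cosint n - cosint (S n)).
Proof.
  pose proof PI_RGT_0.
  split.
  - apply (RInt_ge_0 (fun x => x ^ 2 * cos x ^ (2 * n))); [lra|eexists; apply is_RInt_cosint2|].
    intros x Hx. rewrite pow_mult. apply Rmult_le_pos; [|apply pow_le]; apply pow2_ge_0.
  - apply (is_RInt_le (fun x => x ^ 2 * cos x ^ (2 * n)) (fun x => 4 * (cos x ^ (2 * n) - cos x ^ (2 * S n))) 0 (PI / 2));
      [lra|apply is_RInt_cosint2| |].
    + apply (is_RInt_scal (V := R_NormedModule)), (is_RInt_minus (V := R_NormedModule)); apply is_RInt_cosint.
    + intros x Hx. replace (2 * S n)%nat with (2 * n + 2)%nat by lia. rewrite pow_add.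
      pose proof (sin2_cos2 x) as H1. unfold Rsqr in H1.
      pose proof (sin_ge_half x ltac:(lra)) as H2.
      assert (H3 : 0 <= cos x ^ (2 * n)) by (rewrite pow_mult; apply pow_le, pow2_ge_0).
      replace (4 * (cos x ^ (2 * n) - cos x ^ (2 * n) * cos x ^ 2)) with (4 * (sin x * sin x) * cos x ^ (2 * n))
        by (replace (sin x * sin x) with (1 - cos x * cos x) by lra; ring).
      apply Rmult_le_compat_r; [easy|]. nra.
Qed.

(* Matsuoka: the ratios [cosint2 n / cosint n] telescope to the partial sums. *)
Lemma basel_ratio K :
  cosint2 K / cosint K = (PI ^ 2 / 6 - rsum (fun i => / INR (S i) ^ 2) K) / 2.
Proof.
  induction K as [|K IH].
  - rewrite cosint_0, cosint2_0. simpl. pose proof PI_RGT_0. field. lra.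
  - cbn [rsum]. pose proof (cosint_pos K) as H0. pose proof (cosint_pos (S K)) as H1.
    pose proof (cosint_rec K) as E1. pose proof (cosint2_rec K) as E2.
    assert (HK : 0 < INR (S K)) by (apply lt_0_INR; lia).
    assert (E3 : cosint2 (S K) / cosint (S K) = cosint2 K / cosint K - / INR (S K) ^ 2 / 2).
    { assert (HK' : 0 < 2 * INR K + 1) by (pose proof (pos_INR K); lra).
      replace (cosint K) with (2 * INR (S K) * cosint (S K) / (2 * INR K + 1)) by (rewrite E1; field; lra).
      replace (cosint2 (S K)) with ((INR (S K) * (2 * INR K + 1) * cosint2 K - cosint (S K)) / (2 * INR (S K) ^ 2))
        by (rewrite E2; field; lra).
      field. repeat split; lra. }
    rewrite E3, IH. unfold Rdiv. ring.
Qed.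

(** The O(1/K) error matters: in [mean_estimate] the sum is cut at K of order 1/t and multiplied by
    1/t^2, and the result has to be O(1/t). *)
Lemma basel_rate K :
  0 <= PI ^ 2 / 6 - rsum (fun i => / INR (S i) ^ 2) K <= 4 / INR (S K).
Proof.
  pose proof (basel_ratio K) as E. pose proof (cosint2_bounds K) as [H1 H2].
  pose proof (cosint_pos K) as H0. pose proof (cosint_rec K) as E1.
  assert (HK : 0 < INR (S K)) by (apply lt_0_INR; lia).
  assert (H3 : cosint2 K / cosint K <= 2 / INR (S K)).
  { apply (Rmult_le_reg_r (cosint K * INR (S K))); [nra|].
    replace (cosint2 K / cosint K * (cosint K * INR (S K))) with (cosint2 K * INR (S K)) by (field; lra).
    replace (2 / INR (S K) * (cosint K * INR (S K))) with (2 * cosint K) by (field; lra).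
    rewrite S_INR in *.
    assert (cosint2 K * (INR K + 1) <= 4 * (cosint K - cosint (S K)) * (INR K + 1)) by (apply Rmult_le_compat_r; lra).
    lra. }
  assert (H4 : 0 <= cosint2 K / cosint K) by (apply Rdiv_le_0_compat; lra).
  split; [lra|]. unfold Rdiv in *. lra.
Qed.

(** * Partition numbers as Fourier coefficients *)

(** Relative excess of |1 - a e^(i al)|^2 over its minimum (1-a)^2, from 1 - 2 a cos al + a^2 =
    (1-a)^2 + 2 a (1 - cos al). In [gph] the denominator is positive for 0 < a < 1, so the
    arctangent is the true angle and is continuous in [al]. *)
Definition gexc (a al : R) : R := 2 * a * (1 - cos al) / (1 - a) ^ 2.
Definition gph (a al : R) : R := atan (a * sin al / (1 - a * cos al)).

Lemma acos_lt1 a al : 0 < a < 1 -> 0 < 1 - a * cos al.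
Proof. intros Ha. pose proof (COS_bound al). nra. Qed.

Lemma gexc_ge0 a al : 0 < a < 1 -> 0 <= gexc a al.
Proof.
  intros Ha. pose proof (COS_bound al). apply Rdiv_le_0_compat; [nra|]. apply pow_lt; lra.
Qed.

(* [(1-a) exp (ln (1 + gexc) / 2)] and [- gph] are the modulus and argument of [1 - a e^(i al)]. *)
Lemma geom_polar a al (m := (1 - a) * exp (ln (1 + gexc a al) / 2)) : 0 < a < 1 ->
  0 < m /\ m * cos (gph a al) = 1 - a * cos al /\ m * sin (gph a al) = a * sin al.
Proof.
  intros Ha. pose proof (gexc_ge0 a al Ha) as Hx. pose proof (acos_lt1 a al Ha) as Hs.
  assert (Hm : 0 < m) by (apply Rmult_lt_0_compat; [lra|apply exp_pos]).
  assert (Em : m * m = (1 - a * cos al) ^ 2 + (a * sin al) ^ 2).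
  { unfold m. replace ((1 - a) * exp (ln (1 + gexc a al) / 2) * ((1 - a) * exp (ln (1 + gexc a al) / 2)))
      with ((1 - a) ^ 2 * (exp (ln (1 + gexc a al) / 2) * exp (ln (1 + gexc a al) / 2))) by ring.
    rewrite <- exp_plus. replace (ln (1 + gexc a al) / 2 + ln (1 + gexc a al) / 2) with (ln (1 + gexc a al)) by field.
    rewrite exp_ln by lra. unfold gexc.
    replace ((1 - a) ^ 2 * (1 + 2 * a * (1 - cos al) / (1 - a) ^ 2)) with ((1 - a) ^ 2 + 2 * a * (1 - cos al)) by (field; lra).
    pose proof (sin2_cos2 al) as H. unfold Rsqr in H.
    replace ((a * sin al) ^ 2) with (a ^ 2 * (sin al * sin al)) by ring.
    replace (sin al * sin al) with (1 - cos al * cos al) by lra. ring. }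
  assert (Eq : sqrt (1 + (a * sin al / (1 - a * cos al))²) = m / (1 - a * cos al)).
  { apply sqrt_lem_1.
    - pose proof (Rle_0_sqr (a * sin al / (1 - a * cos al))). lra.
    - apply Rlt_le, Rdiv_lt_0_compat; lra.
    - replace (m / (1 - a * cos al) * (m / (1 - a * cos al))) with (m * m / (1 - a * cos al) ^ 2) by (field; lra).
      rewrite Em. unfold Rsqr. field. lra. }
  split; [easy|]. unfold gph. rewrite cos_atan, sin_atan, Eq. split; field; lra.
Qed.

(** Real part of e^(i phi) (1-a) / (1 - a e^(i al)) multiplied by 1 - a e^(i al): the modulus and
    the angle of the factor cancel. *)
Lemma geom_cos a al phi : 0 < a < 1 ->
  exp (- (ln (1 + gexc a al) / 2)) * (cos (phi + gph a al) - a * cos (phi + gph a al + al))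
  = (1 - a) * cos phi.
Proof.
  intros Ha. destruct (geom_polar a al Ha) as (Hm & Hc & Hs).
  set (m := (1 - a) * exp (ln (1 + gexc a al) / 2)) in *.
  assert (Ee : exp (- (ln (1 + gexc a al) / 2)) = (1 - a) / m).
  { unfold m. rewrite exp_Ropp. pose proof (exp_pos (ln (1 + gexc a al) / 2)). field. lra. }
  rewrite Ee. set (psi := gph a al) in *.
  replace (cos (phi + psi) - a * cos (phi + psi + al)) with (m * cos phi).
  { field. lra. }
  rewrite (cos_plus (phi + psi) al).
  replace (cos (phi + psi) - a * (cos (phi + psi) * cos al - sin (phi + psi) * sin al))
    with (cos (phi + psi) * (1 - a * cos al) + sin (phi + psi) * (a * sin al)) by ring.
  rewrite <- Hc, <- Hs.
  replace phi with (phi + psi - psi) at 1 by ring. rewrite cos_minus. ring.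
Qed.

Definition wt (t : R) (j : nat) : R := exp (- (INR j * t)).

Lemma wt_bounds t j : 0 < t -> 0 < wt t (S j) < 1.
Proof.
  intros Ht. split; [apply exp_pos|]. rewrite <- exp_0. apply exp_increasing.
  assert (0 < INR (S j)) by (apply lt_0_INR; lia). nra.
Qed.

(* Minus the logarithm of the modulus, and the argument, of
   [prod_(j <= J) (1 - e^(-jt)) / (1 - e^(-jt + i j th))]. *)
Definition lmod (J : nat) (t th : R) : R :=
  rsum (fun i => ln (1 + gexc (wt t (S i)) (INR (S i) * th)) / 2) J.
Definition larg (J : nat) (t th : R) : R :=
  rsum (fun i => gph (wt t (S i)) (INR (S i) * th)) J.

Fixpoint normc (J : nat) (t : R) : R :=
  match J with O => 1 | S K => normc K t * (1 - wt t (S K)) end.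

(** Real part of the normalised product times e^(-i y th); its integral over [0, PI] is half of
    Cauchy's integral over the circle. The frequency [y] is real so that the saddle value PI^2/(6
    t^2) can be inserted before it is identified with an integer. *)
Definition fint (J : nat) (t y : R) (th : R) : R :=
  exp (- lmod J t th) * cos (larg J t th - y * th).
Definition fcoef (J : nat) (t : R) (n : Z) : R := RInt (fint J t (IZR n)) 0 PI.

Lemma lmod_ge0 J t th : 0 < t -> 0 <= lmod J t th.
Proof.
  intros Ht. induction J as [|J IH]; [unfold lmod; simpl; lra|].
  unfold lmod in *. cbn [rsum].
  pose proof (gexc_ge0 (wt t (S J)) (INR (S J) * th) (wt_bounds t J Ht)).
  assert (0 <= ln (1 + gexc (wt t (S J)) (INR (S J) * th))).
  { rewrite <- ln_1. apply ln_le; lra. }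
  lra.
Qed.

Lemma continuous_lmod J t th : 0 < t -> continuous (lmod J t) th.
Proof.
  intros Ht. induction J as [|J IH]; [apply continuous_const|].
  unfold lmod in *. cbn [rsum].
  apply (continuous_plus (V := R_NormedModule)); [exact IH|].
  apply continuous_derivable. unfold gexc.
  pose proof (wt_bounds t J Ht) as Ha. set (a := wt t (S J)) in *.
  pose proof (gexc_ge0 a (INR (S J) * th) Ha) as Hx. unfold gexc in Hx.
  auto_derive. unfold Rdiv, Rminus in *. simpl in *. lra. 
Qed.

Lemma continuous_larg J t th : 0 < t -> continuous (larg J t) th.
Proof.
  intros Ht. induction J as [|J IH]; [apply continuous_const|].
  unfold larg in *. cbn [rsum].
  apply (continuous_plus (V := R_NormedModule)); [exact IH|].
  apply continuous_derivable. unfold gph.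
  pose proof (acos_lt1 _ (INR (S J) * th) (wt_bounds t J Ht)) as Ha.
  auto_derive. simpl in *. lra.
Qed.

Lemma continuous_fint J t y th : 0 < t -> continuous (fint J t y) th.
Proof.
  intros Ht. unfold fint. apply (continuous_mult (K := R_AbsRing)).
  - apply continuous_comp with (g := exp); [|apply continuous_derivable; auto_derive; easy].
    apply (continuous_opp (V := R_NormedModule)). now apply continuous_lmod.
  - apply continuous_comp with (g := cos); [|apply continuous_derivable; auto_derive; easy].
    apply (continuous_minus (V := R_NormedModule)); [now apply continuous_larg|].
    apply continuous_derivable; auto_derive; easy.
Qed.

Lemma ex_RInt_fint J t y a b : 0 < t -> ex_RInt (fint J t y) a b.
Proof. intros Ht. apply ex_RInt_cont. intros; now apply continuous_fint. Qed.

Lemma fint_rec J t y th : 0 < t ->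
  fint (S J) t y th - wt t (S J) * fint (S J) t (y - INR (S J)) th = (1 - wt t (S J)) * fint J t y th.
Proof.
  intros Ht. unfold fint, lmod, larg. cbn [rsum].
  fold (lmod J t th). fold (larg J t th).
  pose proof (wt_bounds t J Ht) as Ha. set (a := wt t (S J)) in *. set (al := INR (S J) * th).
  pose proof (geom_cos a al (larg J t th - y * th) Ha) as E.
  replace (larg J t th + gph a al - y * th) with (larg J t th - y * th + gph a al) by ring.
  replace (larg J t th + gph a al - (y - INR (S J)) * th) with (larg J t th - y * th + gph a al + al) by (unfold al; ring).
  rewrite Ropp_plus_distr, exp_plus.
  transitivity (exp (- lmod J t th) * ((1 - a) * cos (larg J t th - y * th))); [rewrite <- E; ring|ring].
Qed.

Lemma fcoef_rec J t n : 0 < t ->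
  fcoef (S J) t n - wt t (S J) * fcoef (S J) t (n - Z.of_nat (S J)) = (1 - wt t (S J)) * fcoef J t n.
Proof.
  intros Ht. unfold fcoef.
  rewrite <- (RInt_scal (V := R_CompleteNormedModule) (fint (S J) _ _)) by now apply ex_RInt_fint.
  rewrite <- (RInt_minus (V := R_CompleteNormedModule)).
  2: now apply ex_RInt_fint.
  2: now apply (ex_RInt_scal (V := R_NormedModule)), ex_RInt_fint.
  rewrite <- (RInt_scal (V := R_CompleteNormedModule)) by now apply ex_RInt_fint.
  apply (RInt_ext (V := R_CompleteNormedModule)). intros th _.
  rewrite minus_IZR, <- INR_IZR_INZ. now apply fint_rec.
Qed.

Lemma fcoef_bound J t n : 0 < t -> Rabs (fcoef J t n) <= PI.
Proof.
  intros Ht. unfold fcoef. pose proof PI_RGT_0.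
  replace PI with ((PI - 0) * 1) at 2 by ring.
  apply abs_RInt_le_const; [lra|now apply ex_RInt_fint|].
  intros th _. unfold fint. rewrite Rabs_mult, Rabs_pos_eq by (apply Rlt_le, exp_pos).
  pose proof (lmod_ge0 J t th Ht). pose proof (COS_bound (larg J t th - IZR n * th)).
  assert (exp (- lmod J t th) <= 1).
  { rewrite <- exp_0. destruct (Req_dec (lmod J t th) 0) as [->|]; [right; f_equal; ring|].
    left; apply exp_increasing; lra. }
  assert (Rabs (cos (larg J t th - IZR n * th)) <= 1) by (apply Rabs_le; lra).
  pose proof (exp_pos (- lmod J t th)). pose proof (Rabs_pos (cos (larg J t th - IZR n * th))). nra.
Qed.

Lemma fcoef_0 t n : fcoef 0 t n = PI * IZR (pk 0 n).
Proof.
  unfold fcoef, fint, lmod, larg. cbn [rsum].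
  destruct (Z.eq_dec n 0) as [->|Hn].
  - change (pk 0 0) with 1%Z. rewrite (RInt_ext (V := R_CompleteNormedModule) _ (fun _ => 1)).
    + rewrite (RInt_const (V := R_CompleteNormedModule)). unfold scal; simpl; unfold mult; simpl. ring.
    + intros x _. rewrite Ropp_0, exp_0. replace (0 - 0 * x) with 0 by ring. rewrite cos_0. apply Rmult_1_l.
  - replace (pk 0 n) with 0%Z by (unfold pk; simpl; destruct (Z.eqb_spec n 0); easy).
    assert (Hn' : IZR n <> 0) by (intros H; apply eq_IZR in H; easy).
    rewrite Rmult_0_r.
    assert (S0 : forall k : Z, sin (IZR k * PI) = 0) by (intros k; apply sin_eq_0_1; now exists k).
    transitivity (sin (IZR n * PI) / IZR n - sin (IZR n * 0) / IZR n);
      [|rewrite S0, Rmult_0_r, sin_0; field; easy].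
    apply (RInt_derive_eq (fun x => sin (IZR n * x) / IZR n) (fun x => exp (- 0) * cos (0 - IZR n * x))).
    + intros x. auto_derive; [easy|]. rewrite Ropp_0, exp_0. replace (0 - IZR n * x) with (- (IZR n * x)) by ring.
      rewrite cos_neg. field. easy.
    + intros x. apply continuous_derivable. auto_derive. easy.
    + apply (RInt_correct (V := R_CompleteNormedModule)), ex_RInt_cont.
      intros x. apply continuous_derivable. auto_derive. easy.
Qed.

(** Both sides obey the recurrence that removes the factor J+1, so their difference satisfies d(n) =
    a d(n - (J+1)) with 0 < a < 1. Far to the left [pk] is zero and the integral is at most PI in
    absolute value, hence |d(n)| <= a^k PI for all large k. *)
Lemma fcoef_pk J t n : 0 < t -> fcoef J t n = PI * normc J t * exp (- (IZR n * t)) * IZR (pk J n).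
Proof.
  intros Ht. revert n. induction J as [|J IH]; intros n.
  - rewrite fcoef_0. simpl normc. destruct (Z.eq_dec n 0) as [->|Hn].
    + rewrite Rmult_0_l, Ropp_0, exp_0. ring.
    + replace (pk 0 n) with 0%Z by (unfold pk; simpl; destruct (Z.eqb_spec n 0); easy). ring.
  - pose proof (wt_bounds t J Ht) as Ha.
    pose (d := fun n => fcoef (S J) t n - PI * normc (S J) t * exp (- (IZR n * t)) * IZR (pk (S J) n)).
    assert (Hd : forall n, d n = wt t (S J) * d (n - Z.of_nat (S J))%Z).
    { intros m. unfold d. pose proof (fcoef_rec J t m Ht) as E. rewrite IH in E.
      rewrite (pk_S J m), plus_IZR.
      assert (Ee : exp (- (IZR m * t)) = wt t (S J) * exp (- (IZR (m - Z.of_nat (S J)) * t))).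
      { unfold wt. rewrite <- exp_plus. f_equal. rewrite minus_IZR, <- INR_IZR_INZ. ring. }
      replace (PI * normc (S J) t * exp (- (IZR m * t)) * (IZR (pk J m) + IZR (pk (S J) (m - Z.of_nat (S J)))))
        with ((1 - wt t (S J)) * (PI * normc J t * exp (- (IZR m * t)) * IZR (pk J m))
          + PI * normc (S J) t * exp (- (IZR m * t)) * IZR (pk (S J) (m - Z.of_nat (S J))))
        by (simpl normc; ring).
      rewrite <- E, Ee. ring. }
    assert (Hk : forall k, d n = wt t (S J) ^ k * d (n - Z.of_nat (k * S J))%Z).
    { induction k as [|k IHk]; [simpl; rewrite Z.sub_0_r; ring|].
      rewrite IHk, Hd. replace (n - Z.of_nat (k * S J) - Z.of_nat (S J))%Z with (n - Z.of_nat (S k * S J))%Z by lia.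
      simpl; ring. }
    enough (d n = 0) by (unfold d in *; lra).
    destruct (Req_dec (d n) 0) as [|Hne]; [easy|exfalso].
    assert (Hp : 0 < Rabs (d n)) by now apply Rabs_pos_lt. pose proof PI_RGT_0 as HPI.
    destruct (pow_lt_1_zero (wt t (S J)) ltac:(rewrite Rabs_pos_eq; lra) (Rabs (d n) / PI) ltac:(apply Rdiv_lt_0_compat; lra)) as [N HN].
    specialize (HN (Nat.max N (S (Z.to_nat n))) ltac:(lia)). set (k := Nat.max N (S (Z.to_nat n))) in *.
    specialize (Hk k).
    assert (Hb : Rabs (d (n - Z.of_nat (k * S J))%Z) <= PI).
    { unfold d. rewrite pk_neg by (unfold k; nia). rewrite Rmult_0_r, Rminus_0_r. now apply fcoef_bound. }
    assert (Rabs (d n) <= Rabs (wt t (S J) ^ k) * PI).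
    { rewrite Hk, Rabs_mult. apply Rmult_le_compat_l; [apply Rabs_pos|easy]. }
    assert (Rabs (wt t (S J) ^ k) * PI < Rabs (d n) / PI * PI) by (apply Rmult_lt_compat_r; lra).
    replace (Rabs (d n) / PI * PI) with (Rabs (d n)) in * by (field; lra). lra.
Qed.

(** * Modulus, phase and mean *)

Lemma rsum_le f g n : (forall i, (i < n)%nat -> f i <= g i) -> rsum f n <= rsum g n.
Proof.
  induction n as [|n IH]; intros H; simpl; [lra|].
  pose proof (H n ltac:(lia)). pose proof (IH ltac:(intros; apply H; lia)). lra.
Qed.

Lemma rsum_ext f g n : (forall i, (i < n)%nat -> f i = g i) -> rsum f n = rsum g n.
Proof. intros H. apply Rle_antisym; apply rsum_le; intros; rewrite H by easy; lra. Qed.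

Lemma rsum_scal c f n : rsum (fun i => c * f i) n = c * rsum f n.
Proof. induction n as [|n IH]; simpl; [ring|]. rewrite IH. ring. Qed.

Lemma rsum_plus f g n : rsum (fun i => f i + g i) n = rsum f n + rsum g n.
Proof. induction n as [|n IH]; simpl; [ring|]. rewrite IH. ring. Qed.

Lemma rsum_minus f g n : rsum (fun i => f i - g i) n = rsum f n - rsum g n.
Proof. induction n as [|n IH]; simpl; [ring|]. rewrite IH. ring. Qed.

Lemma rsum_const c n : rsum (fun _ => c) n = INR n * c.
Proof. induction n as [|n IH]; [simpl; ring|]. rewrite S_INR. simpl rsum. rewrite IH. ring. Qed.

Lemma rsum_ge0 f n : (forall i, (i < n)%nat -> 0 <= f i) -> 0 <= rsum f n.
Proof. intros H. replace 0 with (rsum (fun _ => 0) n) by (rewrite rsum_const; ring). now apply rsum_le. Qed.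

Lemma rsum_abs f n : Rabs (rsum f n) <= rsum (fun i => Rabs (f i)) n.
Proof.
  induction n as [|n IH]; simpl; [rewrite Rabs_R0; lra|].
  pose proof (Rabs_triang (rsum f n) (f n)). lra.
Qed.

Lemma rsum_mono f m n : (m <= n)%nat -> (forall i, 0 <= f i) -> rsum f m <= rsum f n.
Proof. intros H Hf. induction H as [|n H IH]; [lra|]. simpl. pose proof (Hf n). lra. Qed.

Lemma exp_le x y : x <= y -> exp x <= exp y.
Proof. intros [H| ->]; [left; now apply exp_increasing|lra]. Qed.

Lemma exp_ge_1p x : 1 + x <= exp x.
Proof. destruct (Req_dec x 0) as [->|H]; [rewrite exp_0; lra|]. left; now apply exp_ineq1. Qed.

Lemma exp_neg_le1 x : 0 <= x -> exp (- x) <= 1.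
Proof. intros H. rewrite <- exp_0. apply exp_le. lra. Qed.

Lemma exp_pow x n : exp x ^ n = exp (INR n * x).
Proof.
  induction n as [|n IH]; [simpl; now rewrite Rmult_0_l, exp_0|].
  rewrite S_INR. simpl pow. rewrite IH, <- exp_plus. f_equal. ring.
Qed.

Lemma geom_exp_sum s J : 0 < s -> rsum (fun i => exp (- (INR (S i) * s))) J <= / s.
Proof.
  intros Hs.
  enough (rsum (fun i => exp (- (INR (S i) * s))) J <= (1 - exp (- (INR J * s))) / s).
  { pose proof (exp_pos (- (INR J * s))). assert (0 < / s) by now apply Rinv_0_lt_compat.
    unfold Rdiv in *. nra. }
  induction J as [|J IH]; [simpl; rewrite Rmult_0_l, Ropp_0, exp_0; right; field; lra|].
  cbn [rsum]. replace (- (INR (S J) * s)) with (- (INR J * s) + - s) by (rewrite S_INR; ring).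
  rewrite exp_plus. set (e := exp (- (INR J * s))) in *.
  assert (He : 0 < e) by apply exp_pos.
  assert (Hm : exp (- s) * (1 + s) <= 1).
  { pose proof (exp_ge_1p s). pose proof (exp_pos (- s)).
    assert (exp (- s) * exp s = 1) by (rewrite <- exp_plus, Rplus_opp_l; apply exp_0). nra. }
  apply (Rmult_le_compat_r s) in IH; [|lra]. unfold Rdiv in IH. rewrite Rmult_assoc, Rinv_l, Rmult_1_r in IH by lra.
  apply (Rmult_le_reg_r s); [easy|]. unfold Rdiv. rewrite Rmult_assoc, Rinv_l, Rmult_1_r by lra. nra.
Qed.

Lemma geom_weight_inv y : 0 < y -> / (1 - exp (- y)) <= (1 + y) / y.
Proof.
  intros Hy. pose proof (exp_ge_1p y). pose proof (exp_pos (- y)).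
  assert (exp (- y) * exp y = 1) by (rewrite <- exp_plus, Rplus_opp_l; apply exp_0).
  assert (exp (- y) < 1) by (rewrite <- exp_0; apply exp_increasing; lra).
  apply (Rmult_le_reg_l (1 - exp (- y))); [lra|]. rewrite Rinv_r by lra.
  apply (Rmult_le_reg_r y); [easy|].
  replace ((1 - exp (- y)) * ((1 + y) / y) * y) with ((1 - exp (- y)) * (1 + y)) by (field; lra). nra.
Qed.

(** Separates the singularity y^(-k) from a decay that remains summable over j when y = j t. The
    constant is 6^3, from 1 + y <= 6 e^(y/6). *)
Lemma geom_weight_bound y k : 0 < y -> (k <= 3)%nat ->
  exp (- y) / (1 - exp (- y)) ^ k <= 216 * exp (- (y / 2)) / y ^ k.
Proof.
  intros Hy Hk. pose proof (geom_weight_inv y Hy) as H.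
  assert (exp (- y) < 1) by (rewrite <- exp_0; apply exp_increasing; lra).
  assert (H1 : (1 + y) ^ k <= 216 * exp (y / 2)).
  { apply Rle_trans with ((1 + y) ^ 3); [apply Rle_pow; [lra|easy]|].
    replace (exp (y / 2)) with (exp (y / 6) ^ 3) by (rewrite exp_pow; f_equal; simpl; field).
    replace 216 with (6 ^ 3) by ring. rewrite <- Rpow_mult_distr. apply pow_incr.
    pose proof (exp_ge_1p (y / 6)). lra. }
  assert (H2 : (/ (1 - exp (- y))) ^ k <= ((1 + y) / y) ^ k).
  { apply pow_incr. split; [|easy]. left. apply Rinv_0_lt_compat. lra. }
  unfold Rdiv at 1. rewrite <- pow_inv.
  assert (0 < / y ^ k) by (apply Rinv_0_lt_compat, pow_lt; easy).
  assert (He : exp (- (y / 2)) = exp (- y) * exp (y / 2)) by (rewrite <- exp_plus; f_equal; field).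
  pose proof (exp_pos (- y)).
  apply Rle_trans with (exp (- y) * ((1 + y) / y) ^ k); [apply Rmult_le_compat_l; lra|].
  rewrite He. unfold Rdiv in *. rewrite Rpow_mult_distr, pow_inv.
  replace (216 * (exp (- y) * exp (y * / 2)) * / y ^ k) with (exp (- y) * (216 * exp (y * / 2) * / y ^ k)) by ring.
  apply Rmult_le_compat_l; [lra|]. apply Rmult_le_compat_r; [lra|easy].
Qed.

Lemma one_minus_cos x : 1 - cos x = 2 * (sin (x / 2)) ^ 2.
Proof.
  replace (cos x) with (cos (2 * (x / 2))) by (f_equal; field). rewrite cos_2a.
  pose proof (sin2_cos2 (x / 2)) as H. unfold Rsqr in H. nra.
Qed.

Lemma sin_sq_le x : 0 <= x -> sin x ^ 2 <= x ^ 2.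
Proof.
  intros Hx. pose proof (SIN_bound x).
  destruct (Req_dec x 0) as [->|Hne]; [rewrite sin_0; lra|].
  pose proof (sin_lt_x x ltac:(lra)).
  destruct (Rle_dec x PI) as [H1|H1].
  - pose proof (sin_ge_0 x Hx H1). nra.
  - pose proof PI2_3_2. nra.
Qed.

Lemma one_minus_cos_le x : 0 <= x -> 1 - cos x <= x ^ 2 / 2.
Proof. intros Hx. rewrite one_minus_cos. pose proof (sin_sq_le (x / 2) ltac:(lra)). lra. Qed.

Lemma one_minus_cos_ge x : 0 <= x <= PI -> x ^ 2 / 8 <= 1 - cos x.
Proof. intros Hx. rewrite one_minus_cos. pose proof (sin_ge_half (x / 2) ltac:(lra)). nra. Qed.

Lemma INR_S_pos i : 0 < INR (S i).
Proof. apply lt_0_INR. lia. Qed.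

(** Keeps the integrand large near 0: for th <= t^(3/2) the modulus is at least e^(-216). The
    constant is 216/2 from the weights times 2/t from the geometric sum. *)
Lemma lmod_le J t th : 0 < t -> 0 <= th -> lmod J t th <= 216 * th ^ 2 / t ^ 3.
Proof.
  intros Ht Hth.
  apply Rle_trans with (rsum (fun i => 108 * th ^ 2 / t ^ 2 * exp (- (INR (S i) * (t / 2)))) J).
  - apply rsum_le. intros i _. pose proof (INR_S_pos i) as Hi. set (j := INR (S i)) in *.
    pose proof (wt_bounds t i Ht) as Ha. unfold wt in *. fold j in Ha. fold j.
    set (a := exp (- (j * t))) in *.
    pose proof (gexc_ge0 a (j * th) Ha) as Hx.
    assert (Hl : ln (1 + gexc a (j * th)) <= gexc a (j * th)).
    { rewrite <- (ln_exp (gexc a (j * th))) at 2. apply ln_le; [lra|]. apply exp_ge_1p. }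
    assert (Hjt : 0 < j * t) by nra.
    pose proof (geom_weight_bound (j * t) 2 Hjt ltac:(lia)) as Hw. fold a in Hw.
    pose proof (one_minus_cos_le (j * th) ltac:(nra)) as Hc.
    apply Rle_trans with (a / (1 - a) ^ 2 * ((j * th) ^ 2 / 2)).
    { replace (ln (1 + gexc a (j * th)) / 2) with (/ 2 * ln (1 + gexc a (j * th))) by field.
      apply Rle_trans with (a / (1 - a) ^ 2 * (1 - cos (j * th))).
      - replace (a / (1 - a) ^ 2 * (1 - cos (j * th))) with (/ 2 * gexc a (j * th)) by (unfold gexc; field; lra). lra.
      - apply Rmult_le_compat_l; [|easy]. apply Rdiv_le_0_compat; [lra|]. apply pow_lt; lra. }
    replace (108 * th ^ 2 / t ^ 2 * exp (- (j * (t / 2))))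
      with (216 * exp (- (j * t / 2)) / (j * t) ^ 2 * ((j * th) ^ 2 / 2)).
    { apply Rmult_le_compat_r; [|easy]. pose proof (pow2_ge_0 (j * th)). lra. }
    replace (- (j * (t / 2))) with (- (j * t / 2)) by field. field. lra.
  - rewrite rsum_scal. pose proof (geom_exp_sum (t / 2) J ltac:(lra)) as H.
    replace (216 * th ^ 2 / t ^ 3) with (108 * th ^ 2 / t ^ 2 * / (t / 2)) by (field; lra).
    apply Rmult_le_compat_l; [|easy]. apply Rdiv_le_0_compat; [nra|]. apply pow_lt; lra.
Qed.

Lemma is_derive_gph a x : 0 < a < 1 ->
  is_derive (fun x => gph a x - a / (1 - a) * x) x
    (- (a * (1 + a) * (1 - cos x) / ((1 - a) * ((1 - a) ^ 2 + 2 * a * (1 - cos x))))).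
Proof.
  intros Ha. pose proof (acos_lt1 a x Ha) as Hd. pose proof (COS_bound x) as Hc.
  assert (HD : 0 < (1 - a) ^ 2 + 2 * a * (1 - cos x)) by nra.
  assert (E : (1 - a) ^ 2 + 2 * a * (1 - cos x) = (1 - a * cos x) ^ 2 + (a * sin x) ^ 2).
  { pose proof (sin2_cos2 x) as H. unfold Rsqr in H.
    replace ((a * sin x) ^ 2) with (a ^ 2 * (sin x * sin x)) by ring.
    replace (sin x * sin x) with (1 - cos x * cos x) by lra. ring. }
  unfold gph. auto_derive; [lra|].
  assert (E2 : a * (1 * cos x) * / (1 + - (a * cos x)) +
     a * sin x * (- - (a * (1 * - sin x)) * / ((1 + - (a * cos x)) * (1 + - (a * cos x))))
     = (a * cos x - a ^ 2) / (1 - a * cos x) ^ 2).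
  { transitivity ((a * cos x - a ^ 2 * (cos x * cos x + sin x * sin x)) / (1 - a * cos x) ^ 2); [field; lra|].
    pose proof (sin2_cos2 x) as H. unfold Rsqr in H. replace (cos x * cos x + sin x * sin x) with 1 by lra. field; lra. }
  rewrite E2.
  replace (1 + a * sin x * / (1 + - (a * cos x)) * (a * sin x * / (1 + - (a * cos x)) * 1))
    with (((1 - a) ^ 2 + 2 * a * (1 - cos x)) / (1 - a * cos x) ^ 2) by (rewrite E; field; lra).
  field. repeat split; lra.
Qed.

(** The linear term is the tangent at 0, and the derivative of the difference carries a factor 1 -
    cos x, hence is O(x^2); the mean value theorem gives a cubic error. *)
Lemma gph_bound a x : 0 < a < 1 -> 0 <= x -> Rabs (gph a x - a / (1 - a) * x) <= a / (1 - a) ^ 3 * x ^ 3.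
Proof.
  intros Ha Hx. destruct (Req_dec x 0) as [->|Hne].
  { unfold gph. rewrite sin_0, Rmult_0_r. unfold Rdiv. rewrite Rmult_0_l, atan_0.
    rewrite Rmult_0_r, Rminus_0_r, Rabs_R0. simpl. lra. }
  destruct (MVT_gen (fun x => gph a x - a / (1 - a) * x) 0 x
    (fun x => - (a * (1 + a) * (1 - cos x) / ((1 - a) * ((1 - a) ^ 2 + 2 * a * (1 - cos x)))))) as (c & Hc & E).
  - intros; now apply is_derive_gph.
  - intros y _. apply continuity_pt_filterlim, (continuous_derivable (fun x => gph a x - a / (1 - a) * x)).
    eexists; now apply is_derive_gph.
  - rewrite Rmin_left, Rmax_right in Hc by lra.
    assert (E0 : gph a 0 - a / (1 - a) * 0 = 0).
    { unfold gph. rewrite sin_0, Rmult_0_r. unfold Rdiv at 1. rewrite Rmult_0_l, atan_0. ring. }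
    rewrite E0, Rminus_0_r in E. rewrite E, Rminus_0_r, Rabs_mult, Rabs_Ropp, (Rabs_pos_eq x) by lra.
    pose proof (COS_bound c) as Hcos. pose proof (one_minus_cos_le c ltac:(lra)) as H1.
    assert (H1a : 0 < (1 - a) ^ 2) by (apply pow_lt; lra).
    assert (HD : 0 < (1 - a) ^ 2 + 2 * a * (1 - cos c)) by nra.
    rewrite Rabs_pos_eq.
    2: { apply Rdiv_le_0_compat; [apply Rmult_le_pos; nra|apply Rmult_lt_0_compat; lra]. }
    replace (a / (1 - a) ^ 3 * x ^ 3) with (a * x ^ 2 / (1 - a) ^ 3 * x) by (field; lra).
    apply Rmult_le_compat_r; [lra|].
    replace ((1 - a) ^ 3) with ((1 - a) * (1 - a) ^ 2) by ring.
    unfold Rdiv. apply Rmult_le_compat.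
    + apply Rmult_le_pos; nra.
    + left. apply Rinv_0_lt_compat. apply Rmult_lt_0_compat; lra.
    + rewrite Rmult_assoc. apply Rmult_le_compat_l; [lra|].
      assert (c ^ 2 <= x ^ 2) by (apply pow_incr; lra). nra.
    + apply Rinv_le_contravar; [apply Rmult_lt_0_compat; lra|]. apply Rmult_le_compat_l; [lra|]. nra.
Qed.

(** Slope of [larg] at th = 0, the sum of j / (e^(jt) - 1): the expected size of a partition into
    parts at most J weighted by e^(-nt). *)
Definition mean (J : nat) (t : R) : R :=
  rsum (fun i => INR (S i) * (wt t (S i) / (1 - wt t (S i)))) J.

(** At the scale th = A t^(3/2) the right side is 432 A^3 sqrt t, so the phase is linear up to a
    small error where the modulus is concentrated. *)
Lemma larg_bound J t th : 0 < t -> 0 <= th ->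
  Rabs (larg J t th - mean J t * th) <= 432 * th ^ 3 / t ^ 4.
Proof.
  intros Ht Hth. unfold larg, mean. rewrite Rmult_comm, <- rsum_scal, <- rsum_minus.
  eapply Rle_trans; [apply rsum_abs|].
  apply Rle_trans with (rsum (fun i => 216 * th ^ 3 / t ^ 3 * exp (- (INR (S i) * (t / 2)))) J).
  - apply rsum_le. intros i _. pose proof (INR_S_pos i) as Hi. set (j := INR (S i)) in *.
    pose proof (wt_bounds t i Ht) as Ha. unfold wt in *. fold j in Ha. fold j.
    set (a := exp (- (j * t))) in *.
    assert (Hjt : 0 < j * t) by nra.
    pose proof (geom_weight_bound (j * t) 3 Hjt ltac:(lia)) as Hw. fold a in Hw.
    pose proof (gph_bound a (j * th) Ha ltac:(nra)) as H.
    replace (th * (j * (a / (1 - a)))) with (a / (1 - a) * (j * th)) by ring.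
    eapply Rle_trans; [exact H|].
    replace (216 * th ^ 3 / t ^ 3 * exp (- (j * (t / 2))))
      with (216 * exp (- (j * t / 2)) / (j * t) ^ 3 * (j * th) ^ 3).
    { apply Rmult_le_compat_r; [apply pow_le; nra|easy]. }
    replace (- (j * (t / 2))) with (- (j * t / 2)) by field. field. lra.
  - rewrite rsum_scal. pose proof (geom_exp_sum (t / 2) J ltac:(lra)) as H.
    replace (432 * th ^ 3 / t ^ 4) with (216 * th ^ 3 / t ^ 3 * / (t / 2)) by (field; lra).
    apply Rmult_le_compat_l; [|easy]. apply Rdiv_le_0_compat; [|apply pow_lt; lra].
    pose proof (pow_le th 3 Hth). lra.
Qed.

(** * Decay of the modulus away from the real axis *)

Lemma ln_1p_ge y : -1 < y -> y / (1 + y) <= ln (1 + y).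
Proof.
  intros Hy. rewrite <- (ln_exp (y / (1 + y))). apply ln_le; [apply exp_pos|].
  pose proof (exp_ge_1p (- (y / (1 + y)))) as H1.
  replace (1 + - (y / (1 + y))) with (/ (1 + y)) in H1 by (field; lra).
  set (z := y / (1 + y)) in *.
  assert (E : exp (- z) * exp z = 1) by (rewrite <- exp_plus, Rplus_opp_l; apply exp_0).
  pose proof (exp_pos z). assert (0 < / (1 + y)) by (apply Rinv_0_lt_compat; lra).
  apply (Rmult_le_reg_r (/ (1 + y))); [easy|]. rewrite Rinv_r by lra. nra.
Qed.

Lemma lmod_mono m J t th : 0 < t -> (m <= J)%nat -> lmod m t th <= lmod J t th.
Proof.
  intros Ht H. unfold lmod. apply rsum_mono; [easy|]. intros i.
  pose proof (gexc_ge0 (wt t (S i)) (INR (S i) * th) (wt_bounds t i Ht)) as Hx.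
  assert (0 <= ln (1 + gexc (wt t (S i)) (INR (S i) * th))) by (rewrite <- ln_1; apply ln_le; lra). lra.
Qed.

(** For j t <= 1 the weight a = e^(-jt) is at least 1/e >= 1/3, and 1 - a <= j t. *)
Lemma gexc_ge t j al : 0 < t -> 0 < j -> j * t <= 1 ->
  2 / 3 * (1 - cos al) / (j * t) ^ 2 <= gexc (exp (- (j * t))) al.
Proof.
  intros Ht Hj H. assert (Hjt : 0 < j * t) by nra. set (a := exp (- (j * t))).
  pose proof (COS_bound al) as Hc.
  assert (a < 1) by (unfold a; rewrite <- exp_0; apply exp_increasing; lra).
  assert (H1 : 1 - a <= j * t) by (unfold a; pose proof (exp_ge_1p (- (j * t))); lra).
  assert (H2 : / 3 <= a).
  { unfold a. rewrite exp_Ropp. apply Rinv_le_contravar; [apply exp_pos|].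
    apply Rle_trans with (exp 1); [now apply exp_le|apply exp_le_3]. }
  unfold gexc, Rdiv. apply Rmult_le_compat; [nra| |nra|].
  - left. apply Rinv_0_lt_compat, pow_lt; easy.
  - apply Rinv_le_contravar; [apply pow_lt; lra|]. apply pow_incr. lra.
Qed.

(** The Dirichlet kernel, by telescoping; it bounds the cosine sum by O(1/th). *)
Lemma cos_sum m th : 2 * sin (th / 2) * rsum (fun i => cos (INR (S i) * th)) m = sin (INR m * th + th / 2) - sin (th / 2).
Proof.
  induction m as [|m IH]; [simpl; rewrite Rmult_0_l, Rplus_0_l; ring|].
  cbn [rsum]. rewrite Rmult_plus_distr_l, IH, S_INR.
  replace (INR m * th + th / 2) with ((INR m + 1) * th - th / 2) by field.
  rewrite sin_minus, sin_plus. ring.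
Qed.

(** For th <= PI t each of the first m, about 1/t, angles j th stays in [0, PI], where 1 - cos is
    quadratic. Every such factor contributes th^2/(48 t^2): 12 comes from (2/3)/8 and exceeds PI^2,
    and two halvings give 48. *)
Lemma lmod_ge_near m J t th : 0 < t -> (m <= J)%nat -> INR m * t <= 1 -> 0 <= th <= PI * t ->
  INR m * th ^ 2 / (48 * t ^ 2) <= lmod J t th.
Proof.
  intros Ht HJ Hm Hth. eapply Rle_trans; [|apply (lmod_mono m); easy].
  replace (INR m * th ^ 2 / (48 * t ^ 2)) with (rsum (fun _ => th ^ 2 / (48 * t ^ 2)) m) by (rewrite rsum_const; field; lra).
  apply rsum_le. intros i Hi. pose proof (INR_S_pos i) as Hp.
  assert (Him : INR (S i) <= INR m) by (apply le_INR; lia). set (j := INR (S i)) in *.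
  assert (Hjt : 0 < j * t <= 1) by nra.
  pose proof PI_lt_16_5. pose proof PI_RGT_0.
  assert (Hal : 0 <= j * th <= PI).
  { split; [nra|]. apply Rle_trans with (j * (PI * t)); [apply Rmult_le_compat_l; lra|].
    replace (j * (PI * t)) with (PI * (j * t)) by ring. nra. }
  pose proof (gexc_ge t j (j * th) Ht Hp (proj2 Hjt)) as Hg.
  pose proof (one_minus_cos_ge (j * th) Hal) as Hc. unfold wt. fold j.
  set (y := th ^ 2 / (12 * t ^ 2)).
  assert (Ht2 : 0 < t ^ 2) by (apply pow_lt; lra).
  assert (Hy0 : 0 <= y) by (apply Rdiv_le_0_compat; nra).
  assert (Hy1 : y <= 1).
  { apply (Rmult_le_reg_r (12 * t ^ 2)); [lra|]. unfold y. replace (th ^ 2 / (12 * t ^ 2) * (12 * t ^ 2)) with (th ^ 2) by (field; lra).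
    apply Rle_trans with ((PI * t) ^ 2); [apply pow_incr; lra|]. replace ((PI * t) ^ 2) with (PI ^ 2 * t ^ 2) by ring.
    rewrite Rmult_1_l. apply Rmult_le_compat_r; [lra|]. nra. }
  assert (Hyg : y <= gexc (exp (- (j * t))) (j * th)).
  { eapply Rle_trans; [|exact Hg]. unfold y.
    replace (th ^ 2 / (12 * t ^ 2)) with (2 / 3 * ((j * th) ^ 2 / 8) / (j * t) ^ 2) by (field; lra).
    unfold Rdiv at 1 4. apply Rmult_le_compat_r; [|lra]. left. apply Rinv_0_lt_compat, pow_lt; lra. }
  pose proof (ln_1p_ge y ltac:(lra)) as Hl.
  assert (ln (1 + y) <= ln (1 + gexc (exp (- (j * t))) (j * th))) by (apply ln_le; lra).
  assert (y / 2 <= y / (1 + y)).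
  { unfold Rdiv. apply Rmult_le_compat_l; [easy|]. apply Rinv_le_contravar; lra. }
  replace (th ^ 2 / (48 * t ^ 2)) with (y / 2 / 2) by (unfold y; field; lra). lra.
Qed.

(** For th >= PI t the angles j th with j <= m spread out, so that 1 - cos (j th) is bounded below
    on average: the cosines add up to at most 2/(3t), leaving (1/7)(1/t - 1 - 2/(3t)), and 1/t >= 6
    makes this at least 1/(42 t). *)
Lemma lmod_ge_far m J t th : 0 < t <= 1 / 6 -> (m <= J)%nat -> INR m * t <= 1 -> 1 <= (INR m + 1) * t ->
  PI * t <= th <= PI -> / (42 * t) <= lmod J t th.
Proof.
  intros Ht HJ Hm Hm' Hth. eapply Rle_trans; [|apply (lmod_mono m); easy].
  pose proof PI2_3_2. assert (Hth0 : 3 * t < th) by nra.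
  apply Rle_trans with (rsum (fun i => / 7 * (1 - cos (INR (S i) * th))) m).
  - rewrite rsum_scal, rsum_minus, rsum_const.
    assert (Hs : th / 4 <= sin (th / 2)) by (pose proof (sin_ge_half (th / 2) ltac:(lra)); lra).
    pose proof (cos_sum m th) as E. pose proof (SIN_bound (INR m * th + th / 2)).
    set (C := rsum (fun i => cos (INR (S i) * th)) m) in *.
    assert (HC : C <= 2 / 3 * / t).
    { assert (H3 : 0 < / t) by (apply Rinv_0_lt_compat; lra). assert (t * / t = 1) by (apply Rinv_r; lra).
      destruct (Rle_dec C 0) as [|HC]; [lra|].
      assert (th / 4 * C <= sin (th / 2) * C) by (apply Rmult_le_compat_r; lra).
      assert (3 * t * C <= 2) by nra.
      apply (Rmult_le_reg_l (3 * t)); [lra|]. nra. }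
    assert (Hmt : / t - 1 <= INR m).
    { apply (Rmult_le_reg_r t); [lra|]. rewrite Rmult_minus_distr_r, Rinv_l by lra. lra. }
    assert (6 <= / t) by (rewrite <- (Rinv_inv 6); apply Rinv_le_contravar; lra).
    rewrite Rinv_mult. lra.
  - apply rsum_le. intros i Hi. pose proof (INR_S_pos i) as Hp.
    assert (Him : INR (S i) <= INR m) by (apply le_INR; lia). set (j := INR (S i)) in *.
    assert (Hjt : 0 < j * t <= 1) by nra.
    pose proof (gexc_ge t j (j * th) ltac:(lra) Hp (proj2 Hjt)) as Hg. unfold wt. fold j.
    pose proof (COS_bound (j * th)) as Hc.
    set (y := 2 / 3 * (1 - cos (j * th))) in *.
    assert (Hyg : y <= gexc (exp (- (j * t))) (j * th)).
    { eapply Rle_trans; [|exact Hg]. unfold Rdiv. rewrite <- (Rmult_1_r y) at 1.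
      apply Rmult_le_compat_l; [unfold y; lra|]. rewrite <- Rinv_1. apply Rinv_le_contravar; [apply pow_lt; lra|].
      rewrite <- (pow1 2). apply pow_incr; lra. }
    assert (Hy : 0 <= y <= 4 / 3) by (unfold y; lra).
    pose proof (ln_1p_ge y ltac:(lra)) as Hl.
    assert (ln (1 + y) <= ln (1 + gexc (exp (- (j * t))) (j * th))) by (apply ln_le; lra).
    assert (y * / (7 / 3) <= y / (1 + y)).
    { unfold Rdiv at 2. apply Rmult_le_compat_l; [lra|]. apply Rinv_le_contravar; lra. }
    replace (/ 7 * (1 - cos (j * th))) with (y * / (7 / 3) / 2) by (unfold y; field). lra.
Qed.

Lemma nat_floor_inv t : 0 < t -> exists m, INR m * t <= 1 /\ 1 <= (INR m + 1) * t.
Proof.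
  intros Ht. assert (0 < / t) by now apply Rinv_0_lt_compat.
  destruct (nfloor_ex (/ t)) as [m Hm]; [lra|]. exists m.
  assert (t * / t = 1) by (apply Rinv_r; lra). nra.
Qed.

(** Merges both ranges of th. Near 0, with y = th^2/t^3, one has (1+y)^2 <= 192^2 e^(y/96). Far away
    (t^3 + th^2)^2 is at most 17^2 and t^6 e^(1/(42t)) is bounded below, by the sixth power of 1 <=
    252 t e^(1/(252t)). *)
Lemma modulus_decay : exists C, 0 < C /\ forall t, 0 < t <= 1 / 6 -> forall m J th,
  INR m * t <= 1 -> 1 <= (INR m + 1) * t -> (m <= J)%nat -> 0 <= th <= PI ->
  exp (- lmod J t th) * (t ^ 3 + th ^ 2) ^ 2 <= C * t ^ 6.
Proof.
  exists (192 ^ 2 + 17 ^ 2 * 252 ^ 6). split; [lra|]. intros t Ht m J th Hm Hm' HJ Hth.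
  assert (Ht3 : 0 < t ^ 3) by (apply pow_lt; lra). assert (Ht6 : 0 < t ^ 6) by (apply pow_lt; lra).
  set (L := lmod J t th). pose proof (exp_pos (- L)) as HeL.
  enough (H : (t ^ 3 + th ^ 2) ^ 2 <= (192 ^ 2 + 17 ^ 2 * 252 ^ 6) * t ^ 6 * exp L).
  { apply (Rmult_le_compat_l (exp (- L))) in H; [|lra].
    replace (exp (- L) * ((192 ^ 2 + 17 ^ 2 * 252 ^ 6) * t ^ 6 * exp L))
      with ((192 ^ 2 + 17 ^ 2 * 252 ^ 6) * t ^ 6 * (exp (- L) * exp L)) in H by ring.
    rewrite <- exp_plus, Rplus_opp_l, exp_0, Rmult_1_r in H. easy. }
  pose proof (exp_pos L) as HeL'.
  destruct (Rle_dec th (PI * t)) as [H1|H1].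
  - pose proof (lmod_ge_near m J t th ltac:(lra) HJ Hm ltac:(lra)) as HL. fold L in HL.
    set (y := th ^ 2 / t ^ 3).
    assert (Hy : 0 <= y) by (apply Rdiv_le_0_compat; [apply pow2_ge_0|easy]).
    assert (HyL : y / 96 <= L).
    { eapply Rle_trans; [|exact HL].
      replace (INR m * th ^ 2 / (48 * t ^ 2)) with (INR m * t * y / 48) by (unfold y; field; lra). nra. }
    assert (E : (t ^ 3 + th ^ 2) ^ 2 = t ^ 6 * (1 + y) ^ 2) by (unfold y; field; lra).
    rewrite E.
    assert (H2 : (1 + y) ^ 2 <= 192 ^ 2 * exp L).
    { apply Rle_trans with ((192 * exp (y / 192)) ^ 2).
      - apply pow_incr. pose proof (exp_ge_1p (y / 192)). lra.
      - rewrite Rpow_mult_distr, exp_pow. apply Rmult_le_compat_l; [lra|]. apply exp_le. simpl INR. lra. }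
    apply Rle_trans with (t ^ 6 * (192 ^ 2 * exp L)); [apply Rmult_le_compat_l; lra|].
    assert (0 < t ^ 6 * exp L) by nra. nra.
  - pose proof (lmod_ge_far m J t th Ht HJ Hm Hm' ltac:(lra)) as HL. fold L in HL.
    assert (H2 : (t ^ 3 + th ^ 2) ^ 2 <= 17 ^ 2).
    { apply pow_incr. pose proof PI_lt_16_5. split; [nra|].
      assert (t ^ 3 <= 1 ^ 3) by (apply pow_incr; lra). nra. }
    assert (H3 : 1 <= 252 ^ 6 * t ^ 6 * exp L).
    { assert (H4 : 1 <= 252 * t * exp (/ (252 * t))).
      { pose proof (exp_ge_1p (/ (252 * t))) as H4.
        assert (H5 : 252 * t * / (252 * t) = 1) by (apply Rinv_r; lra).
        assert (0 < / (252 * t)) by (apply Rinv_0_lt_compat; lra). nra. }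
      apply Rle_trans with ((252 * t * exp (/ (252 * t))) ^ 6); [apply pow_R1_Rle; easy|].
      rewrite !Rpow_mult_distr, exp_pow. apply Rmult_le_compat_l; [nra|]. apply exp_le.
      replace (INR 6 * / (252 * t)) with (/ (42 * t)) by (simpl; field; lra). easy. }
    assert (0 < t ^ 6 * exp L) by nra.
    apply Rle_trans with (17 ^ 2 * (252 ^ 6 * t ^ 6 * exp L)); nra.
Qed.

(** * Asymptotics of the mean *)

Lemma rsum_exchange (f : nat -> nat -> R) m n :
  rsum (fun i => rsum (fun j => f i j) n) m = rsum (fun j => rsum (fun i => f i j) m) n.
Proof.
  induction m as [|m IH]; simpl; [now rewrite rsum_const, Rmult_0_r|].
  rewrite IH, <- rsum_plus. reflexivity.
Qed.

Lemma nonneg_of_derive (f df : R -> R) x : 0 <= x -> f 0 = 0 ->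
  (forall y, is_derive f y (df y)) -> (forall y, 0 <= y <= x -> 0 <= df y) -> 0 <= f x.
Proof.
  intros Hx H0 Hd Hp.
  destruct (MVT_gen f 0 x df) as (c & Hc & E).
  - intros; apply Hd.
  - intros y _. apply continuity_pt_filterlim, continuous_derivable. eexists; apply Hd.
  - rewrite Rmin_left, Rmax_right in Hc by lra. pose proof (Hp c Hc). nra.
Qed.

Lemma cosh_ge1 x : 1 <= (exp x + exp (- x)) / 2.
Proof. pose proof (exp_ge_1p x). pose proof (exp_ge_1p (- x)). lra. Qed.

(** Starting from e <= 3, integrating twice improves sinh y <= 3 y to cosh y <= 1 + 3 y^2/2 and then
    to the cubic bound. *)
Lemma sinh_bounds x : 0 <= x <= 1 -> x <= (exp x - exp (- x)) / 2 <= x + x ^ 3 / 2.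
Proof.
  intros Hx.
  assert (S1 : forall y, 0 <= y <= 1 -> (exp y - exp (- y)) / 2 <= 3 * y).
  { intros y Hy. enough (0 <= 3 * y - (exp y - exp (- y)) / 2) by lra.
    apply (nonneg_of_derive (fun y => 3 * y - (exp y - exp (- y)) / 2) (fun y => 3 - (exp y + exp (- y)) / 2)); [lra| | |].
    - rewrite Ropp_0. lra.
    - intros z. auto_derive; [easy|]. lra.
    - intros z Hz. pose proof exp_le_3. pose proof (exp_le z 1 ltac:(lra)). pose proof (exp_neg_le1 z ltac:(lra)). lra. }
  assert (C1 : forall y, 0 <= y <= 1 -> (exp y + exp (- y)) / 2 <= 1 + 3 * y ^ 2 / 2).
  { intros y Hy. enough (0 <= 1 + 3 * y ^ 2 / 2 - (exp y + exp (- y)) / 2) by lra.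
    apply (nonneg_of_derive (fun y => 1 + 3 * y ^ 2 / 2 - (exp y + exp (- y)) / 2) (fun y => 3 * y - (exp y - exp (- y)) / 2)); [lra| | |].
    - rewrite Ropp_0, exp_0. lra.
    - intros z. auto_derive; [easy|]. lra.
    - intros z Hz. pose proof (S1 z ltac:(lra)). lra. }
  split.
  - enough (0 <= (exp x - exp (- x)) / 2 - x) by lra.
    apply (nonneg_of_derive (fun y => (exp y - exp (- y)) / 2 - y) (fun y => (exp y + exp (- y)) / 2 - 1)); [lra| | |].
    + rewrite Ropp_0. lra.
    + intros z. auto_derive; [easy|]. lra.
    + intros z _. pose proof (cosh_ge1 z). lra.
  - enough (0 <= x + x ^ 3 / 2 - (exp x - exp (- x)) / 2) by lra.
    apply (nonneg_of_derive (fun y => y + y ^ 3 / 2 - (exp y - exp (- y)) / 2) (fun y => 1 + 3 * y ^ 2 / 2 - (exp y + exp (- y)) / 2)); [lra| | |].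
    + rewrite Ropp_0. lra.
    + intros z. auto_derive; [easy|]. simpl. lra.
    + intros z Hz. pose proof (C1 z ltac:(lra)). lra.
Qed.

(** The middle term is 1 / (4 sinh^2 (s/2)), which differs from 1/s^2 by a bounded amount. *)
Lemma geom_mean_bounds s : 0 < s <= 2 ->
  / s ^ 2 - 1 <= exp (- s) / (1 - exp (- s)) ^ 2 <= / s ^ 2.
Proof.
  intros Hs. pose proof (sinh_bounds (s / 2) ltac:(lra)) as [H1 H2].
  set (h := (exp (s / 2) - exp (- (s / 2))) / 2) in *. set (u := s / 2) in *.
  assert (Hu : 0 < u <= 1) by (unfold u; lra).
  assert (E : exp (- s) / (1 - exp (- s)) ^ 2 = / (4 * h ^ 2)).
  { unfold h. replace (- s) with (- u + - u) by (unfold u; field). rewrite exp_plus, exp_Ropp.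
    pose proof (exp_pos u) as He. assert (1 < exp u) by (pose proof (exp_ge_1p u); lra).
    field. repeat split; try lra; nra. }
  rewrite E. replace s with (2 * u) by (unfold u; field).
  assert (Hu2 : 0 < u ^ 2 <= 1) by (split; [apply pow_lt; lra|rewrite <- (pow1 2); apply pow_incr; lra]).
  assert (Hh : u ^ 2 <= h ^ 2) by (apply pow_incr; lra).
  split.
  - assert (Hh2 : h ^ 2 <= u ^ 2 * (1 + u ^ 2 / 2) ^ 2).
    { replace (u ^ 2 * (1 + u ^ 2 / 2) ^ 2) with ((u + u ^ 3 / 2) ^ 2) by field. apply pow_incr. lra. }
    apply (Rmult_le_reg_r (4 * h ^ 2)); [lra|]. rewrite Rinv_l by lra.
    replace ((/ (2 * u) ^ 2 - 1) * (4 * h ^ 2)) with (h ^ 2 * ((1 - 4 * u ^ 2) / u ^ 2)) by (field; lra).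
    destruct (Rle_dec (1 - 4 * u ^ 2) 0) as [Hn|Hn].
    + assert (0 <= h ^ 2 * ((4 * u ^ 2 - 1) / u ^ 2)) by (apply Rmult_le_pos; [lra|]; apply Rdiv_le_0_compat; lra).
      replace (h ^ 2 * ((1 - 4 * u ^ 2) / u ^ 2)) with (- (h ^ 2 * ((4 * u ^ 2 - 1) / u ^ 2))) by (field; lra). lra.
    + apply Rle_trans with (u ^ 2 * (1 + u ^ 2 / 2) ^ 2 * ((1 - 4 * u ^ 2) / u ^ 2)).
      * apply Rmult_le_compat_r; [apply Rdiv_le_0_compat; lra|easy].
      * replace (u ^ 2 * (1 + u ^ 2 / 2) ^ 2 * ((1 - 4 * u ^ 2) / u ^ 2)) with ((1 + u ^ 2 / 2) ^ 2 * (1 - 4 * u ^ 2)) by (field; lra).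
        set (v := u ^ 2) in *. nra.
  - apply Rinv_le_contravar; [|lra]. apply pow_lt. lra.
Qed.

Lemma arith_geom_sum b J : b <> 1 ->
  rsum (fun j => INR (S j) * b ^ S j) J = b / (1 - b) ^ 2 - b ^ J * (INR J * (b / (1 - b)) + b / (1 - b) ^ 2).
Proof.
  intros Hb. induction J as [|J IH]; [simpl; field; lra|].
  cbn [rsum]. rewrite IH, !S_INR. simpl pow. field. lra.
Qed.

Lemma geom_sum_rem a K : a <> 1 -> a / (1 - a) = rsum (fun i => a ^ S i) K + a ^ K * (a / (1 - a)).
Proof.
  intros Ha. induction K as [|K IH]; [simpl; field; lra|].
  cbn [rsum]. rewrite IH at 1. simpl pow. field. lra.
Qed.

Lemma mean_term_le j t : 0 < t -> 0 < j -> j * (exp (- (j * t)) / (1 - exp (- (j * t)))) <= / t.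
Proof.
  intros Ht Hj. assert (Hjt : 0 < j * t) by nra.
  pose proof (exp_ge_1p (j * t)) as H1. rewrite exp_Ropp. set (e := exp (j * t)) in *.
  replace (/ e / (1 - / e)) with (/ (e - 1)) by (field; lra).
  apply Rle_trans with (j * / (j * t)); [|right; field; lra].
  apply Rmult_le_compat_l; [lra|]. apply Rinv_le_contravar; lra.
Qed.

(** Expanding a/(1-a) geometrically and exchanging the sums, the row with frequency i is a sum of j
    e^(-ijt), close to 1/(it)^2. The rows thus assemble the Basel sum; the rows beyond K are kept as
    one remainder. *)
Lemma mean_split J K t : 0 < t ->
  mean J t = rsum (fun i => rsum (fun j => INR (S j) * exp (- (INR (S i) * t)) ^ S j) J) K
    + rsum (fun j => wt t (S j) ^ K * (INR (S j) * (wt t (S j) / (1 - wt t (S j))))) J.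
Proof.
  intros Ht. rewrite rsum_exchange, <- rsum_plus. apply rsum_ext. intros j _.
  pose proof (wt_bounds t j Ht) as Ha.
  rewrite (geom_sum_rem (wt t (S j)) K) at 1 by lra.
  rewrite Rmult_plus_distr_l, <- rsum_scal. f_equal; [|ring].
  apply rsum_ext. intros i _. f_equal. unfold wt. rewrite !exp_pow. f_equal. ring.
Qed.

(** The constant is 4 + 4 + 1. Each of the K <= 2/t rows is off by at most 2, one unit from
    [geom_mean_bounds] and one from truncation at J; the Basel tail times 1/t^2 is at most 4/t; the
    remainder is at most 1/t because K t >= 1. *)
Lemma mean_estimate t : 0 < t <= 1 -> exists J0, forall J, (J0 <= J)%nat ->
  Rabs (mean J t - PI ^ 2 / (6 * t ^ 2)) <= 9 / t.
Proof.
  intros Ht. destruct (nat_floor_inv t ltac:(lra)) as (m & Hm1 & Hm2).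
  set (K := S m). assert (HK : INR K = INR m + 1) by apply S_INR.
  assert (HKt1 : 1 <= INR K * t <= 2) by (rewrite HK; lra).
  (* J t^4 >= 8 makes the truncation error e^(-Jt) (J/t + 1/t^2) at most 1 in every row. *)
  destruct (nfloor_ex (8 / t ^ 4)) as [J0 HJ0]; [apply Rdiv_le_0_compat; [lra|apply pow_lt; lra]|].
  exists (S J0). intros J HJ. apply le_INR in HJ. rewrite S_INR in HJ.
  assert (HJt : 8 <= INR J * t ^ 4).
  { apply Rle_trans with (8 / t ^ 4 * t ^ 4); [right; field; lra|]. apply Rmult_le_compat_r; [apply pow_le; lra|lra]. }
  rewrite (mean_split J K t) by lra.
  assert (Hit : 0 < / t) by (apply Rinv_0_lt_compat; lra).
  assert (H2 : 0 <= rsum (fun j => wt t (S j) ^ K * (INR (S j) * (wt t (S j) / (1 - wt t (S j))))) J <= / t).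
  { split.
    - apply rsum_ge0. intros j _. pose proof (wt_bounds t j ltac:(lra)). pose proof (INR_S_pos j).
      apply Rmult_le_pos; [apply pow_le; lra|]. apply Rmult_le_pos; [lra|]. apply Rdiv_le_0_compat; lra.
    - apply Rle_trans with (rsum (fun j => / t * exp (- (INR (S j) * (INR K * t)))) J).
      + apply rsum_le. intros j _. pose proof (INR_S_pos j).
        pose proof (mean_term_le (INR (S j)) t ltac:(lra) ltac:(lra)) as H0.
        unfold wt in *. rewrite exp_pow.
        replace (INR K * - (INR (S j) * t)) with (- (INR (S j) * (INR K * t))) by ring.
        rewrite Rmult_comm. apply Rmult_le_compat_r; [left; apply exp_pos|easy].
      + rewrite rsum_scal. pose proof (geom_exp_sum (INR K * t) J ltac:(lra)) as H0.
        assert (/ (INR K * t) <= 1) by (rewrite <- Rinv_1; apply Rinv_le_contravar; lra). nra. }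
  assert (HJp : 0 < INR J) by (assert (0 < t ^ 4) by (apply pow_lt; lra); nra).
  assert (He : forall i, (i < K)%nat -> exp (- (INR (S i) * t)) ^ J * (INR J * / t + / t ^ 2) <= 1).
  { intros i _. rewrite exp_pow. pose proof (INR_S_pos i).
    assert (1 <= INR (S i)) by (rewrite S_INR; pose proof (pos_INR i); lra).
    apply Rle_trans with (exp (- (INR J * t)) * (INR J * / t + / t ^ 2)).
    - apply Rmult_le_compat_r.
      + assert (0 < / t ^ 2) by (apply Rinv_0_lt_compat, pow_lt; lra). nra.
      + apply exp_le. assert (INR J * t <= INR J * (INR (S i) * t)) by (apply Rmult_le_compat_l; nra). lra.
    - set (x := INR J * t). assert (Hx : 0 < x) by (unfold x; nra).
      assert (Hx2 : x ^ 2 / 4 <= exp x).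
      { replace (exp x) with (exp (x / 2) ^ 2) by (rewrite exp_pow; f_equal; simpl; field).
        replace (x ^ 2 / 4) with ((x / 2) ^ 2) by field. apply pow_incr. pose proof (exp_ge_1p (x / 2)). lra. }
      rewrite exp_Ropp. apply (Rmult_le_reg_l (exp x)); [apply exp_pos|].
      rewrite <- Rmult_assoc, Rinv_r, Rmult_1_l, Rmult_1_r by (pose proof (exp_pos x); lra).
      eapply Rle_trans; [|exact Hx2].
      apply (Rmult_le_reg_r (t ^ 2)); [apply pow_lt; lra|].
      replace ((INR J * / t + / t ^ 2) * t ^ 2) with (x + 1) by (unfold x; field; lra).
      replace (x ^ 2 / 4 * t ^ 2) with (x * (INR J * t ^ 3) / 4) by (unfold x; field).
      assert (t ^ 4 <= t ^ 3) by (simpl; assert (0 < t * (t * t)) by (repeat apply Rmult_lt_0_compat; lra); nra).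
      assert (t ^ 3 <= t) by (simpl; nra).
      assert (8 <= INR J * t ^ 3) by nra. assert (8 <= x) by (unfold x; nra). nra. }
  assert (H1 : forall i, (i < K)%nat -> / t ^ 2 * / INR (S i) ^ 2 - 2
      <= rsum (fun j => INR (S j) * exp (- (INR (S i) * t)) ^ S j) J <= / t ^ 2 * / INR (S i) ^ 2).
  { intros i Hi. pose proof (INR_S_pos i) as Hp. set (s := INR (S i) * t).
    assert (HiK : INR (S i) <= INR K) by (apply le_INR; lia).
    assert (1 <= INR (S i)) by (rewrite S_INR; pose proof (pos_INR i); lra).
    assert (Hs : t <= s <= 2) by (unfold s; split; nra).
    pose proof (geom_mean_bounds s ltac:(lra)) as Hb. specialize (He i Hi). fold s in He.
    assert (Hb1 : exp (- s) < 1) by (rewrite <- exp_0; apply exp_increasing; lra).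
    pose proof (exp_pos (- s)) as Hb0.
    rewrite arith_geom_sum by lra. set (b := exp (- s)) in *.
    replace (/ t ^ 2 * / INR (S i) ^ 2) with (/ s ^ 2) by (unfold s; field; lra).
    assert (Hr : 0 <= INR J * (b / (1 - b)) + b / (1 - b) ^ 2 <= INR J * / t + / t ^ 2).
    { assert (0 <= b / (1 - b)) by (apply Rdiv_le_0_compat; lra).
      assert (0 <= b / (1 - b) ^ 2) by (apply Rdiv_le_0_compat; [lra|apply pow_lt; lra]).
      split; [nra|]. apply Rplus_le_compat.
      - apply Rmult_le_compat_l; [lra|].
        pose proof (mean_term_le 1 s ltac:(lra) ltac:(lra)) as Hq. rewrite !Rmult_1_l in Hq. fold b in Hq.
        eapply Rle_trans; [exact Hq|]. apply Rinv_le_contravar; lra.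
      - apply Rle_trans with (/ s ^ 2); [lra|]. apply Rinv_le_contravar; [apply pow_lt; lra|apply pow_incr; lra]. }
    assert (HbJ : 0 <= b ^ J) by (apply pow_le; lra).
    set (r := INR J * (b / (1 - b)) + b / (1 - b) ^ 2) in *.
    assert (0 <= b ^ J * r <= 1) by (split; [nra|]; eapply Rle_trans; [|exact He]; apply Rmult_le_compat_l; lra).
    lra. }
  assert (H3 : / t ^ 2 * rsum (fun i => / INR (S i) ^ 2) K - INR K * 2
      <= rsum (fun i => rsum (fun j => INR (S j) * exp (- (INR (S i) * t)) ^ S j) J) K
      <= / t ^ 2 * rsum (fun i => / INR (S i) ^ 2) K).
  { rewrite <- rsum_scal, <- rsum_const, <- rsum_minus. split; apply rsum_le; intros i Hi; now apply H1. }
  pose proof (basel_rate K) as HB.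
  set (B := rsum (fun i => / INR (S i) ^ 2) K) in *.
  assert (Hit2 : 0 < / t ^ 2) by (apply Rinv_0_lt_compat, pow_lt; lra).
  assert (HB2 : 4 / INR (S K) <= 4 * t).
  { rewrite S_INR. apply (Rmult_le_reg_r (INR K + 1)); [pose proof (pos_INR K); lra|].
    unfold Rdiv. rewrite Rmult_assoc, Rinv_l by (pose proof (pos_INR K); lra). nra. }
  assert (H4 : 0 <= / t ^ 2 * (PI ^ 2 / 6 - B) <= 4 * / t).
  { replace (4 * / t) with (/ t ^ 2 * (4 * t)) by (field; lra). split; [nra|]. apply Rmult_le_compat_l; lra. }
  assert (HKt : INR K * 2 <= 4 * / t).
  { apply (Rmult_le_reg_r t); [lra|]. rewrite Rmult_assoc, (Rmult_assoc 4), Rinv_l by lra. nra. }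
  replace (PI ^ 2 / (6 * t ^ 2)) with (/ t ^ 2 * (PI ^ 2 / 6 - B) + / t ^ 2 * B) by (field; lra).
  unfold Rdiv. apply Rabs_le. lra.
Qed.

(** * Ratios of consecutive partition numbers *)

Lemma continuous_modulus J t th : 0 < t -> continuous (fun th => exp (- lmod J t th)) th.
Proof.
  intros Ht. apply continuous_comp with (g := exp); [|apply continuous_derivable; auto_derive; easy].
  apply (continuous_opp (V := R_NormedModule)). now apply continuous_lmod.
Qed.

Lemma continuous_modulus_id J t th : 0 < t -> continuous (fun th => exp (- lmod J t th) * th) th.
Proof.
  intros Ht. apply (continuous_mult (K := R_AbsRing)); [now apply continuous_modulus|apply continuous_id].
Qed.

Lemma continuous_kernel c w th : 0 < w -> continuous (fun x => c * (x / (w + x ^ 2) ^ 2)) th.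
Proof.
  intros Hw. apply continuous_derivable. auto_derive.
  pose proof (pow2_ge_0 th). simpl in *. apply Rmult_integral_contrapositive_currified; nra.
Qed.

Lemma RInt_kernel c w a b : 0 < w ->
  RInt (fun x => c * (x / (w + x ^ 2) ^ 2)) a b = c * (/ (2 * (w + a ^ 2)) - / (2 * (w + b ^ 2))).
Proof.
  intros Hw.
  refine (eq_trans (RInt_derive_eq (fun x => - (c * / (2 * (w + x ^ 2)))) (fun x => c * (x / (w + x ^ 2) ^ 2)) a b
    (RInt (fun x => c * (x / (w + x ^ 2) ^ 2)) a b) _ _ _) _).
  - intros x. pose proof (pow2_ge_0 x). auto_derive; [simpl in *; nra|]. simpl. field. simpl in *. nra.
  - intros x. now apply continuous_kernel.
  - apply (RInt_correct (V := R_CompleteNormedModule)), ex_RInt_cont. intros; now apply continuous_kernel.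
  - change (- (c * / (2 * (w + b ^ 2))) - - (c * / (2 * (w + a ^ 2))) = c * (/ (2 * (w + a ^ 2)) - / (2 * (w + b ^ 2))) :> R). ring.
Qed.

(** Applied with w = t^3, this yields the O(t^3) bound for the first moment. *)
Lemma modulus_moment J t C w : 0 < t -> 0 < w -> 0 <= C ->
  (forall th, 0 <= th <= PI -> exp (- lmod J t th) * (w + th ^ 2) ^ 2 <= C * w ^ 2) ->
  RInt (fun th => exp (- lmod J t th) * th) 0 PI <= C * w.
Proof.
  intros Ht Hw HC H. pose proof PI_RGT_0.
  apply Rle_trans with (RInt (fun x => C * w ^ 2 * (x / (w + x ^ 2) ^ 2)) 0 PI).
  - apply RInt_le; [lra| | |].
    + apply ex_RInt_cont. intros; now apply continuous_modulus_id.
    + apply ex_RInt_cont. intros; now apply continuous_kernel.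
    + intros th Hth. specialize (H th ltac:(lra)).
      assert (Hd : 0 < (w + th ^ 2) ^ 2) by (apply pow_lt; pose proof (pow2_ge_0 th); lra).
      apply (Rmult_le_reg_r ((w + th ^ 2) ^ 2)); [easy|].
      replace (C * w ^ 2 * (th / (w + th ^ 2) ^ 2) * (w + th ^ 2) ^ 2) with (C * w ^ 2 * th) by (field; pose proof (pow2_ge_0 th); lra).
      nra.
  - rewrite RInt_kernel by easy.
    assert (0 < / (2 * (w + PI ^ 2))) by (apply Rinv_0_lt_compat; pose proof (pow2_ge_0 PI); lra).
    replace (C * w) with (C * w ^ 2 * / w) by (field; lra).
    apply Rmult_le_compat_l; [apply Rmult_le_pos; [lra|apply pow2_ge_0]|].
    replace (w + 0 ^ 2) with w by ring.
    assert (/ (2 * w) <= / w) by (apply Rinv_le_contravar; lra). lra.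
Qed.

Lemma modulus_tail J t y C w h : 0 < t -> 0 < w -> 0 <= C -> 0 < h <= PI ->
  (forall th, 0 <= th <= PI -> exp (- lmod J t th) * (w + th ^ 2) ^ 2 <= C * w ^ 2) ->
  - (C * w ^ 2 / (2 * h ^ 3)) <= RInt (fint J t y) h PI.
Proof.
  intros Ht Hw HC Hh H.
  (* Beyond [h] the factor x/h is at least 1; inserting it gives a kernel with an elementary
     antiderivative. *)
  apply Rle_trans with (RInt (fun x => (- (C * w ^ 2 / h)) * (x / (w + x ^ 2) ^ 2)) h PI).
  - rewrite RInt_kernel by easy.
    assert (0 < / (2 * (w + PI ^ 2))) by (apply Rinv_0_lt_compat; pose proof (pow2_ge_0 PI); lra).
    assert (Hh2 : 0 < h ^ 2) by (apply pow_lt; lra).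
    assert (Hi : / (2 * (w + h ^ 2)) <= / (2 * h ^ 2)) by (apply Rinv_le_contravar; lra).
    assert (0 <= C * w ^ 2 / h) by (apply Rdiv_le_0_compat; [apply Rmult_le_pos; [lra|apply pow2_ge_0]|lra]).
    replace (C * w ^ 2 / (2 * h ^ 3)) with (C * w ^ 2 / h * / (2 * h ^ 2)) by (field; lra). nra.
  - apply RInt_le; [lra| | |].
    + apply ex_RInt_cont. intros; now apply continuous_kernel.
    + now apply ex_RInt_fint.
    + intros th Hth. specialize (H th ltac:(lra)).
      assert (Hw2 : 0 < w + th ^ 2) by (pose proof (pow2_ge_0 th); lra).
      assert (Hd : 0 < (w + th ^ 2) ^ 2) by now apply pow_lt.
      assert (HE : exp (- lmod J t th) <= C * w ^ 2 / h * (th / (w + th ^ 2) ^ 2)).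
      { apply (Rmult_le_reg_r ((w + th ^ 2) ^ 2)); [easy|].
        replace (C * w ^ 2 / h * (th / (w + th ^ 2) ^ 2) * (w + th ^ 2) ^ 2) with (C * w ^ 2 * (th / h)) by (field; lra).
        eapply Rle_trans; [exact H|]. rewrite <- (Rmult_1_r (C * w ^ 2)) at 1.
        apply Rmult_le_compat_l; [apply Rmult_le_pos; [lra|apply pow2_ge_0]|].
        apply (Rmult_le_reg_r h); [lra|]. unfold Rdiv. rewrite Rmult_assoc, Rinv_l by lra. lra. }
      unfold fint. pose proof (COS_bound (larg J t th - y * th)). pose proof (exp_pos (- lmod J t th)). nra.
Qed.

Lemma fint_ge_near J t y th : Rabs (larg J t th - y * th) <= 1 -> exp (- lmod J t th) / 2 <= fint J t y th.
Proof.
  intros H. unfold fint. set (x := larg J t th - y * th) in *.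
  assert (Hc : cos x = cos (Rabs x)) by (unfold Rabs; destruct (Rcase_abs x); [now rewrite cos_neg|easy]).
  pose proof (one_minus_cos_le (Rabs x) (Rabs_pos x)). pose proof (Rabs_pos x).
  assert (/ 2 <= cos x) by (rewrite Hc; nra).
  pose proof (exp_pos (- lmod J t th)). nra.
Qed.

(** The interval is cut at h = s^3 and A h. Up to h the integrand is at least e0/2, from h to A h it
    is nonnegative because the phase stays below 1, and beyond A h the modulus bound limits the loss
    to e0 h/4. *)
Lemma saddle_bounds : exists C c s0, 0 < C /\ 0 < c /\ 0 < s0 /\ forall s, 0 < s <= s0 ->
  exists J0, forall J, (J0 <= J)%nat ->
    RInt (fun th => exp (- lmod J (s ^ 2) th) * th) 0 PI <= C * s ^ 6 /\
    c * s ^ 3 <= RInt (fint J (s ^ 2) (PI ^ 2 / (6 * (s ^ 2) ^ 2))) 0 PI.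
Proof.
  destruct modulus_decay as (C & HC & Hdec).
  set (e0 := exp (- 216)). assert (He0 : 0 < e0) by apply exp_pos.
  (* Chosen so that 2 C <= e0 A^3, which makes the tail at most half of the main contribution. *)
  set (A := 1 + 2 * C / e0). assert (HCe : 0 < C / e0) by now apply Rdiv_lt_0_compat.
  assert (HA : 1 <= A) by (unfold A; unfold Rdiv in *; lra).
  assert (HA3 : A <= A ^ 3) by (assert (1 <= A ^ 2) by (rewrite <- (pow1 2); apply pow_incr; lra); simpl in *; nra).
  (* D s bounds the phase on [0, A h]: a cubic part 432 A^3 s and an error 9 A s in the slope. *)
  set (D := 432 * A ^ 3 + 9 * A). assert (HD : 1 <= D) by (unfold D; lra).
  exists C, (e0 / 4), (/ (3 * D)).
  assert (Hs0 : 0 < / (3 * D)) by (apply Rinv_0_lt_compat; lra).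
  repeat split; [easy|lra|easy|]. intros s Hs.
  assert (HDs : D * s <= 1 / 3).
  { apply Rle_trans with (D * / (3 * D)); [apply Rmult_le_compat_l; lra|right; field; lra]. }
  assert (Hs3 : s <= 1 / 3) by nra.
  set (t := s ^ 2). assert (Ht : 0 < t <= 1 / 6) by (unfold t; split; [apply pow_lt; lra|simpl; nra]).
  destruct (nat_floor_inv t ltac:(lra)) as (m & Hm1 & Hm2).
  destruct (mean_estimate t ltac:(lra)) as [J1 HJ1].
  exists (Nat.max m J1). intros J HJ. specialize (HJ1 J ltac:(lia)).
  set (w := s ^ 6). assert (Hw : 0 < w) by (apply pow_lt; lra).
  assert (Hd : forall th, 0 <= th <= PI -> exp (- lmod J t th) * (w + th ^ 2) ^ 2 <= C * w ^ 2).
  { intros th Hth. pose proof (Hdec t Ht m J th Hm1 Hm2 ltac:(lia) Hth) as H.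
    replace (t ^ 3) with w in H by (unfold t, w; ring). replace (t ^ 6) with (w ^ 2) in H by (unfold t, w; ring). easy. }
  split; [apply modulus_moment; [lra|easy|lra|easy]|].
  set (y := PI ^ 2 / (6 * t ^ 2)) in *.
  set (h := s ^ 3). assert (Hh : 0 < h) by (apply pow_lt; lra).
  assert (Hhs : h <= s) by (unfold h; simpl; nra).
  assert (HAD : A <= D) by (unfold D; lra).
  assert (HAh : A * h <= 1) by nra. pose proof PI2_3_2 as HPI.
  assert (Hphase : forall th, 0 <= th <= A * h -> Rabs (larg J t th - y * th) <= 1).
  { intros th Hth. replace (larg J t th - y * th) with ((larg J t th - mean J t * th) + (mean J t - y) * th) by ring.
    eapply Rle_trans; [apply Rabs_triang|]. rewrite Rabs_mult, (Rabs_pos_eq th) by lra.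
    pose proof (larg_bound J t th ltac:(lra) ltac:(lra)) as H1.
    assert (H2 : 432 * th ^ 3 / t ^ 4 <= 432 * A ^ 3 * s).
    { replace (432 * A ^ 3 * s) with (432 * (A * h) ^ 3 / t ^ 4) by (unfold h, t; field; lra).
      unfold Rdiv. apply Rmult_le_compat_r; [left; apply Rinv_0_lt_compat, pow_lt; lra|].
      apply Rmult_le_compat_l; [lra|]. apply pow_incr; lra. }
    assert (H3 : Rabs (mean J t - y) * th <= 9 * A * s).
    { replace (9 * A * s) with (9 / t * (A * h)) by (unfold h, t; field; lra).
      apply Rmult_le_compat; [apply Rabs_pos|lra|easy|lra]. }
    unfold D in HDs. lra. }
  assert (Ex : forall a b, ex_RInt (fint J t y) a b) by (intros; apply ex_RInt_fint; lra).
  rewrite <- (RInt_Chasles (V := R_CompleteNormedModule) _ 0 (A * h) PI) by apply Ex.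
  rewrite <- (RInt_Chasles (V := R_CompleteNormedModule) _ 0 h (A * h)) by apply Ex.
  unfold plus; simpl.
  assert (I1 : e0 / 2 * h <= RInt (fint J t y) 0 h).
  { replace (e0 / 2 * h) with (RInt (fun _ => e0 / 2) 0 h)
      by (rewrite (RInt_const (V := R_CompleteNormedModule)); unfold scal; simpl; unfold mult; simpl; ring).
    apply RInt_le; [lra|apply (ex_RInt_const (V := R_NormedModule))|apply Ex|].
    intros th Hth. eapply Rle_trans; [|apply fint_ge_near, Hphase; nra].
    enough (e0 <= exp (- lmod J t th)) by lra. apply exp_le.
    pose proof (lmod_le J t th ltac:(lra) ltac:(lra)) as H.
    enough (216 * th ^ 2 / t ^ 3 <= 216) by lra.
    replace 216 with (216 * h ^ 2 / t ^ 3) at 2 by (unfold h, t; field; lra).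
    unfold Rdiv. apply Rmult_le_compat_r; [left; apply Rinv_0_lt_compat, pow_lt; lra|].
    apply Rmult_le_compat_l; [lra|]. apply pow_incr; lra. }
  assert (I2 : 0 <= RInt (fint J t y) h (A * h)).
  { apply RInt_ge_0; [nra|apply Ex|]. intros th Hth.
    eapply Rle_trans; [|apply fint_ge_near, Hphase; lra]. pose proof (exp_pos (- lmod J t th)); lra. }
  pose proof (modulus_tail J t y C w (A * h) ltac:(lra) Hw ltac:(lra) ltac:(nra) Hd) as I3.
  assert (I4 : C * w ^ 2 / (2 * (A * h) ^ 3) <= e0 / 4 * h).
  { replace (C * w ^ 2 / (2 * (A * h) ^ 3)) with (C / (2 * A ^ 3) * h) by (unfold w, h; field; lra).
    apply Rmult_le_compat_r; [lra|].
    apply (Rmult_le_reg_r (2 * A ^ 3)); [lra|].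
    replace (C / (2 * A ^ 3) * (2 * A ^ 3)) with C by (field; lra).
    assert (e0 * A = e0 + 2 * C) by (unfold A; field; lra).
    assert (e0 * A <= e0 * A ^ 3) by (apply Rmult_le_compat_l; lra). lra. }
  lra.
Qed.

Lemma cos_lipschitz x d : 0 <= d -> Rabs (cos (x + d) - cos x) <= d.
Proof.
  intros Hd. rewrite form2. replace ((x + d - x) / 2) with (d / 2) by field.
  rewrite !Rabs_mult. replace (Rabs (-2)) with 2 by (rewrite Rabs_left; lra).
  assert (H1 : Rabs (sin (d / 2)) <= d / 2).
  { pose proof (sin_sq_le (d / 2) ltac:(lra)) as H. apply Rabs_le. split; nra. }
  pose proof (SIN_bound ((x + d + x) / 2)) as H2.
  assert (H3 : Rabs (sin ((x + d + x) / 2)) <= 1) by (apply Rabs_le; lra).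
  pose proof (Rabs_pos (sin (d / 2))). pose proof (Rabs_pos (sin ((x + d + x) / 2))). nra.
Qed.

(** Passing from y to y - 1 rotates the phase by th, and the cosine is 1-Lipschitz. *)
Lemma fint_shift_bound J t y : 0 < t ->
  Rabs (RInt (fint J t (y - 1)) 0 PI - RInt (fint J t y) 0 PI) <= RInt (fun th => exp (- lmod J t th) * th) 0 PI.
Proof.
  intros Ht. pose proof PI_RGT_0.
  change (RInt (fint J t (y - 1)) 0 PI - RInt (fint J t y) 0 PI)
    with (minus (RInt (fint J t (y - 1)) 0 PI) (RInt (fint J t y) 0 PI)).
  rewrite <- (RInt_minus (V := R_CompleteNormedModule)) by now apply ex_RInt_fint.
  eapply Rle_trans; [apply abs_RInt_le; [lra|apply (ex_RInt_minus (V := R_NormedModule)); now apply ex_RInt_fint]|].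
  apply RInt_le; [lra| | |].
  - apply ex_RInt_cont. intros x.
    apply continuous_comp with (g := Rabs); [|apply continuous_Rabs].
    apply (continuous_minus (V := R_NormedModule)); now apply continuous_fint.
  - apply ex_RInt_cont. intros; now apply continuous_modulus_id.
  - intros th Hth. unfold minus, plus, opp; simpl. unfold fint.
    replace (exp (- lmod J t th) * cos (larg J t th - (y - 1) * th) + - (exp (- lmod J t th) * cos (larg J t th - y * th)))
      with (exp (- lmod J t th) * (cos (larg J t th - y * th + th) - cos (larg J t th - y * th)))
      by (replace (larg J t th - (y - 1) * th) with (larg J t th - y * th + th) by ring; ring).
    rewrite Rabs_mult, Rabs_pos_eq by (left; apply exp_pos).
    apply Rmult_le_compat_l; [left; apply exp_pos|]. apply cos_lipschitz; lra.
Qed.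

(** * Comparison of consecutive partition numbers *)

(** The solution t of x = PI^2/(6 t^2), where the mean matches the target x to leading order. *)
Definition rate (x : R) : R := PI / sqrt (6 * x).

Lemma rate_pos x : 0 < x -> 0 < rate x.
Proof. intros Hx. apply Rdiv_lt_0_compat; [apply PI_RGT_0|apply sqrt_lt_R0; lra]. Qed.

Lemma rate_sq x : 0 < x -> x * rate x ^ 2 = PI ^ 2 / 6.
Proof.
  intros Hx. unfold rate. pose proof (sqrt_lt_R0 (6 * x) ltac:(lra)).
  replace ((PI / sqrt (6 * x)) ^ 2) with (PI ^ 2 / (sqrt (6 * x) ^ 2)) by (field; lra).
  rewrite pow2_sqrt by lra. field. lra.
Qed.

Lemma normc_pos J t : 0 < t -> 0 < normc J t.
Proof.
  intros Ht. induction J as [|J IH]; simpl; [lra|]. pose proof (wt_bounds t J Ht).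
  apply Rmult_lt_0_compat; lra.
Qed.

(** Both integrals carry the same factor [X], apart from the e^(s^2) caused by the unit shift.
    Dividing the moment C s^6 by the lower bound c s^3 for X p(M) leaves a relative error of order
    s^3. *)
Lemma partition_ratio : exists K s0, 0 < K /\ 0 < s0 /\ forall (M : nat) s, (0 < M)%nat ->
  0 < s <= s0 -> s ^ 2 = rate (INR M) ->
  0 < IZR (pz (Z.of_nat M)) /\
  Rabs (exp (s ^ 2) * IZR (pz (Z.of_nat M - 1)) - IZR (pz (Z.of_nat M))) <= K * s ^ 3 * IZR (pz (Z.of_nat M)).
Proof.
  destruct saddle_bounds as (C & c & s0 & HC & Hc & Hs0 & H).
  exists (C / c), s0. split; [now apply Rdiv_lt_0_compat|split; [easy|]].
  intros M s HM0 Hs Es. destruct (H s Hs) as [J0 HJ0].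
  assert (HM : 0 < INR M) by (now apply lt_0_INR).
  assert (Ht : 0 < s ^ 2) by (apply pow_lt; lra).
  (* J >= M turns [pk J] into [pz] at both M and M - 1. *)
  destruct (HJ0 (Nat.max J0 M) ltac:(lia)) as [A1 A2]. set (J := Nat.max J0 M) in *.
  assert (Ey : PI ^ 2 / (6 * (s ^ 2) ^ 2) = IZR (Z.of_nat M)).
  { rewrite <- INR_IZR_INZ. pose proof (rate_sq (INR M) HM) as E. rewrite <- Es in E.
    apply (Rmult_eq_reg_r ((s ^ 2) ^ 2)); [|apply pow_nonzero; lra]. rewrite E. field. lra. }
  rewrite Ey in A2.
  pose proof (fcoef_pk J (s ^ 2) (Z.of_nat M) Ht) as F1. unfold fcoef in F1. rewrite F1 in A2.
  rewrite (pk_stable J (Z.of_nat M)) in * by (unfold J; lia).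
  set (X := PI * normc J (s ^ 2) * exp (- (IZR (Z.of_nat M) * s ^ 2))) in *.
  assert (HX : 0 < X).
  { unfold X. pose proof PI_RGT_0. pose proof (normc_pos J (s ^ 2) Ht).
    apply Rmult_lt_0_compat; [apply Rmult_lt_0_compat; lra|apply exp_pos]. }
  assert (Hs3 : 0 < s ^ 3) by (apply pow_lt; lra).
  set (P := IZR (pz (Z.of_nat M))) in *.
  assert (HP : 0 < P) by (assert (0 < X * P) by nra; nra).
  split; [easy|].
  pose proof (fint_shift_bound J (s ^ 2) (IZR (Z.of_nat M)) Ht) as F2.
  pose proof (fcoef_pk J (s ^ 2) (Z.of_nat M - 1) Ht) as F3. unfold fcoef in F3. rewrite minus_IZR in F3.
  rewrite F1, F3 in F2. rewrite (pk_stable J (Z.of_nat M - 1)) in F2 by (unfold J; lia).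
  replace (exp (- ((IZR (Z.of_nat M) - 1) * s ^ 2))) with (exp (- (IZR (Z.of_nat M) * s ^ 2)) * exp (s ^ 2)) in F2
    by (rewrite <- exp_plus; f_equal; ring).
  replace (PI * normc J (s ^ 2) * (exp (- (IZR (Z.of_nat M) * s ^ 2)) * exp (s ^ 2)) * IZR (pz (Z.of_nat M - 1)) - X * P)
    with (X * (exp (s ^ 2) * IZR (pz (Z.of_nat M - 1)) - P)) in F2 by (unfold X; ring).
  rewrite Rabs_mult, (Rabs_pos_eq X) in F2 by lra.
  set (d := Rabs (exp (s ^ 2) * IZR (pz (Z.of_nat M - 1)) - P)) in *.
  apply (Rmult_le_reg_l X); [easy|].
  apply Rle_trans with (C * s ^ 6); [lra|].
  replace (C * s ^ 6) with (C / c * s ^ 3 * (c * s ^ 3)) by (field; lra).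
  replace (X * (C / c * s ^ 3 * P)) with (C / c * s ^ 3 * (X * P)) by ring.
  apply Rmult_le_compat_l; [|easy]. apply Rmult_le_pos; [left; now apply Rdiv_lt_0_compat|lra].
Qed.

(** * Total variation and the main theorem *)

(** Multiplying by 1 - q cancels the factor belonging to the part 1, which has to be present, hence
    the index S k; the remaining product still has nonnegative coefficients. *)
Lemma pk_step_nonneg k n : (0 <= pk (S k) n - pk (S k) (n - 1))%Z.
Proof.
  revert n. induction k as [|k IH]; intros n.
  - rewrite (pk_S 0 n). replace (n - Z.of_nat 1)%Z with (n - 1)%Z by lia.
    unfold pk at 1; simpl. destruct (Z.eqb_spec n 0); lia.
  - assert (K : forall b n, (n < Z.of_nat b -> 0 <= pk (S (S k)) n - pk (S (S k)) (n - 1))%Z).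
    { clear n. induction b as [|b IHb]; intros n Hn.
      - rewrite !pk_neg by lia. lia.
      - rewrite (pk_S (S k) n), (pk_S (S k) (n - 1)).
        specialize (IH n). specialize (IHb (n - Z.of_nat (S (S k)))%Z ltac:(lia)).
        replace (n - 1 - Z.of_nat (S (S k)))%Z with (n - Z.of_nat (S (S k)) - 1)%Z by lia. lia. }
    apply (K (S (Z.to_nat n))). lia.
Qed.

Lemma pz_mono n : (pz (n - 1) <= pz n)%Z.
Proof.
  rewrite <- (pk_stable (S (Z.to_nat n)) n), <- (pk_stable (S (Z.to_nat n)) (n - 1)) by lia.
  pose proof (pk_step_nonneg (Z.to_nat n) n). lia.
Qed.

Lemma pz_nonneg n : (0 <= pz n)%Z.
Proof.
  assert (K : forall b n, (n < Z.of_nat b -> 0 <= pz n)%Z).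
  { clear n. induction b as [|b IH]; intros n Hn; [rewrite pz_neg by lia; lia|].
    pose proof (pz_mono n). specialize (IH (n - 1)%Z ltac:(lia)). lia. }
  apply (K (S (Z.to_nat n))). lia.
Qed.

Lemma exp_diff_le x y z : x <= z -> y <= z -> Rabs (exp x - exp y) <= Rabs (x - y) * exp z.
Proof.
  assert (W : forall x y, x <= y -> y <= z -> Rabs (exp x - exp y) <= Rabs (x - y) * exp z).
  { clear x y. intros x y Hxy Hy. pose proof (exp_le x y Hxy). rewrite !Rabs_left1 by lra.
    replace (exp x) with (exp y * exp (x - y)) by (rewrite <- exp_plus; f_equal; ring).
    pose proof (exp_ge_1p (x - y)). pose proof (exp_pos y). pose proof (exp_le y z Hy). nra. }
  intros Hx Hy. destruct (Rle_dec x y) as [H|H]; [now apply W|].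
  rewrite (Rabs_minus_sym (exp x)), (Rabs_minus_sym x). apply W; lra.
Qed.

Lemma ln_1p_abs e : Rabs e <= 1 / 2 -> Rabs (ln (1 + e)) <= 2 * Rabs e.
Proof.
  intros He. apply Rabs_le_between in He.
  pose proof (ln_1p_ge e ltac:(lra)) as H1.
  assert (H2 : ln (1 + e) <= e).
  { rewrite <- (ln_exp e) at 2. apply ln_le; [lra|]. apply exp_ge_1p. }
  assert (H3 : - (2 * Rabs e) <= e / (1 + e)).
  { apply (Rmult_le_reg_r (1 + e)); [lra|]. unfold Rdiv. rewrite Rmult_assoc, Rinv_l, Rmult_1_r by lra.
    unfold Rabs. destruct (Rcase_abs e); nra. }
  pose proof (Rabs_pos e). pose proof (Rle_abs e). apply Rabs_le. lra.
Qed.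

(** N is of order s^(-4), so i of order s^(-3) is a fraction u <= 2 s of N. From (1+u)^2 (1-u) >= 1
    the rate grows at most by the factor 1 + u. *)
Lemma rate_near N i s : 0 < s <= 1 / 4 -> 0 < N -> 0 <= i -> s ^ 2 = rate N -> i <= / s ^ 3 + 1 ->
  i <= N / 2 /\ s ^ 2 <= rate (N - i) <= s ^ 2 + 2 * s ^ 3.
Proof.
  intros Hs HN Hi Es Hi'.
  pose proof (rate_sq N HN) as EN. rewrite <- Es in EN.
  assert (Hs3 : 0 < s ^ 3) by (apply pow_lt; lra).
  assert (Hs4 : 0 < s ^ 4) by (apply pow_lt; lra).
  assert (HPI : 3 / 2 <= PI ^ 2 / 6) by (pose proof PI2_3_2; nra).
  assert (His : i * s ^ 3 <= 2).
  { apply Rle_trans with ((/ s ^ 3 + 1) * s ^ 3); [apply Rmult_le_compat_r; lra|].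
    rewrite Rmult_plus_distr_r, Rinv_l by lra. assert (s ^ 3 <= 1 ^ 3) by (apply pow_incr; lra). lra. }
  assert (HNs : 3 / 2 <= N * s ^ 4) by (replace (N * s ^ 4) with (N * (s ^ 2) ^ 2) by ring; lra).
  assert (Hu : i <= 2 * s * N).
  { apply (Rmult_le_reg_r (s ^ 3)); [easy|]. replace (2 * s * N * s ^ 3) with (2 * (N * s ^ 4)) by ring. lra. }
  assert (Hi2 : i <= N / 2) by nra.
  split; [easy|].
  assert (HM : 0 < N - i) by lra.
  pose proof (rate_sq (N - i) HM) as EM. pose proof (rate_pos (N - i) HM) as Hp.
  set (t' := rate (N - i)) in *. set (t := s ^ 2) in *.
  assert (Ht : 0 < t) by (apply pow_lt; lra).
  rewrite <- EN in EM.
  split.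
  - destruct (Rle_dec t t') as [|Hn]; [easy|exfalso]. assert (t' ^ 2 < t ^ 2) by nra.
    assert ((N - i) * t' ^ 2 <= N * t' ^ 2) by (apply Rmult_le_compat_r; [apply pow2_ge_0|lra]). nra.
  - set (u := i / N).
    assert (Ei : i = u * N) by (unfold u; field; lra).
    assert (Hu0 : 0 <= u) by (apply Rdiv_le_0_compat; lra).
    assert (Hu1 : u <= 2 * s) by (apply (Rmult_le_reg_r N); lra).
    assert (Hle : t' <= t * (1 + u)).
    { destruct (Rle_dec t' (t * (1 + u))) as [|Hn]; [easy|exfalso].
      assert (Hsq : (t * (1 + u)) ^ 2 < t' ^ 2).
      { assert (0 < t * (1 + u)) by nra. nra. }
      assert (Hc : (1 - u) * t' ^ 2 = t ^ 2).
      { apply (Rmult_eq_reg_l N); [|lra]. rewrite <- EM, Ei. ring. }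
      assert (1 <= (1 + u) ^ 2 * (1 - u)) by (simpl; nra).
      assert ((1 - u) * (t * (1 + u)) ^ 2 < (1 - u) * t' ^ 2) by (apply Rmult_lt_compat_l; lra).
      replace ((1 - u) * (t * (1 + u)) ^ 2) with (t ^ 2 * ((1 + u) ^ 2 * (1 - u))) in * by ring.
      assert (0 < t ^ 2) by (apply pow_lt; lra). nra. }
    eapply Rle_trans; [exact Hle|]. replace (2 * s ^ 3) with (t * (2 * s)) by (unfold t; ring). nra.
Qed.

(** Uniform version at N - i with the exponent frozen at s^2. The drift of the rate costs 2 s^3. The
    local parameter s' is at most 2 s, so the relative error is at most 8 K s^3, and taking the
    logarithm doubles it. *)
Lemma partition_log_ratio : exists K s1, 0 < K /\ 0 < s1 /\ forall (N : nat) s, (0 < N)%nat ->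
  0 < s <= s1 -> s ^ 2 = rate (INR N) -> forall i : nat, INR i <= / s ^ 3 + 1 ->
  0 < IZR (pz (Z.of_nat N - Z.of_nat i)) /\ exists d, Rabs d <= K * s ^ 3 /\
    IZR (pz (Z.of_nat N - Z.of_nat i - 1)) = IZR (pz (Z.of_nat N - Z.of_nat i)) * exp (- s ^ 2 + d).
Proof.
  destruct partition_ratio as (K & s0 & HK & Hs0 & H).
  (* In turn: the hypothesis of [rate_near], s' <= 2 s <= s0, and a relative error of at most
     1/2. *)
  set (s1 := Rmin (1 / 4) (Rmin (s0 / 2) (/ (16 * K)))).
  assert (Hi16 : 0 < / (16 * K)) by (apply Rinv_0_lt_compat; lra).
  exists (2 + 16 * K), s1. split; [lra|]. split; [unfold s1; repeat apply Rmin_glb_lt; lra|].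
  intros N s HN Hs Es i Hi.
  assert (Hs' : s <= 1 / 4 /\ s <= s0 / 2 /\ s <= / (16 * K)).
  { unfold s1 in Hs. pose proof (Rmin_l (1 / 4) (Rmin (s0 / 2) (/ (16 * K)))).
    pose proof (Rmin_r (1 / 4) (Rmin (s0 / 2) (/ (16 * K)))).
    pose proof (Rmin_l (s0 / 2) (/ (16 * K))). pose proof (Rmin_r (s0 / 2) (/ (16 * K))). lra. }
  assert (HN' : 0 < INR N) by now apply lt_0_INR.
  destruct (rate_near (INR N) (INR i) s ltac:(lra) HN' (pos_INR i) Es Hi) as [HiN [Hr1 Hr2]].
  assert (HiN' : (i < N)%nat) by (apply INR_lt; lra).
  rewrite <- minus_INR in Hr1, Hr2 by lia.
  set (M := (N - i)%nat) in *.
  replace (Z.of_nat N - Z.of_nat i)%Z with (Z.of_nat M) by (unfold M; lia).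
  assert (HM : (0 < M)%nat) by (unfold M; lia).
  set (t' := rate (INR M)) in *. set (s' := sqrt t').
  assert (Ht : 0 < s ^ 2) by (apply pow_lt; lra).
  assert (Es' : s' ^ 2 = t') by (apply pow2_sqrt; lra).
  assert (Hs3 : 0 < s ^ 3) by (apply pow_lt; lra).
  assert (Hs'0 : 0 < s') by (apply sqrt_lt_R0; lra).
  assert (Hs'1 : s' <= 2 * s).
  { destruct (Rle_dec s' (2 * s)) as [|Hn]; [easy|exfalso].
    assert ((2 * s) ^ 2 < s' ^ 2) by nra. rewrite Es' in *. simpl in *. nra. }
  destruct (H M s' HM ltac:(lra) Es') as [HP HD]. rewrite Es' in HD.
  split; [easy|]. set (P := IZR (pz (Z.of_nat M))) in *. set (P' := IZR (pz (Z.of_nat M - 1))) in *.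
  set (e := exp t' * P' / P - 1).
  assert (He : Rabs e <= 8 * K * s ^ 3).
  { unfold e. replace (exp t' * P' / P - 1) with ((exp t' * P' - P) / P) by (field; lra).
    unfold Rdiv. rewrite Rabs_mult, (Rabs_pos_eq (/ P)) by (left; now apply Rinv_0_lt_compat).
    apply (Rmult_le_reg_r P); [easy|]. rewrite Rmult_assoc, Rinv_l, Rmult_1_r by lra.
    eapply Rle_trans; [exact HD|]. apply Rmult_le_compat_r; [lra|].
    replace (8 * K * s ^ 3) with (K * (2 * s) ^ 3) by ring. apply Rmult_le_compat_l; [lra|].
    apply pow_incr. lra. }
  assert (HKs : K * s <= / 16).
  { apply Rle_trans with (K * / (16 * K)); [apply Rmult_le_compat_l; lra|right; field; lra]. }
  assert (Hk3 : 8 * K * s ^ 3 <= 1 / 2).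
  { replace (8 * K * s ^ 3) with (8 * (K * s) * s ^ 2) by ring. assert (s ^ 2 <= 1) by (simpl; nra). nra. }
  pose proof (ln_1p_abs e ltac:(lra)) as Hl.
  assert (He' : 0 < 1 + e) by (pose proof (Rle_abs (- e)) as Ha; rewrite Rabs_Ropp in Ha; lra).
  exists (s ^ 2 - t' + ln (1 + e)). split.
  - eapply Rle_trans; [apply Rabs_triang|]. rewrite (Rabs_left1 (s ^ 2 - t')) by lra. lra.
  - replace (- s ^ 2 + (s ^ 2 - t' + ln (1 + e))) with (- t' + ln (1 + e)) by ring.
    rewrite exp_plus, exp_ln, exp_Ropp by easy. unfold e. pose proof (exp_pos t'). field. lra.
Qed.

Lemma rsum_recl f n : rsum f (S n) = f O + rsum (fun i => f (S i)) n.
Proof. induction n as [|n IH]; [simpl; ring|]. cbn [rsum] in *. rewrite IH. ring. Qed.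

Lemma geom_exp_sum0 s n : 0 < s -> rsum (fun i => exp (- (INR i * s))) n <= 1 + / s.
Proof.
  intros Hs. apply Rle_trans with (rsum (fun i => exp (- (INR i * s))) (S n)).
  - apply rsum_mono; [lia|]. intros; left; apply exp_pos.
  - rewrite rsum_recl. pose proof (geom_exp_sum s n Hs).
    replace (exp (- (INR 0 * s))) with 1 by (simpl; rewrite Rmult_0_l, Ropp_0, exp_0; easy). lra.
Qed.

Definition pratio (N j : nat) : R := IZR (pz (Z.of_nat N - Z.of_nat j)) / IZR (pz (Z.of_nat N)).
Definition model (lam : R) (j : nat) : R := exp (- (INR j * lam)).
Definition dev (N : nat) (lam : R) (j : nat) : R := pratio N j - model lam j.

Lemma model_anti lam i j : 0 < lam -> (i <= j)%nat -> model lam j <= model lam i.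
Proof. intros Hl Hij. apply exp_le. apply le_INR in Hij. nra. Qed.

(* Bounding the total variation, rather than the values, of the deviation makes the
   estimate uniform in [l]: the intervals [q1 n, q2 n) are disjoint for every [l]. *)
Lemma dev_variation : exists C s1, 0 < C /\ 0 < s1 /\ forall (N : nat) s, (0 < N)%nat ->
  0 < s <= s1 -> s ^ 2 = rate (INR N) -> 0 < IZR (pz (Z.of_nat N)) /\
  forall k, rsum (fun j => Rabs (dev N (s ^ 2) j - dev N (s ^ 2) (S j))) k <= C * s.
Proof.
  destruct partition_log_ratio as (K & s0 & HK & Hs0 & H).
  set (s1 := Rmin 1 (Rmin s0 (/ (2 * K)))).
  assert (Hi2 : 0 < / (2 * K)) by (apply Rinv_0_lt_compat; lra).
  exists (45 * K + 4), s1. split; [lra|]. split; [unfold s1; repeat apply Rmin_glb_lt; lra|].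
  intros N s HN Hs Es.
  assert (Hs' : s <= 1 /\ s <= s0 /\ s <= / (2 * K)).
  { unfold s1 in Hs. pose proof (Rmin_l 1 (Rmin s0 (/ (2 * K)))). pose proof (Rmin_r 1 (Rmin s0 (/ (2 * K)))).
    pose proof (Rmin_l s0 (/ (2 * K))). pose proof (Rmin_r s0 (/ (2 * K))). lra. }
  specialize (H N s HN ltac:(lra) Es).
  assert (Hs3 : 0 < s ^ 3) by (apply pow_lt; lra). assert (His3 : 0 < / s ^ 3) by now apply Rinv_0_lt_compat.
  assert (HP : 0 < IZR (pz (Z.of_nat N))).
  { destruct (H 0%nat) as [HP _]; [change (INR 0) with 0; lra|]. now rewrite Z.sub_0_r in HP. }
  split; [easy|].
  set (lam := s ^ 2) in *. assert (Hlam : 0 < lam <= 1) by (unfold lam; split; [apply pow_lt; lra|simpl; nra]).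
  set (eps := K * s ^ 3) in *. assert (Heps : 0 < eps) by (unfold eps; nra).
  assert (HKs : K * s <= / 2).
  { apply Rle_trans with (K * / (2 * K)); [apply Rmult_le_compat_l; lra|right; field; lra]. }
  (* Half of the decay e^(-j lam) thus absorbs the accumulated error e^(j eps). *)
  assert (Hel : eps <= lam / 2) by (unfold eps; replace (K * s ^ 3) with (K * s * lam) by (unfold lam; ring); nra).
  (* The cut X is of order s^(-3): within reach of the ratio estimate, and with X lam >= 1/s, so
     that both functions are O(s) there. *)
  destruct (nfloor_ex (/ s ^ 3)) as [x0 Hx0]; [lra|].
  set (X := S x0). assert (HX : / s ^ 3 <= INR X <= / s ^ 3 + 1) by (unfold X; rewrite S_INR; lra).
  assert (Hf : forall j, (j <= X)%nat -> exists d, Rabs d <= INR j * eps /\ pratio N j = exp (- (INR j * lam) + d)).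
  { induction j as [|j IH]; intros Hj.
    - exists 0. split; [rewrite Rabs_R0; simpl; lra|]. unfold pratio. simpl INR.
      rewrite Z.sub_0_r, Rmult_0_l, Ropp_0, Rplus_0_r, exp_0. field. lra.
    - destruct IH as (d & Hd & E); [lia|].
      destruct (H j) as (HPj & d' & Hd' & E'); [apply le_INR in Hj; rewrite S_INR in Hj; lra|].
      exists (d + d'). split.
      + eapply Rle_trans; [apply Rabs_triang|]. rewrite S_INR. lra.
      + unfold pratio in *. replace (Z.of_nat N - Z.of_nat (S j))%Z with (Z.of_nat N - Z.of_nat j - 1)%Z by lia.
        rewrite E'. replace (- (INR (S j) * lam) + (d + d')) with ((- (INR j * lam) + d) + (- lam + d')) by (rewrite S_INR; ring).
        rewrite (exp_plus (- (INR j * lam) + d)), <- E. field. lra. }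
  assert (Hj0 : forall j, 0 <= INR j) by apply pos_INR.
  assert (Hfg : forall j, (j < X)%nat -> Rabs (dev N lam j - dev N lam (S j)) <= 9 * eps * exp (- (INR j * (lam / 4)))).
  { intros j Hj. specialize (Hj0 j). destruct (Hf j ltac:(lia)) as (d & Hd & E).
    destruct (H j) as (HPj & d' & Hd' & E'); [apply le_INR in Hj; rewrite S_INR in Hj; lra|].
    set (f := pratio N j) in *. set (g := model lam j).
    assert (Ef : pratio N (S j) = f * exp (- lam + d')).
    { unfold f, pratio. replace (Z.of_nat N - Z.of_nat (S j))%Z with (Z.of_nat N - Z.of_nat j - 1)%Z by lia.
      rewrite E'. field. lra. }
    assert (Eg : model lam (S j) = g * exp (- lam)).
    { unfold g, model. rewrite <- exp_plus. f_equal. rewrite S_INR. ring. }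
    unfold dev. fold f g. rewrite Ef, Eg.
    (* Difference form of the product rule: the accumulated deviation times one relative step, plus
       the model times the new relative error. *)
    replace (f - g - (f * exp (- lam + d') - g * exp (- lam)))
      with ((f - g) * (1 - exp (- lam + d')) + g * (exp (- lam) - exp (- lam + d'))) by ring.
    eapply Rle_trans; [apply Rabs_triang|]. rewrite !Rabs_mult.
    pose proof (Rle_abs d') as Hd1. pose proof (Rle_abs (- d')) as Hd2. rewrite Rabs_Ropp in Hd2.
    pose proof (Rle_abs d) as Hd3.
    set (q := exp (- (INR j * (lam / 4)))). assert (Hq : 0 < q) by apply exp_pos.
    assert (B1 : Rabs (f - g) <= INR j * eps * (q * q)).
    { rewrite E. unfold g, model. eapply Rle_trans; [apply (exp_diff_le _ _ (- (INR j * (lam / 2)))); nra|].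
      replace (- (INR j * lam) + d - - (INR j * lam)) with d by ring.
      unfold q. rewrite <- exp_plus. replace (- (INR j * (lam / 4)) + - (INR j * (lam / 4))) with (- (INR j * (lam / 2))) by field.
      apply Rmult_le_compat_r; [left; apply exp_pos|easy]. }
    assert (B2 : Rabs (1 - exp (- lam + d')) <= 2 * lam).
    { rewrite <- exp_0 at 1. eapply Rle_trans; [apply (exp_diff_le _ _ 0); lra|]. rewrite exp_0, Rmult_1_r.
      apply Rabs_le. lra. }
    assert (B3 : Rabs g <= q).
    { unfold g, model, q. rewrite Rabs_pos_eq by (left; apply exp_pos). apply exp_le. nra. }
    assert (B4 : Rabs (exp (- lam) - exp (- lam + d')) <= eps).
    { eapply Rle_trans; [apply (exp_diff_le _ _ 0); lra|]. rewrite exp_0, Rmult_1_r.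
      replace (- lam - (- lam + d')) with (- d') by ring. now rewrite Rabs_Ropp. }
    (* One of the two factors [q] in [B1] pays for the factor j of the accumulated error; 2 times 4
       plus 1 gives the constant 9. *)
    assert (B5 : INR j * lam * q <= 4).
    { unfold q. rewrite exp_Ropp. pose proof (exp_ge_1p (INR j * (lam / 4))) as Hx. set (z := exp (INR j * (lam / 4))) in *.
      assert (0 < z) by apply exp_pos.
      apply (Rmult_le_reg_r z); [easy|]. rewrite Rmult_assoc, Rinv_l by lra. lra. }
    apply Rle_trans with (INR j * eps * (q * q) * (2 * lam) + q * eps).
    - apply Rplus_le_compat; apply Rmult_le_compat; try apply Rabs_pos; easy.
    - replace (INR j * eps * (q * q) * (2 * lam)) with (2 * eps * q * (INR j * lam * q)) by ring.
      assert (2 * eps * q * (INR j * lam * q) <= 2 * eps * q * 4) by (apply Rmult_le_compat_l; [nra|easy]). lra. }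
  assert (TX : rsum (fun j => Rabs (dev N lam j - dev N lam (S j))) X <= 45 * K * s).
  { eapply Rle_trans; [apply rsum_le, Hfg|]. rewrite rsum_scal.
    pose proof (geom_exp_sum0 (lam / 4) X ltac:(lra)) as Hg.
    assert (Hl4 : 1 + / (lam / 4) <= 5 * / lam).
    { replace (/ (lam / 4)) with (4 * / lam) by (field; lra). 
      assert (1 <= / lam) by (rewrite <- Rinv_1; apply Rinv_le_contravar; lra). lra. }
    replace (45 * K * s) with (9 * eps * (5 * / lam)) by (unfold eps, lam; field; lra).
    apply Rmult_le_compat_l; lra. }
  (* Beyond X both functions decrease, so the variation of their difference is at most the sum of
     their drops, which telescope; each drop is at most 2 s. *)
  assert (Tk : forall i, rsum (fun j => Rabs (dev N lam j - dev N lam (S j))) (X + i) <=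
    45 * K * s + (pratio N X - pratio N (X + i)) + (model lam X - model lam (X + i))).
  { induction i as [|i IH]; [rewrite Nat.add_0_r; lra|].
    rewrite Nat.add_succ_r. cbn [rsum]. unfold dev at 3 4.
    assert (M1 : model lam (S (X + i)) <= model lam (X + i)) by (apply model_anti; [lra|lia]).
    assert (M2 : pratio N (S (X + i)) <= pratio N (X + i)).
    { unfold pratio, Rdiv. apply Rmult_le_compat_r; [left; now apply Rinv_0_lt_compat|].
      apply IZR_le. pose proof (pz_mono (Z.of_nat N - Z.of_nat (X + i))).
      replace (Z.of_nat N - Z.of_nat (S (X + i)))%Z with (Z.of_nat N - Z.of_nat (X + i) - 1)%Z by lia. easy. }
    match goal with |- _ + Rabs ?a <= _ => assert (Rabs a <= (pratio N (X + i) - pratio N (S (X + i))) + (model lam (X + i) - model lam (S (X + i)))) by (apply Rabs_le; lra) end.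
    lra. }
  assert (HeX : exp (- (INR X * (lam / 2))) <= 2 * s).
  { assert (HXl : / s <= INR X * lam).
    { replace (/ s) with (/ s ^ 3 * lam) by (unfold lam; field; lra). apply Rmult_le_compat_r; lra. }
    rewrite exp_Ropp. pose proof (exp_ge_1p (INR X * (lam / 2))) as He.
    assert (0 < / s) by (apply Rinv_0_lt_compat; lra).
    replace (2 * s) with (/ (/ s / 2)) by (field; lra). apply Rinv_le_contravar; lra. }
  assert (HfX : pratio N X <= 2 * s).
  { destruct (Hf X ltac:(lia)) as (d & Hd & E). rewrite E. eapply Rle_trans; [|exact HeX]. apply exp_le.
    pose proof (Rle_abs d). specialize (Hj0 X). nra. }
  assert (HgX : model lam X <= 2 * s).
  { eapply Rle_trans; [|exact HeX]. apply exp_le. specialize (Hj0 X). nra. }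
  intros k. apply Rle_trans with (rsum (fun j => Rabs (dev N lam j - dev N lam (S j))) (X + k)).
  { apply rsum_mono; [lia|]. intros; apply Rabs_pos. }
  eapply Rle_trans; [apply Tk|].
  assert (0 <= pratio N (X + k)).
  { apply Rdiv_le_0_compat; [|easy]. apply IZR_le, pz_nonneg. }
  assert (0 < model lam (X + k)) by apply exp_pos. lra.
Qed.

Lemma variation_interval (d : nat -> R) a b : (a <= b)%nat ->
  Rabs (d a - d b) <= rsum (fun j => Rabs (d j - d (S j))) b - rsum (fun j => Rabs (d j - d (S j))) a.
Proof.
  intros H. induction H as [|b H IH].
  - rewrite Rminus_diag, Rabs_R0. lra.
  - cbn [rsum]. replace (d a - d (S b)) with ((d a - d b) + (d b - d (S b))) by ring.
    eapply Rle_trans; [apply Rabs_triang|]. lra.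
Qed.

Lemma q_interleave n l : (q1 n l <= q2 n l <= q1 (S n) l)%nat.
Proof. unfold q2, q1. nia. Qed.

Lemma variation_intervals (d : nat -> R) l M :
  Rabs (rsum (fun n => d (q1 n l) - d (q2 n l)) M) <= rsum (fun j => Rabs (d j - d (S j))) (q1 M l).
Proof.
  induction M as [|M IH]; [simpl; rewrite Rabs_R0; lra|].
  cbn [rsum]. eapply Rle_trans; [apply Rabs_triang|].
  pose proof (q_interleave M l) as [Q1 Q2].
  pose proof (variation_interval d _ _ Q1).
  pose proof (rsum_mono (fun j => Rabs (d j - d (S j))) _ _ Q2 ltac:(intros; apply Rabs_pos)). lra.
Qed.

(** * Return to the compositions and to the series I_M *)

Lemma IZR_zsum f n : IZR (zsum f n) = rsum (fun i => IZR (f i)) n.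
Proof. induction n as [|n IH]; [easy|]. simpl. now rewrite plus_IZR, IH. Qed.

Lemma Vd_ratio l N M : (N < M)%nat -> 0 < IZR (pz (Z.of_nat N)) ->
  INR (Vd (Z.of_nat l) (N + l * (l + 1) / 2)) / INR (part N) = rsum (fun n => pratio N (q1 n l) - pratio N (q2 n l)) M.
Proof.
  intros HM HP. rewrite !INR_IZR_INZ, Vd_conc, part_pz, (conc_formula l _ M) by lia.
  rewrite IZR_zsum. unfold Rdiv. rewrite Rmult_comm, <- rsum_scal. apply rsum_ext. intros n _.
  unfold pratio. rewrite minus_IZR. field. lra.
Qed.

(** B / (2 sqrt N) is PI / sqrt (6 N), which identifies the exponents of the series with the rate at
    N. *)
Lemma IM_term_model l N n : (0 < N)%nat ->
  IM_term l N n = model (rate (INR N)) (q1 n l) - model (rate (INR N)) (q2 n l).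
Proof.
  intros HN. apply lt_0_INR in HN. unfold IM_term, model, rate, Bconst.
  assert (E1 : Q1 n l = INR (q1 n l)).
  { unfold Q1, q1. rewrite !plus_INR, !mult_INR, plus_INR, mult_INR. simpl. ring. }
  assert (E2 : Q2 n l = INR (q2 n l)).
  { unfold Q2. rewrite E1. unfold q2. rewrite !plus_INR, !mult_INR. simpl. ring. }
  rewrite E1, E2, sqrt_mult by lra.
  pose proof (sqrt_lt_R0 6 ltac:(lra)). pose proof (sqrt_lt_R0 (INR N) HN).
  f_equal; f_equal; field; lra.
Qed.

Lemma rsum_sum_f_R0 f n : sum_f_R0 f n = rsum f (S n).
Proof. induction n as [|n IH]; [simpl; ring|]. simpl sum_f_R0. rewrite IH. reflexivity. Qed.

(** The drops over disjoint intervals add up to at most the total drop; this bounds the partial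
    sums, whose terms are nonnegative, and yields convergence. *)
Lemma model_sum_bound lam l M : 0 < lam ->
  rsum (fun n => model lam (q1 n l) - model lam (q2 n l)) M <= 1 - model lam (q1 M l).
Proof.
  intros Hl. induction M as [|M IH].
  - unfold model. simpl. rewrite Rmult_0_l, Ropp_0, exp_0. lra.
  - cbn [rsum]. pose proof (q_interleave M l) as [_ Q2]. pose proof (model_anti lam _ _ Hl Q2). lra.
Qed.

Lemma infinite_sum_IM l N : (0 < N)%nat -> exists I, infinite_sum (IM_term l N) I.
Proof.
  intros HN. set (lam := rate (INR N)).
  assert (Hl : 0 < lam) by (apply rate_pos, lt_0_INR; easy).
  destruct (Un_cv_crit (sum_f_R0 (IM_term l N))) as [I HI].
  - intros n. simpl sum_f_R0. rewrite IM_term_model by easy. fold lam.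
    pose proof (q_interleave (S n) l) as [Q1 _]. pose proof (model_anti lam _ _ Hl Q1). lra.
  - exists 1. intros x [n ->]. rewrite rsum_sum_f_R0.
    rewrite (rsum_ext _ (fun n => model lam (q1 n l) - model lam (q2 n l))) by (intros; now apply IM_term_model).
    pose proof (model_sum_bound lam l (S n) Hl). pose proof (exp_pos (- (INR (q1 (S n) l) * lam))).
    unfold model in *. lra.
  - exists I. exact HI.
Qed.

Lemma infinite_sum_close f I v c n0 : infinite_sum f I ->
  (forall n, (n0 <= n)%nat -> Rabs (v - sum_f_R0 f n) <= c) -> Rabs (v - I) <= c.
Proof.
  intros HI H. apply le_epsilon. intros e He. destruct (HI e He) as [n1 Hn].
  specialize (Hn (Nat.max n0 n1) ltac:(lia)). specialize (H (Nat.max n0 n1) ltac:(lia)).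
  unfold Rdist in Hn. set (S := sum_f_R0 f (Nat.max n0 n1)) in *.
  replace (v - I) with ((v - S) + (S - I)) by ring. eapply Rle_trans; [apply Rabs_triang|]. lra.
Qed.

(** Here N^(-1/4) is relaxed to N^(-1/5). With y = N^(-1/5) one has N y^5 = 1; if s exceeded 2 y,
    then 32 = N (2y)^5 <= N s^5 <= N s^4 = PI^2/6, a contradiction. *)
Lemma sqrt_rate_bound N s : (0 < N)%nat -> 0 < s <= 1 -> s ^ 2 = rate (INR N) -> s <= 2 * Rpower (INR N) (- (1 / 5)).
Proof.
  intros HN Hs Es. apply lt_0_INR in HN. pose proof (rate_sq (INR N) HN) as E. rewrite <- Es in E.
  set (y := Rpower (INR N) (- (1 / 5))). assert (Hy : 0 < y) by apply exp_pos.
  assert (Ey : INR N * y ^ 5 = 1).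
  { unfold y. rewrite <- Rpower_pow, Rpower_mult by apply exp_pos.
    replace (- (1 / 5) * INR 5) with (-1) by (simpl; field).
    replace (-1) with (- (1)) by ring. rewrite Rpower_Ropp, Rpower_1 by easy. field. lra. }
  destruct (Rle_dec s (2 * y)) as [|Hn]; [easy|exfalso].
  assert (H1 : (2 * y) ^ 5 <= s ^ 5) by (apply pow_incr; lra).
  assert (H2 : s ^ 5 <= s ^ 4) by (simpl; assert (0 < s * (s * (s * s))) by (repeat apply Rmult_lt_0_compat; lra); nra).
  assert (H3 : INR N * (2 * y) ^ 5 <= INR N * s ^ 4) by (apply Rmult_le_compat_l; lra).
  replace (INR N * (2 * y) ^ 5) with (32 * (INR N * y ^ 5)) in H3 by ring.
  replace (INR N * s ^ 4) with (INR N * (s ^ 2) ^ 2) in H3 by ring.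
  pose proof PI_4. pose proof PI_RGT_0. nra.
Qed.

Theorem mainTheorem7 :
  exists (C : R) (N0 : nat),
    forall (N l : nat),
      (N0 <= N)%nat ->
      INR l <= sqrt (INR N) * (ln (INR N)) ^ 2 ->
      exists IM : R,
        infinite_sum (IM_term l N) IM /\
        Rabs (INR (Vd (Z.of_nat l) (N + l * (l + 1) / 2)) / INR (part N) - IM)
          <= C * Rpower (INR N) (- (1 / 5)).
Proof.
  destruct dev_variation as (C & s1 & HC & Hs1 & H).
  set (s2 := Rmin 1 s1). assert (Hs2 : 0 < s2) by (unfold s2; apply Rmin_glb_lt; lra).
  assert (Hs4 : 0 < s2 ^ 4) by (apply pow_lt; lra).
  (* N s^4 = PI^2/6 < 3, so N s2^4 >= 3 forces s <= s2. *)
  destruct (nfloor_ex (3 / s2 ^ 4)) as [n0 Hn0]; [apply Rdiv_le_0_compat; lra|].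
  exists (C * 2), (S n0). intros N l HN _.
  assert (HN0 : (0 < N)%nat) by lia. pose proof (lt_0_INR N HN0) as HNr.
  destruct (infinite_sum_IM l N HN0) as [I HI]. exists I. split; [easy|].
  set (s := sqrt (rate (INR N))). pose proof (rate_pos (INR N) HNr) as Hr.
  assert (Es : s ^ 2 = rate (INR N)) by (apply pow2_sqrt; lra).
  assert (Hs0 : 0 < s) by (apply sqrt_lt_R0; lra).
  assert (Hs : s <= s2).
  { destruct (Rle_dec s s2) as [|Hn]; [easy|exfalso].
    pose proof (rate_sq (INR N) HNr) as E. rewrite <- Es in E.
    assert (H4 : s2 ^ 4 <= s ^ 4) by (apply pow_incr; lra).
    apply le_INR in HN. rewrite S_INR in HN.
    assert (H3 : 3 <= INR N * s2 ^ 4).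
    { apply Rle_trans with (3 / s2 ^ 4 * s2 ^ 4); [right; field; lra|]. apply Rmult_le_compat_r; lra. }
    assert (INR N * s2 ^ 4 <= INR N * s ^ 4) by (apply Rmult_le_compat_l; lra).
    replace (INR N * s ^ 4) with (INR N * (s ^ 2) ^ 2) in * by ring.
    pose proof PI_4. pose proof PI_RGT_0. nra. }
  assert (Hss : s <= 1 /\ s <= s1) by (pose proof (Rmin_l 1 s1); pose proof (Rmin_r 1 s1); unfold s2 in Hs; lra).
  destruct (H N s HN0 ltac:(lra) Es) as [HP Hv].
  apply Rle_trans with (C * s).
  (* From n = N on, the composition side equals its partial sum exactly, so comparing partial sums
     of equal length leaves only differences of [dev]. *)
  - apply (infinite_sum_close _ _ _ _ N HI). intros n Hn.
    rewrite rsum_sum_f_R0, (Vd_ratio l N (S n)) by (easy || lia). rewrite <- rsum_minus.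
    rewrite (rsum_ext _ (fun n => dev N (s ^ 2) (q1 n l) - dev N (s ^ 2) (q2 n l))).
    + eapply Rle_trans; [apply variation_intervals|apply Hv].
    + intros i _. rewrite IM_term_model by easy. unfold dev. rewrite Es. ring.
  - rewrite Rmult_assoc. apply Rmult_le_compat_l; [lra|]. apply sqrt_rate_bound; [easy|lra|easy].
Qed.
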